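(* Let $(M,g)$ be a non-flat Kasner spacetime of dimension 4 with $p_1\le p_2\le p_3<1$. Let $\mathcal{S}\subset C^\infty(\mathbb{T}^3,\mathbb{R}^8)$ be the space of solutions to the constraint equations (Maxwell's equations in the Lorenz gauge) at $t_0=1$, equipped with the subspace topology. Then there is a subset $\mathcal{A}\subset\mathcal{S}$, open and dense in $\mathcal{S}$, such that, if $\omega=\omega_tdt+\omega_jdx^j$ solves $\Box_g\omega=0$ with initial data $$(\omega_t(1),\omega_1(1),\omega_2(1),\omega_3(1),\partial_t\omega_t(1),\partial_t\omega_1(1),\partial_t\omega_2(1),\partial_t\omega_3(1))\in\mathcal{A},$$ the following holds. Let $T$ be the electromagnetic stress-energy tensor associated to $d\omega$. Then for almost every timelike geodesic $\gamma$, the energy density $T(\dot\gamma,\dot\gamma)$ along $\gamma$ blows up like $t^{-(2p_2+4p_3)}$ as $t\to0$.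
   Context: A (vacuum) Kasner spacetime is $M=(0,\infty)\times\mathbb{T}^3$ with $g=-dt\otimes dt+\sum_{i=1}^3t^{2p_i}dx^i\otimes dx^i$, where $p_1+p_2+p_3=p_1^2+p_2^2+p_3^2=1$, ordered $p_1\le p_2\le p_3$. Non-flat means $p_3<1$ (then $p_1<0<p_2$). $\Box_g\omega=\mathrm{tr}_g(\nabla^2\omega)$ for one-forms. Constraint equations at $t_0=1$ (equivalent to $\mathrm{div}\,\omega=0$ everywhere for the corresponding solution of $\Box_g\omega=0$, in which case $F=d\omega$ solves the source free Maxwell equations): at $t=1$, $$-(\partial_t\omega_t+\omega_t)+\sum_i\partial_i\omega_i=0,\qquad\sum_i\partial_i(\partial_t\omega_i-\partial_i\omega_t)=0.$$ $C^\infty(\mathbb{T}^3,\mathbb{R}^8)$ carries the $C^\infty$ topology. With $F=d\omega$, the stress-energy tensor is $T_{\alpha\beta}=\frac1{4\pi}\left(F_{\alpha\gamma}F_\beta{}^\gamma-\frac14g_{\alpha\beta}F_{\mu\nu}F^{\mu\nu}\right)$. Timelike geodesics are past directed and parametrized by proper time ($g(\dot\gamma,\dot\gamma)=-1$). For a fixed $t_*>0$, inextendible timelike geodesics are identified with the manifold $P$ of past directed unit timelike vectors with base point in the Cauchy surface $\{t_*\}\times\mathbb{T}^3$. ''Almost every timelike geodesic'' means: all except a set corresponding to a subset of measure zero in $P$. ''Blows up like $t^{-a}$ as $t\to0$'' means that along $\gamma$, $t^{a}\,T(\dot\gamma,\dot\gamma)$ converges to a positive finite limit as $t\to0$ (i.e.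 the leading order behavior is a positive constant times $t^{-a}$). *)

(* Defs.v *)
From HB Require Import structures.
From mathcomp Require Import all_boot all_order all_algebra.
From mathcomp Require Import all_classical all_reals all_analysis.
Import Order.TTheory GRing.Theory Num.Theory.
Import numFieldNormedType.Exports.

Set Implicit Arguments.
Unset Strict Implicit.
Unset Printing Implicit Defensive.

Local Open Scope classical_set_scope.
Local Open Scope ring_scope.

Section Smooth.
Variables (R : realType) (n : nat) (W : normedModType R).
Implicit Types (f : 'rV[R]_n -> W) (U : set 'rV[R]_n).

Definition partial (i : 'I_n) f : 'rV[R]_n -> W :=
  fun x => 'D_(delta_mx 0 i) f x.

Definition partials (alpha : seq 'I_n) f := foldr partial f alpha.

(* To be used with U open only. *)
Definition smooth_on U f :=
  forall (alpha : seq 'I_n) x, U x ->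
    {for x, continuous (partials alpha f)} /\
    (forall i, derivable (partials alpha f) x (delta_mx 0 i)).

End Smooth.

(* Tensor calculus in global coordinates: g is the matrix of components of a
   metric, and a one-form is given by the row vector of its components. *)
Section TensorCalculus.
Variables (R : realType) (n : nat) (g : 'rV[R]_n -> 'M[R]_n).
Implicit Types (x : 'rV[R]_n) (omega : 'rV[R]_n -> 'rV[R]_n).

Definition inv_metric x : 'M[R]_n := invmx (g x).

Definition gdot x (v w : 'rV[R]_n) : R := \sum_a \sum_b g x a b * v 0 a * w 0 b.

(* Gamma^c_{ab} *)
Definition christoffel (c a b : 'I_n) x : R :=
  2^-1 * \sum_d inv_metric x c d *
    (partial a (fun y => g y b d) x + partial b (fun y => g y a d) x
     - partial d (fun y => g y a b) x).

(* (nabla_a omega)_b *)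
Definition nabla omega (a b : 'I_n) x : R :=
  partial a (fun y => omega y 0 b) x
  - \sum_d christoffel d a b x * omega x 0 d.

(* (nabla^2_{a,b} omega)_c, a being the index of the outer derivative *)
Definition nabla2 omega (a b c : 'I_n) x : R :=
  partial a (nabla omega b c) x
  - \sum_d christoffel d a b x * nabla omega d c x
  - \sum_d christoffel d a c x * nabla omega b d x.

Definition box omega x : 'rV[R]_n :=
  \row_c \sum_a \sum_b inv_metric x a b * nabla2 omega a b c x.

(* the components (d omega)_{ab} *)
Definition ext_d omega x : 'M[R]_n :=
  \matrix_(a, b) (partial a (fun y => omega y 0 b) x
                  - partial b (fun y => omega y 0 a) x).

(* F is the component matrix F_{ab} at x of a two-form *)
Definition stress_energy x (F : 'M[R]_n) : 'M[R]_n :=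
  let h := inv_metric x in
  let F2 := \sum_m \sum_k \sum_a \sum_b h m a * h k b * F m k * F a b in
  \matrix_(a, b) ((4 * pi)^-1 *
    (\sum_c \sum_d h c d * F a c * F b d - 4^-1 * g x a b * F2)).

(* I is the parameter interval; gamma is junk outside of I *)
Definition geodesic_on (M : set 'rV[R]_n) (I : set R) (gamma : R -> 'rV[R]_n) :=
  [/\ open I, is_interval I, I !=set0 & forall s, I s ->
    [/\ M (gamma s), derivable gamma s 1, derivable (derive1 gamma) s 1 &
      forall c, derive1 (derive1 gamma) s 0 c
        + \sum_a \sum_b christoffel c a b (gamma s)
            * derive1 gamma s 0 a * derive1 gamma s 0 b = 0]].

Definition inextendible_geodesic (M : set 'rV[R]_n) (I : set R) gamma :=
  geodesic_on M I gamma /\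
  forall J eta, geodesic_on M J eta -> I `<=` J ->
    (forall s, I s -> eta s = gamma s) -> J = I.

End TensorCalculus.

(* T^3 = (R / 2 pi Z)^3. Tensor fields on (0, oo) x T^3 are represented by their
   lifts to (0, oo) x R^3, 2 pi-periodic in the space variables. Coordinate 0
   is t, and coordinate lift ord0 i is the i-th space coordinate. *)

Section Torus.
Variable R : realType.

Record torus_map := TorusMap {
  torus_fun :> 'rV[R]_3 -> 'rV[R]_8;
  torus_periodic :
    forall x i, torus_fun (x + (2 * pi) *: delta_mx 0 i) = torus_fun x;
  torus_smooth : smooth_on setT torus_fun }.

HB.instance Definition _ := gen_eqMixin torus_map.
HB.instance Definition _ := gen_choiceMixin torus_map.

Definition jet (u : torus_map) :
    prod_topology (fun _ : seq 'I_3 => {uniform 'rV[R]_3 -> 'rV[R]_8}) :=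
  fun alpha => partials alpha u.

(* The C^oo topology: uniform convergence of all partial derivatives. *)
HB.instance Definition _ := Topological.copy torus_map (initial_topology jet).

End Torus.

Section Constraints.
Variables (R : realType) (u : torus_map R).

(* The data are (omega_t, omega_1, omega_2, omega_3) followed by the
   t-derivatives of these, in the same order. *)
Definition data0 (a : 'I_4) (x : 'rV[R]_3) : R := u x 0 (lshift 4 a).
Definition data1 (a : 'I_4) (x : 'rV[R]_3) : R := u x 0 (rshift 4 a).

Definition constraints : Prop := forall x : 'rV[R]_3,
  - (data1 ord0 x + data0 ord0 x)
    + \sum_(i < 3) partial i (data0 (lift ord0 i)) x = 0 /\
  \sum_(i < 3) partial i
    (fun y => data1 (lift ord0 i) y - partial i (data0 ord0) y) x = 0.

End Constraints.

Definition constraint_solutions (R : realType) : set (torus_map R) :=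
  [set u | constraints u].

Definition open_dense_in (T : topologicalType) (S A : set T) :=
  (exists2 U, open U & A = U `&` S) /\ S `<=` closure A.

Section Kasner.
Variable R : realType.

Definition spacetime : set 'rV[R]_4 := [set x | 0 < x 0 0].

Definition spacetime_point (t : R) (x : 'rV[R]_3) : 'rV[R]_4 :=
  row_mx (t%:M : 'M[R]_1) x.

Definition one_form (omega : 'rV[R]_4 -> 'rV[R]_4) :=
  smooth_on spacetime omega /\
  forall x (i : 'I_3), spacetime x ->
    omega (x + (2 * pi) *: delta_mx 0 (lift ord0 i)) = omega x.

Definition has_data (omega : 'rV[R]_4 -> 'rV[R]_4) (u : torus_map R) :=
  forall x, u x = row_mx (omega (spacetime_point 1 x))
                         (partial ord0 omega (spacetime_point 1 x)).

Variables p1 p2 p3 : R.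

Definition kasner_exponents :=
  [/\ p1 <= p2, p2 <= p3, p1 + p2 + p3 = 1
    & p1 ^+ 2 + p2 ^+ 2 + p3 ^+ 2 = 1].

Definition kasner_metric (x : 'rV[R]_4) : 'M[R]_4 :=
  let t := x 0 0 in
  diag_mx (\row_a [:: -1; t `^ (2 * p1); t `^ (2 * p2); t `^ (2 * p3)]`_a).

(* Inextendibility is that of the lift to (0, oo) x R^3, equivalently that of
   the geodesic of (0, oo) x T^3. *)
Definition timelike_geodesic (I : set R) (gamma : R -> 'rV[R]_4) :=
  inextendible_geodesic kasner_metric spacetime I gamma /\
  forall s, I s ->
    gdot kasner_metric (gamma s) (derive1 gamma s) (derive1 gamma s) = -1 /\
    derive1 gamma s 0 0 < 0.

Definition energy_density (omega : 'rV[R]_4 -> 'rV[R]_4)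
    (gamma : R -> 'rV[R]_4) (s : R) : R :=
  let x := gamma s in
  let T := stress_energy kasner_metric x (ext_d omega x) in
  let v := derive1 gamma s in
  \sum_a \sum_b T a b * v 0 a * v 0 b.

End Kasner.

Section BlowUp.
Variable R : realType.

(* The filter "t -> 0 along gamma" on the parameter s in I. *)
Definition t_to_0 (I : set R) (gamma : R -> 'rV[R]_4) : set_system R :=
  filter_from [set d : R | 0 < d] (fun d => [set s | I s /\ gamma s 0 0 < d]).

(* E blows up like t^(-a) along gamma. Properness of the filter says that t
   does tend to 0 along gamma. *)
Definition blows_up_like (a : R) (I : set R) (gamma : R -> 'rV[R]_4)
    (E : R -> R) :=
  ProperFilter (t_to_0 I gamma) /\
  exists2 c : R, 0 < c &
    (fun s => gamma s 0 0 `^ a * E s) @ t_to_0 I gamma --> c.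

End BlowUp.

Section AlmostEvery.
Variable R : realType.
Variables p1 p2 p3 : R.
Local Notation lambda := (@lebesgue_measure R).
Local Open Scope ereal_scope.

Definition lebesgue6 := lambda \x lambda \x lambda \x lambda \x lambda \x lambda.

Local Open Scope ring_scope.

(* The unit tangent manifold P over {tstar} x T^3: base point, vector. *)
Definition unit_past (tstar : R) : set ('rV[R]_4 * 'rV[R]_4) :=
  [set q : 'rV[R]_4 * 'rV[R]_4 |
    [/\ q.1 0 0 = tstar,
        gdot (kasner_metric p1 p2 p3) q.1 q.2 q.2 = -1
      & q.2 0 0 < 0]].

(* The space coordinates of the base point and of the vector are global
   coordinates on (the lift of) the manifold P; the time component of the vector
   is determined by its space components. *)
Definition unit_past_chart (q : 'rV[R]_4 * 'rV[R]_4) :=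
  (q.1 0 1, q.1 0 2, q.1 0 3, q.2 0 1, q.2 0 2, q.2 0 3).

Definition measure_zero (tstar : R) (N : set ('rV[R]_4 * 'rV[R]_4)) :=
  N `<=` unit_past tstar /\ lebesgue6.-negligible (unit_past_chart @` N).

Definition almost_every_timelike_geodesic (tstar : R)
    (Q : set R -> (R -> 'rV[R]_4) -> Prop) :=
  measure_zero tstar [set q | exists I gamma s,
    [/\ timelike_geodesic p1 p2 p3 I gamma, I s, gamma s 0 0 = tstar,
        q = (gamma s, derive1 gamma s) & ~ Q I gamma]].

End AlmostEvery.

(* Main.v *)
Require Import Defs.
From HB Require Import structures.
From mathcomp Require Import all_boot all_order all_algebra.
From mathcomp Require Import all_classical all_reals all_analysis.
From mathcomp Require Import measurable_realfun ring lra.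
Import Order.TTheory GRing.Theory Num.Theory.
Import numFieldNormedType.Exports.
Set Implicit Arguments.
Unset Strict Implicit.
Unset Printing Implicit Defensive.
Local Open Scope classical_set_scope.
Local Open Scope ring_scope.

(* In the frame of the normalized coordinate fields, the electric and magnetic
   components of d omega and the divergence of omega satisfy a symmetric
   first-order system with damping terms of order 1/t. The energy of a solution
   and of its space derivatives grows at most like t^(-2 (1 - p_1)). Inserting
   this bound in the equations one component at a time, t^(1 - p_1) times the
   components E_1 and B_23 converges as t -> 0 to continuous profiles D and B on
   the torus, while the other components are negligible along geodesics.

   Along a timelike geodesic the momenta c_k = t^(2 p_k) x_k' are constant, and
   x converges to an endpoint x_0 as t -> 0. The rescaled energy density tends to
   (4 pi)^-1 (w_2^2 + w_3^2) (D(x_0)^2 + B(x_0)^2), where w_3 = c_3, and w_2 is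
   c_2 or 0 according to whether p_2 = p_3 or not. So it blows up at the claimed
   rate if c_3 <> 0 and D(x_0) <> 0.

   For a fixed velocity, x_0 is a translate of the base point. The zeros of D at
   which some derivative of order at most 3 does not vanish lie in countably many
   sets that meet the lines in a coordinate direction in isolated points, so the
   corresponding geodesics form a null set. It remains to exclude zeros that are
   flat to third order. The explicit solution t^(2 p_1) dx^1 adds a constant to D
   and does not change its derivatives, and by a pigeonhole argument as in
   Sard's theorem some arbitrarily small constant yields a profile without
   nearly flat near-zeros. This condition is stable under small perturbations of
   the data. *)

(** * Integrals and derivatives on the real line *)

(** All damping rates are at most [lam = 1 - p1], which is attained by E_1 and, as
    [p2 + p3 = 1 - p1], by B_23. On [t <= 1] a space derivative in the frame costs at most a factor
    [t^(-p3)]. Once its damping term is removed, [t^lam * E_1] has a derivative of size [t^(-p3)],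
    integrable at 0 because [p3 < 1]; for the other components [p1 < 0] makes the same estimate a
    decay by [t^(1 - p3)] relative to [t^(-lam)]. The squared field contributes [t^(-2 lam)] and the
    squared velocity [t^(-2 p3)], whence the exponent [2 (p2 + p3) + 2 p3].

    Order 3 comes from counting: flatness to order k on cubes of side r bounds the oscillation by
    r^(k+1), and the r^(-3) cubes can be told apart by small shifts only if k+1 > 3.

    A datum is called good if every solution with this datum blows up as claimed, and [A] consists
    of the constrained data with a neighbourhood of good ones. Openness is then automatic. Density
    is proved by shifting a nearby datum that has a solution; where there is no such datum, goodness
    is vacuous. *)

Section RealLine.
Variable R : realType.
Implicit Types (f g : R -> R) (a b : R).

(** For [b < a] the segment is empty and the value is 0, not minus the reversed integral; [prim]
    below restores the sign. *)
Definition rint a b f : R := \int[lebesgue_measure]_(t in `[a, b]) f t.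

Lemma continuous_segment_integrable f a b : continuous f ->
  lebesgue_measure.-integrable `[a, b] (EFin \o f).
Proof.
move=> cf; apply: continuous_compact_integrable; first exact: segment_compact.
exact: continuous_subspaceT.
Qed.

Lemma le_rint f g a b : continuous f -> continuous g ->
  (forall s, a <= s <= b -> f s <= g s) -> rint a b f <= rint a b g.
Proof.
move=> cf cg fg; apply: le_Rintegral => //;
  exact: continuous_segment_integrable.
Qed.

Lemma rint_cst (c : R) a b : a <= b -> rint a b (fun=> c) = c * (b - a).
Proof.
move=> ab; rewrite /rint Rintegral_cst //=.
rewrite lebesgue_measure_itv /=; case: ltP => //= h.
have -> : b = a by apply/eqP; rewrite eq_le ab -lee_fin h.
by rewrite subrr.
Qed.

Lemma rintD f g a b : continuous f -> continuous g ->
  rint a b (fun s => f s + g s) = rint a b f + rint a b g.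
Proof.
by move=> cf cg; apply: RintegralD => //; exact: continuous_segment_integrable.
Qed.

Lemma rintB f g a b : continuous f -> continuous g ->
  rint a b (fun s => f s - g s) = rint a b f - rint a b g.
Proof.
by move=> cf cg; apply: RintegralB => //; exact: continuous_segment_integrable.
Qed.

Lemma rintZ (c : R) f a b : continuous f ->
  rint a b (fun s => c * f s) = c * rint a b f.
Proof.
by move=> cf; apply: RintegralZl => //; exact: continuous_segment_integrable.
Qed.

Lemma le_norm_rint f a b (e : R) : a <= b -> continuous f ->
  (forall s, a <= s <= b -> `|f s| <= e) -> `|rint a b f| <= e * (b - a).
Proof.
move=> ab cf fe; rewrite ler_norml -mulNr -!rint_cst //.
have cc c : continuous (fun _ : R => c : R) by exact: cst_continuous.
by apply/andP; split; apply: le_rint => // s /fe; rewrite ler_norml => /andP[].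
Qed.

Lemma is_derive_continuous f g : (forall s, is_derive s (1 : R) f (g s)) ->
  continuous f.
Proof.
move=> fg s; apply: differentiable_continuous.
by apply/derivable1_diffP; case: (fg s).
Qed.

Lemma FTC2_rint f g a b : a <= b -> continuous g ->
  (forall s, is_derive s (1 : R) f (g s)) -> rint a b g = f b - f a.
Proof.
rewrite le_eqVlt => /orP[/eqP <- _ _|ab cg fg].
  by rewrite subrr /rint set_itv1 Rintegral_set1.
have cf := is_derive_continuous fg.
rewrite /rint /Rintegral (@continuous_FTC2 _ g f a b) //.
- exact: continuous_subspaceT.
- split; first by move=> x _; case: (fg x).
  + by apply: cvg_at_right_filter; exact: cf.
  + by apply: cvg_at_left_filter; exact: cf.
- by move=> x _; rewrite derive1E; case: (fg x).
Qed.

Lemma FTC1_rint f a x : a < x -> continuous f ->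
  is_derive x (1 : R) (fun y => rint a y f) (f x).
Proof.
move=> ax cf.
have [d] := @continuous_FTC1_closed R f a x (x + 1) (ltr_pwDr ltr01 (lexx x))
  (continuous_segment_integrable a (x + 1) cf) ax (cf x).
by rewrite derive1E => e; split.
Qed.

Lemma MVT_is_derive f g a b : a <= b ->
  (forall s, a <= s <= b -> is_derive s (1 : R) f (g s)) ->
  exists2 c, a <= c <= b & f b - f a = g c * (b - a).
Proof.
move=> ab fg.
have [|s |c + ?] := @MVT_segment R f g a b ab.
- by move=> s; rewrite in_itv /= => /andP[as_ sb]; apply: fg; rewrite !ltW.
- apply: derivable_within_continuous => x; rewrite in_itv /= => h.
  by case: (fg x h).
- by rewrite in_itv /= => ?; exists c.
Qed.

Lemma MVT_le f g a b (M : R) :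
  (forall s, Num.min a b <= s <= Num.max a b -> is_derive s (1 : R) f (g s)) ->
  (forall s, Num.min a b <= s <= Num.max a b -> `|g s| <= M) ->
  `|f b - f a| <= M * `|b - a|.
Proof.
wlog ab : a b / a <= b.
  move=> W; have [ab|ab] := orP (le_total a b); first exact: W.
  by rewrite distrC (distrC b) minC maxC; exact: W.
rewrite (min_idPl ab) (max_idPr ab) => fg gM.
have [c h ->] := MVT_is_derive ab fg.
by rewrite normrM ler_wpM2r //; exact: gM.
Qed.

Lemma nondecreasing_is_derive f g a b : a <= b ->
  (forall s, a <= s <= b -> is_derive s (1 : R) f (g s)) ->
  (forall s, a <= s <= b -> 0 <= g s) -> f a <= f b.
Proof.
move=> ab fg g0; have [c h e] := MVT_is_derive ab fg.
by rewrite -subr_ge0 e mulr_ge0 ?g0 // subr_ge0.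
Qed.

End RealLine.

(** * Directional derivatives and integrals along segments *)

Section Lines.
Variables (R : realType) (V W : normedModType R).

(** Both sides have the same difference quotient; this reduces partial derivatives to one real
    variable. *)
Lemma is_derive_line (f : V -> W) x v (s : R) d :
  is_derive s (1 : R) (fun s => f (x + s *: v)) d <->
  is_derive (x + s *: v) v f d.
Proof.
have E : (fun h : R => h^-1 *: ((fun s => f (x + s *: v)) (h *: 1 + s)
            - f (x + s *: v)))
       = (fun h : R => h^-1 *: (f (h *: v + (x + s *: v)) - f (x + s *: v))).
  apply/funext => h; congr (_ *: (f _ - _)).
  by rewrite scalerDl addrCA [h *: 1]mulr1.
by split; case=> D1 D2; split;
  rewrite /derivable /derive -?E // ?E //; rewrite /derivable /derive ?E in D1 D2 *.
Qed.

Lemma cvg_line (x v : V) : x + h *: v @[h --> (0 : R)] --> x.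
Proof.
rewrite -[X in _ --> X]addr0 -[X in _ --> _ + X](scale0r v).
by apply: cvgD; [exact: cvg_cst|apply: cvgZr_tmp; exact: cvg_id].
Qed.

Lemma is_derive_shift (f : V -> W) (a x v : V) d :
  is_derive x v (fun y => f (y + a)) d <-> is_derive (x + a) v f d.
Proof.
have E : (fun h : R => h^-1 *: ((fun y => f (y + a)) (h *: v + x) - f (x + a)))
       = (fun h : R => h^-1 *: (f (h *: v + (x + a)) - f (x + a))).
  by apply/funext => h; rewrite addrA.
by split; case=> D1 D2; split;
  rewrite /derivable /derive -?E // ?E //; rewrite /derivable /derive ?E in D1 D2 *.
Qed.

End Lines.

Section LineIntegral.
Variables (R : realType) (V : normedModType R).
Variables (U : set V) (v : V).
Hypothesis openU : open U.
Hypothesis shiftU : forall x (s : R), U x -> U (x + s *: v).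
Implicit Types (f g : V -> R) (x w : V) (L : R).

Definition lint L f x : R := rint 0 L (fun s => f (x + s *: v)).

Lemma line_continuous f x : (forall y, U y -> {for y, continuous f}) -> U x ->
  continuous (fun s : R => f (x + s *: v)).
Proof.
move=> cf Ux s; apply: (@continuous_comp _ _ _ (fun s : R => x + s *: v) f).
  by apply: cvgD; [exact: cvg_cst|apply: cvgZr_tmp; exact: cvg_id].
exact/cf/shiftU.
Qed.

(** For [(s', y)] near [(s, x)] both values are close to [f (x + s *: v)]; compactness of [[0, L]]
    turns this into one neighbourhood of [x] that serves all [s]. *)
Lemma tube f x (e : R) L : (forall y, U y -> {for y, continuous f}) -> U x ->
  0 < e -> \forall y \near x, forall s : R, 0 <= s <= L ->
    `|f (y + s *: v) - f (x + s *: v)| < e.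
Proof.
move=> cf Ux e0.
have /compact_near_coveringP K := @segment_compact R 0 L.
have H s : s \in `[0, L] -> \forall s' \near s & y \near x,
    `|f (y + s' *: v) - f (x + s' *: v)| < e.
  move=> _.
  have c1 : (fun q : R * V => f (q.2 + q.1 *: v)) @ (s, x) --> f (x + s *: v).
    apply: (@cvg_comp _ _ _ (fun q : R * V => q.2 + q.1 *: v) f _ (nbhs (x + s *: v))).
      by apply: cvgD; [exact: cvg_snd|apply: cvgZr_tmp; exact: cvg_fst].
    exact/cf/shiftU.
  have c2 : (fun q : R * V => f (x + q.1 *: v)) @ (s, x) --> f (x + s *: v).
    apply: (@cvg_comp _ _ _ (fun q : R * V => x + q.1 *: v) f _ (nbhs (x + s *: v))).
      by apply: cvgD; [exact: cvg_cst|apply: cvgZr_tmp; exact: cvg_fst].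
    exact/cf/shiftU.
  have D : f (q.2 + q.1 *: v) - f (x + q.1 *: v) @[q --> (s, x)] --> (0 : R).
    by rewrite -(subrr (f (x + s *: v))); exact: cvgB.
  by move/cvgr0Pnorm_lt : D => /(_ _ e0).
have := K V (nbhs x) (fun y s => `|f (y + s *: v) - f (x + s *: v)| < e)
  (nbhs_filter x) H.
by apply: filterS => y Ky s sL; apply: Ky; rewrite /= in_itv.
Unshelve. all: by end_near. Qed.

Lemma lint_continuous L f : 0 <= L -> (forall y, U y -> {for y, continuous f}) ->
  forall x, U x -> {for x, continuous (lint L f)}.
Proof.
move=> L0 cf x Ux; apply/cvgrPdist_le => /= e e0.
(* Dividing by [L + 1] rather than [L] covers the degenerate segment [L = 0]. *)
have e1 : 0 < e / (L + 1) by rewrite divr_gt0 // ltr_wpDl.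
near=> y; rewrite /lint -rintB; last 2 first.
- exact: line_continuous.
- by apply: line_continuous => //; near: y; exact: open_nbhs_nbhs.
apply: (@le_trans _ _ (e / (L + 1) * (L - 0))).
  apply: le_norm_rint => //.
  - move=> s; apply: cvgB; apply: line_continuous => //.
    by near: y; exact: open_nbhs_nbhs.
  - move=> s sL; rewrite distrC; apply: ltW; move: s sL.
    by near: y; exact: tube.
rewrite subr0 mulrAC ler_pdivrMr ?ltr_wpDl // ler_pM2l // lerDl ler01.
by [].
Unshelve. all: by end_near. Qed.

Lemma is_derive_lint L f w x : 0 <= L -> U x ->
  (forall y, U y -> {for y, continuous f}) ->
  (forall y, U y -> derivable f y w) ->
  (forall y, U y -> {for y, continuous ('D_w f)}) ->
  is_derive x w (lint L f) (lint L ('D_w f) x).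
Proof.
move=> L0 Ux cf df cdf.
suff H : h^-1 *: (lint L f (h *: w + x) - lint L f x) @[h --> (0:R)^']
    --> lint L ('D_w f) x.
  split; first by apply/cvg_ex; exists (lint L ('D_w f) x).
  exact: (cvg_lim _ H).
apply/cvgrPdist_le => /= e e0.
have e1 : 0 < e / (L + 1) by rewrite divr_gt0 // ltr_wpDl.
have [r /= r0 rP] : exists2 r : R, 0 < r & forall h, `|h| < r ->
    U (x + h *: w) /\ forall s : R, 0 <= s <= L ->
    `|'D_w f (x + h *: w + s *: v) - 'D_w f (x + s *: v)| < e / (L + 1).
  have T : \forall y \near x, U y /\ forall s : R, 0 <= s <= L ->
    `|'D_w f (y + s *: v) - 'D_w f (x + s *: v)| < e / (L + 1).
    by near=> y; split; near: y; [exact: open_nbhs_nbhs|exact: (@tube ('D_w f))].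
  have [r /= r0 rP] := (nbhs_ballP _ _).1 (cvg_line w T).
  by exists r => // h hr; apply: rP; rewrite /ball /= sub0r normrN.
near=> h.
have h0 : h != 0 by near: h; exact: nbhs_dnbhs_neq.
have hr : `|h| < r by near: h; exact: dnbhs0_lt.
have [Uh _] := rP h hr.
rewrite [h *: w + x]addrC /lint -rintB; try exact: line_continuous.
rewrite -[_ *: _]/(_ * _) -rintZ; last first.
  by move=> s; apply: cvgB; exact: line_continuous.
have cD := @line_continuous ('D_w f) x cdf Ux.
rewrite -rintB; last 2 first.
- exact: cD.
- move=> s; apply: cvgM; first exact: cvg_cst.
  by apply: cvgB; exact: line_continuous.
apply: (@le_trans _ _ (e / (L + 1) * (L - 0))); last first.
  by rewrite subr0 mulrAC ler_pdivrMr ?ltr_wpDl // ler_pM2l // lerDl ler01.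
apply: le_norm_rint => //.
  move=> s; apply: cvgB; first exact: cD.
  apply: cvgM; first exact: cvg_cst.
  by apply: cvgB; exact: line_continuous.
move=> s sL.
have E : 'D_w f (x + s *: v) - h^-1 * (f (x + h *: w + s *: v) - f (x + s *: v))
  = - h^-1 * ((f (x + s *: v + h *: w) - h * 'D_w f (x + s *: v))
      - (f (x + s *: v + 0 *: w) - 0 * 'D_w f (x + s *: v))).
  by rewrite scale0r addr0 mul0r subr0 [x + h *: w + _]addrAC; field.
rewrite E normrM normrN normfV mulrC ler_pdivrMr ?normr_gt0 //.
rewrite -[X in _ <= _ * `|X|]subr0.
have kr k : Num.min 0 h <= k <= Num.max 0 h -> `|k| < r.
  move=> /andP[]; rewrite ge_min le_max ltr_norml => k1 k2.
  move: hr; rewrite ltr_norml => /andP[h1 h2]; apply/andP; split.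
    by case/orP: k1; [apply: lt_le_trans; rewrite oppr_lt0|exact: lt_le_trans].
  by case/orP: k2 => k2; apply: le_lt_trans k2 _.
(* Subtracting the linear part makes the derivative in [k] a difference of values of ['D_w f], which
   [rP] bounds uniformly in [s]. *)
apply: (@MVT_le R (fun k => f (x + s *: v + k *: w) - k * 'D_w f (x + s *: v))
   (fun k => 'D_w f (x + s *: v + k *: w) - 'D_w f (x + s *: v))) => k kh.
- apply: is_deriveB.
    apply/is_derive_line; have : U (x + s *: v + k *: w).
      by rewrite addrAC; apply: shiftU; have [] := rP k (kr k kh).
    by split => //; exact: df.
  apply: is_derive_eq.
  by rewrite scaler0 add0r [_ *: _]mulr1.
- by rewrite [x + _ + _]addrAC; apply: ltW; have [_] := rP k (kr k kh); apply.
Unshelve. all: by end_near. Qed.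

Lemma lint_derive L f x : 0 <= L -> U x ->
  (forall y, U y -> derivable f y v) ->
  (forall y, U y -> {for y, continuous ('D_v f)}) ->
  lint L ('D_v f) x = f (x + L *: v) - f x.
Proof.
move=> L0 Ux df cdf.
have -> : f x = f (x + 0 *: v) by rewrite scale0r addr0.
apply: (@FTC2_rint R (fun s => f (x + s *: v))) => //.
  exact: (@line_continuous ('D_v f)).
by move=> s; apply/is_derive_line; split=> //; exact/df/shiftU.
Qed.

End LineIntegral.

(** * Closure properties of smooth functions and symmetry of second derivatives *)

Section SmoothClosure.
Variables (R : realType) (n : nat) (U : set 'rV[R]_n).
Hypothesis openU : open U.
Implicit Types (f g : 'rV[R]_n -> R) (x : 'rV[R]_n) (i j : 'I_n).

Local Notation e i := (delta_mx 0 i : 'rV[R]_n).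

(** [smooth_on] speaks of all orders at once and offers no induction for the Leibniz rule; the
    finite order [k] supplies one. *)
Fixpoint ck k f : Prop := (forall x, U x -> {for x, continuous f}) /\
  (if k is k'.+1 then
     forall i, (forall x, U x -> derivable f x (e i)) /\ ck k' (partial i f)
   else True).

Lemma near_eq_in f g x : (forall y, U y -> f y = g y) -> U x ->
  \forall y \near x, f y = g y.
Proof. by move=> fg Ux; near=> y; apply: fg; near: y; exact: open_nbhs_nbhs.
Unshelve. all: by end_near. Qed.

Lemma partial_eq_in f g i x : (forall y, U y -> f y = g y) -> U x ->
  partial i f x = partial i g x.
Proof. by move=> fg Ux; apply: near_eq_derive; exact: near_eq_in. Qed.

Lemma continuous_eq_in f g x : (forall y, U y -> f y = g y) -> U x ->
  {for x, continuous f} -> {for x, continuous g}.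
Proof.
move=> fg Ux cf; have {}cf : f @ x --> g x by rewrite -fg.
apply: cvg_trans cf; exact: (near_eq_cvg (near_eq_in fg Ux)).
Qed.

Lemma derivable_eq_in f g x v : (forall y, U y -> f y = g y) -> U x ->
  derivable f x v -> derivable g x v.
Proof. by move=> fg Ux; apply: near_eq_derivable; exact: near_eq_in. Qed.

Lemma ck_eq_in k f g : (forall y, U y -> f y = g y) -> ck k f -> ck k g.
Proof.
elim: k f g => [|k IH] f g fg /= [cf df]; split=> //.
- by move=> x Ux; exact: continuous_eq_in (cf x Ux).
- by move=> x Ux; exact: continuous_eq_in (cf x Ux).
- move=> i; have [dfi ckf] := df i; split.
    by move=> x Ux; exact: derivable_eq_in (dfi x Ux).
  by apply: IH ckf => y Uy; exact: partial_eq_in.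
Qed.

Lemma ckS k f : ck k.+1 f -> ck k f.
Proof.
elim: k f => [|k IH] f /= [cf df]; split=> // i.
by have [dfi ckf] := df i; split => //; exact: IH.
Qed.

Lemma smooth_on_partial f i : smooth_on U f -> smooth_on U (partial i f).
Proof. by move=> sf a x Ux; rewrite /partials -foldr_rcons; exact: sf. Qed.

Lemma smooth_onP f : smooth_on U f <-> forall k, ck k f.
Proof.
split=> [sf k|].
  elim: k f sf => [|k IH] f sf /=.
    by split=> // x Ux; have [] := sf [::] x Ux.
  split=> [x Ux|i]; first by have [] := sf [::] x Ux.
  split=> [x Ux|]; first by have [_] := sf [::] x Ux; exact.
  exact/IH/smooth_on_partial.
move=> H a; elim/last_ind: a f H => [|a i IH] f H x Ux.
  by have /= [cf df] := H 1; split; [exact: cf|move=> i; have [+ _] := df i; exact].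
rewrite /partials foldr_rcons; apply: IH => // k.
by have /= [_ /(_ i) []] := H k.+1.
Qed.

Lemma smooth_on_eq_in f g : (forall y, U y -> f y = g y) ->
  smooth_on U f -> smooth_on U g.
Proof.
move=> fg /smooth_onP H; apply/smooth_onP => k; exact: ck_eq_in (H k).
Qed.

Lemma smooth_on_continuous f x : smooth_on U f -> U x -> {for x, continuous f}.
Proof. by move=> sf Ux; have [] := sf [::] x Ux. Qed.

Lemma smooth_on_derivable f i x : smooth_on U f -> U x -> derivable f x (e i).
Proof. by move=> sf Ux; have [_] := sf [::] x Ux; exact. Qed.

Lemma smooth_on_is_derive f i x : smooth_on U f -> U x ->
  is_derive x (e i) f (partial i f x).
Proof. by move=> sf Ux; split => //; exact: smooth_on_derivable. Qed.

Lemma ck_cst k (c : R) : ck k (fun=> c).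
Proof.
elim: k c => [|k IH] c /=.
  by split=> // x _; exact: cst_continuous.
split=> [x _|i]; first exact: cst_continuous.
split=> [x _|]; first exact: derivable_cst.
by apply: ck_eq_in (IH 0) => y _; rewrite /partial derive_cst.
Qed.

Lemma ckD k f g : ck k f -> ck k g -> ck k (fun x => f x + g x).
Proof.
elim: k f g => [|k IH] f g /= [cf df] [cg dg].
  by split=> // x Ux; exact: (continuousD (cf x Ux) (cg x Ux)).
split=> [x Ux|i].
- by exact: (continuousD (cf x Ux) (cg x Ux)).
- have [dfi ckf] := df i; have [dgi ckg] := dg i; split=> [x Ux|].
    by apply: derivableD; [exact: dfi|exact: dgi].
  apply: ck_eq_in (IH _ _ ckf ckg) => y Uy.
  by rewrite /partial deriveD //; [exact: dfi|exact: dgi].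
Qed.

Lemma ckM k f g : ck k f -> ck k g -> ck k (fun x => f x * g x).
Proof.
elim: k f g => [|k IH] f g F G; move: (F) (G) => /= [cf df] [cg dg].
  by split=> // x Ux; exact: (continuousM (cf x Ux) (cg x Ux)).
split=> [x Ux|i].
- by exact: (continuousM (cf x Ux) (cg x Ux)).
- have [dfi ckf] := df i; have [dgi ckg] := dg i; split=> [x Ux|].
    by apply: derivableM; [exact: dfi|exact: dgi].
  have := ckD (IH _ _ (ckS F) ckg) (IH _ _ (ckS G) ckf).
  apply: ck_eq_in => y Uy.
  by rewrite /partial deriveM //; [exact: dfi|exact: dgi].
Qed.

Lemma smooth_on_cst (c : R) : smooth_on U (fun=> c).
Proof. by apply/smooth_onP => k; exact: ck_cst. Qed.

Lemma smooth_onD f g : smooth_on U f -> smooth_on U g ->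
  smooth_on U (fun x => f x + g x).
Proof.
by move=> /smooth_onP F /smooth_onP G; apply/smooth_onP => k; exact: ckD.
Qed.

Lemma smooth_onM f g : smooth_on U f -> smooth_on U g ->
  smooth_on U (fun x => f x * g x).
Proof.
by move=> /smooth_onP F /smooth_onP G; apply/smooth_onP => k; exact: ckM.
Qed.

Lemma smooth_onN f : smooth_on U f -> smooth_on U (fun x => - f x).
Proof.
move=> F; apply: smooth_on_eq_in (smooth_onM (smooth_on_cst (-1)) F) => y _.
by rewrite mulN1r.
Qed.

Lemma smooth_on_sum (I : Type) (r : seq I) (P : pred I)
    (F : I -> 'rV[R]_n -> R) : (forall k, smooth_on U (F k)) ->
  smooth_on U (fun x => \sum_(k <- r | P k) F k x).
Proof.
move=> sF; elim: r => [|k r IH].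
  by apply: smooth_on_eq_in (smooth_on_cst 0) => y _; rewrite big_nil.
case: (boolP (P k)) => Pk.
  by apply: smooth_on_eq_in (smooth_onD (sF k) IH) => y _; rewrite big_cons Pk.
by apply: smooth_on_eq_in IH => y _; rewrite big_cons (negPf Pk).
Qed.

Lemma partial_cst i (c : R) x : partial i (fun=> c) x = 0.
Proof. exact: derive_cst. Qed.

Lemma partialD f g i x : smooth_on U f -> smooth_on U g -> U x ->
  partial i (fun x => f x + g x) x = partial i f x + partial i g x.
Proof.
by move=> F G Ux; rewrite /partial deriveD //; exact: smooth_on_derivable.
Qed.

Lemma partialM f g i x : smooth_on U f -> smooth_on U g -> U x ->
  partial i (fun x => f x * g x) x = f x * partial i g x + g x * partial i f x.
Proof.
by move=> F G Ux; rewrite /partial deriveM //; exact: smooth_on_derivable.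
Qed.

Lemma partialN f i x : smooth_on U f -> U x ->
  partial i (fun x => - f x) x = - partial i f x.
Proof. by move=> F Ux; rewrite /partial deriveN //; exact: smooth_on_derivable. Qed.

Lemma partialB f g i x : smooth_on U f -> smooth_on U g -> U x ->
  partial i (fun x => f x - g x) x = partial i f x - partial i g x.
Proof.
by move=> F G Ux; rewrite (partialD i F (smooth_onN G) Ux) partialN.
Qed.

Lemma partial_sum (I : Type) (r : seq I) (P : pred I)
    (F : I -> 'rV[R]_n -> R) i x : (forall k, smooth_on U (F k)) -> U x ->
  partial i (fun x => \sum_(k <- r | P k) F k x) x =
  \sum_(k <- r | P k) partial i (F k) x.
Proof.
move=> sF Ux; elim: r => [|k r IH].
  rewrite big_nil (@partial_eq_in _ (fun=> 0) i x _ Ux) ?partial_cst // => y _.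
  by rewrite big_nil.
rewrite big_cons; case: ifPn => Pk; last first.
  by rewrite -IH; apply: partial_eq_in Ux => y _; rewrite big_cons (negPf Pk).
rewrite -IH -(partialD i (sF k) (smooth_on_sum r P sF) Ux).
by apply: partial_eq_in Ux => y _; rewrite big_cons Pk.
Qed.

(** Differentiation under the integral shows that the integral of [partial j (partial i f)] along
    direction [i] is an increment of [partial j f]; then the length of the segment is varied.
    Invariance of [U] is asked in direction [i] alone, so that [j] can be the time direction. *)
Lemma schwarz f i j x : (forall y (s : R), U y -> U (y + s *: e i)) ->
  smooth_on U f -> U x -> partial i (partial j f) x = partial j (partial i f) x.
Proof.
move=> shiftU sf Ux.
(* The integral is differentiated at a parameter beyond its lower limit, so the segment starts one
   unit before [x] and reaches it at parameter 1. *)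
pose z := x + (-1) *: e i.
have Uz : U z by exact: shiftU.
have zx : z + 1 *: e i = x by rewrite /z scaleN1r scale1r subrK.
have I1 y (s : R) : 0 <= s -> U y ->
    lint (e i) s (partial i f) y = f (y + s *: e i) - f y.
  move=> s0 Uy; apply: (@lint_derive _ _ U) => // w Uw.
    exact: (smooth_on_derivable sf Uw).
  exact: (smooth_on_continuous (smooth_on_partial i sf) Uw).
have I2 (s : R) : 0 <= s ->
    lint (e i) s (partial j (partial i f)) z
    = partial j f (z + s *: e i) - partial j f z.
  move=> s0.
  have /(_ s (partial i f) (e j) z s0 Uz) [w Uw|w Uw|w Uw|_ <-] :=
      @is_derive_lint _ _ U (e i) openU shiftU.
  - exact: (smooth_on_continuous (smooth_on_partial i sf) Uw).
  - exact: (smooth_on_derivable (smooth_on_partial i sf) Uw).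
  - exact: (smooth_on_continuous (smooth_on_partial j (smooth_on_partial i sf)) Uw).
  rewrite -[LHS]/(partial j (lint (e i) s (partial i f)) z).
  rewrite (@partial_eq_in _ (fun y => f (y + s *: e i) - f y)) //; last first.
    by move=> y Uy; exact: I1.
  have D1 : is_derive z (e j) (fun y => f (y + s *: e i))
      (partial j f (z + s *: e i)).
    by apply/is_derive_shift; exact: (smooth_on_is_derive j sf (shiftU _ _ Uz)).
  have D2 := smooth_on_is_derive j sf Uz.
  by rewrite /partial deriveB; [case: D1 => _ ->|case: D1|case: D2].
pose h s := partial j (partial i f) (z + s *: e i).
have ch : continuous h.
  apply: (@line_continuous _ _ U) => // w Uw.
  exact: (smooth_on_continuous (smooth_on_partial j (smooth_on_partial i sf)) Uw).
have [_] := FTC1_rint ltr01 ch.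
rewrite {2}/h zx => <-.
pose k (s : R) := partial j f (z + s *: e i) - partial j f z.
have -> : 'D_1 (fun s : R => rint 0 s h) (1 : R)
    = 'D_1 k 1.
  apply: near_eq_derive; near=> s; apply: I2.
  by apply: ltW; near: s; exact: lt_nbhsr.
have D : is_derive (1 : R) 1 (fun s => partial j f (z + s *: e i))
    (partial i (partial j f) x).
  apply/is_derive_line; rewrite zx.
  exact: (smooth_on_is_derive i (smooth_on_partial j sf) Ux).
rewrite deriveB; [|by case: D|exact: derivable_cst].
by rewrite derive_cst subr0; case: D => _ ->.
Unshelve. all: by end_near. Qed.
End SmoothClosure.

(** * Periodic functions on spacetime *)

Section Fields.
Variable R : realType.
Implicit Types (f g : 'rV[R]_4 -> R) (x y : 'rV[R]_4) (i j : 'I_3) (a : 'I_4).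

Local Notation U := (@spacetime R).
Local Notation "'d_ a" := (@partial R 4 R a) (at level 10, a at level 2, format "''d_' a").
Local Notation ex i := (delta_mx 0 (lift ord0 i) : 'rV[R]_4).
Local Notation e0 := (delta_mx 0 ord0 : 'rV[R]_4).

Lemma coord_line x v (s : R) a : (x + s *: v) 0 a = x 0 a + s * v 0 a.
Proof. by rewrite !mxE. Qed.

Lemma ex_time i : ex i 0 ord0 = 0.
Proof. by rewrite mxE. Qed.

Lemma e0_time : e0 0 ord0 = 1.
Proof. by rewrite mxE. Qed.

Lemma time_shift x i (s : R) : (x + s *: ex i) 0 ord0 = x 0 ord0.
Proof. by rewrite coord_line ex_time mulr0 addr0. Qed.

Lemma time_flow x (s : R) : (x + s *: e0) 0 ord0 = x 0 ord0 + s.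
Proof. by rewrite coord_line e0_time mulr1. Qed.

Lemma spacetime_shift i x (s : R) : U x -> U (x + s *: ex i).
Proof. by rewrite /spacetime /= time_shift. Qed.

Lemma open_spacetime : open U.
Proof.
have -> : U = (fun x : 'rV[R]_4 => x 0 0) @^-1` [set t | 0 < t] by [].
by apply: open_comp => [x _|]; [exact: coord_continuous|exact: open_gt].
Qed.

Lemma is_derive_coord x v a : is_derive x v (fun y : 'rV[R]_4 => y 0 a) (v 0 a).
Proof.
rewrite -[x in is_derive x _ _ _](addr0 x) -(scale0r v).
apply/is_derive_line.
have -> : (fun s : R => (x + s *: v) 0 a) = (fun s : R => x 0 a + s * v 0 a).
  by apply/funext => s; rewrite coord_line.
apply: is_derive_eq.
by rewrite scaler0 !add0r mul1r [_ *: _]mulr1.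
Qed.

Definition tpow (m : R) : 'rV[R]_4 -> R := fun x => x 0 0 `^ m.

Lemma is_derive_tpow m x v : U x ->
  is_derive x v (tpow m) (m * tpow (m - 1) x * v 0 0).
Proof.
move=> Ux.
rewrite -[x in is_derive x _ _ _](addr0 x) -(scale0r v).
apply/is_derive_line.
have := @is_derive1_comp R (fun t => t `^ m) (fun s => (x + s *: v) 0 0) 0
  (m * tpow (m - 1) x) (v 0 0).
apply.
  rewrite scale0r addr0; exact: is_derive1_powR.
apply/(@is_derive_line R _ _ (fun y : 'rV[R]_4 => y 0 0)).
exact: is_derive_coord.
Qed.

Lemma partial_tpow0 m x : U x -> 'd_ord0 (tpow m) x = m * tpow (m - 1) x.
Proof. by move=> /(is_derive_tpow m e0)[_]; rewrite e0_time mulr1. Qed.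

Lemma partial_tpow i m x : U x -> 'd_(lift ord0 i) (tpow m) x = 0.
Proof. by move=> /(is_derive_tpow m (ex i))[_]; rewrite ex_time mulr0. Qed.

Lemma tpow_continuous m x : U x -> {for x, continuous (tpow m)}.
Proof.
move=> Ux.
apply: (@continuous_comp _ _ _ (fun y : 'rV[R]_4 => y 0 0) (fun t : R => t `^ m)).
  exact: coord_continuous.
apply: differentiable_continuous; apply/derivable1_diffP/derivable_powR.
by rewrite in_itv /= andbT.
Qed.

Lemma smooth_tpow m : smooth_on U (tpow m).
Proof.
apply/smooth_onP => k; elim: k m => [|k IH] m.
  by split=> // x Ux; exact: tpow_continuous.
split=> [x Ux|a]; first exact: tpow_continuous.
split=> [x Ux|]; first by have [] := is_derive_tpow m (delta_mx 0 a) Ux.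
case: (unliftP ord0 a) => [i ->|->].
  apply: (ck_eq_in open_spacetime _ (ck_cst open_spacetime k 0)) => y Uy.
  by rewrite partial_tpow.
have := ckM open_spacetime (ck_cst open_spacetime k m) (IH (m - 1)).
by apply: (ck_eq_in open_spacetime) => y Uy; rewrite partial_tpow0.
Qed.

Lemma tpowD m q x : U x -> tpow (m + q) x = tpow m x * tpow q x.
Proof. by move=> Ux; rewrite /tpow powRD // (lt0r_neq0 Ux) implybT. Qed.

Lemma tpow_gt0 m x : U x -> 0 < tpow m x.
Proof. exact: powR_gt0. Qed.

Definition periodic f := forall x i, U x -> f (x + (2 * pi) *: ex i) = f x.

Definition field f := smooth_on U f /\ periodic f.

Lemma field_partial f a : field f -> field ('d_a f).
Proof.
move=> [sf pf]; split; first exact: smooth_on_partial.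
move=> x i Ux; pose z := (2 * pi) *: ex i.
have [_ <-] := (is_derive_shift _ z _ _ _).2
  (smooth_on_is_derive a sf (spacetime_shift i (2 * pi) Ux)).
rewrite -[LHS]/('d_a (fun y => f (y + z)) x).
by apply: (partial_eq_in open_spacetime) Ux => y Uy; exact: pf.
Qed.

Lemma field_cst (c : R) : field (fun=> c).
Proof. by split=> //; exact: (smooth_on_cst open_spacetime). Qed.

Lemma fieldD f g : field f -> field g -> field (fun x => f x + g x).
Proof.
move=> [sf pf] [sg pg]; split; first exact: (smooth_onD open_spacetime sf sg).
by move=> x i Ux; rewrite pf // pg.
Qed.

Lemma fieldM f g : field f -> field g -> field (fun x => f x * g x).
Proof.
move=> [sf pf] [sg pg]; split; first exact: (smooth_onM open_spacetime sf sg).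
by move=> x i Ux; rewrite pf // pg.
Qed.

Lemma fieldN f : field f -> field (fun x => - f x).
Proof.
move=> [sf pf]; split; first exact: (smooth_onN open_spacetime sf).
by move=> x i Ux; rewrite pf.
Qed.

Lemma fieldB f g : field f -> field g -> field (fun x => f x - g x).
Proof. by move=> F G; exact: (fieldD F (fieldN G)). Qed.

Lemma field_sum (I : Type) (r : seq I) (P : pred I) (F : I -> 'rV[R]_4 -> R) :
  (forall k, field (F k)) -> field (fun x => \sum_(k <- r | P k) F k x).
Proof.
move=> fF; split; first by apply: (smooth_on_sum open_spacetime) => k; case: (fF k).
by move=> x i Ux; apply: eq_bigr => k _; case: (fF k) => _; apply.
Qed.

Lemma field_tpow m : field (tpow m).
Proof.
by split; [exact: smooth_tpow|move=> x i Ux; rewrite /tpow time_shift].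
Qed.

Lemma field_continuous f x : field f -> U x -> {for x, continuous f}.
Proof. by move=> [sf _] Ux; exact: (smooth_on_continuous sf Ux). Qed.

Lemma field_is_derive f a x : field f -> U x ->
  is_derive x (delta_mx 0 a : 'rV[R]_4) f ('d_a f x).
Proof. by move=> [sf _] Ux; exact: (smooth_on_is_derive a sf Ux). Qed.

Lemma dD f g a x : field f -> field g -> U x ->
  'd_a (fun y => f y + g y) x = 'd_a f x + 'd_a g x.
Proof. by move=> [F _] [G _]; exact: partialD. Qed.

Lemma dB f g a x : field f -> field g -> U x ->
  'd_a (fun y => f y - g y) x = 'd_a f x - 'd_a g x.
Proof. by move=> [F _] [G _]; exact: (partialB open_spacetime). Qed.

Lemma dN f a x : field f -> U x -> 'd_a (fun y => - f y) x = - 'd_a f x.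
Proof. by move=> [F _]; exact: partialN. Qed.

Lemma dM f g a x : field f -> field g -> U x ->
  'd_a (fun y => f y * g y) x = f x * 'd_a g x + g x * 'd_a f x.
Proof. by move=> [F _] [G _]; exact: partialM. Qed.

Lemma d_sum (I : Type) (r : seq I) (P : pred I) (F : I -> 'rV[R]_4 -> R) a x :
  (forall k, field (F k)) -> U x ->
  'd_a (fun x => \sum_(k <- r | P k) F k x) x = \sum_(k <- r | P k) 'd_a (F k) x.
Proof.
by move=> fF; apply: (partial_sum open_spacetime) => k; case: (fF k).
Qed.

Lemma d_eq f g a x : (forall y, U y -> f y = g y) -> U x -> 'd_a f x = 'd_a g x.
Proof. exact: (partial_eq_in open_spacetime). Qed.

Lemma dx_tpowM i m f x : field f -> U x ->
  'd_(lift ord0 i) (fun y => tpow m y * f y) x = tpow m x * 'd_(lift ord0 i) f x.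
Proof.
by move=> F Ux; rewrite (dM _ (field_tpow m) F) // partial_tpow // mulr0 addr0.
Qed.

Lemma dt_tpowM m f x : field f -> U x ->
  'd_ord0 (fun y => tpow m y * f y) x
  = tpow m x * ('d_ord0 f x + m * tpow (-1) x * f x).
Proof.
move=> F Ux; rewrite (dM _ (field_tpow m) F) // partial_tpow0 // tpowD //.
by ring.
Qed.

Lemma d_comm f i a x : field f -> U x ->
  'd_(lift ord0 i) ('d_a f) x = 'd_a ('d_(lift ord0 i) f) x.
Proof.
move=> [sf _] Ux; exact: (@schwarz _ _ _ open_spacetime f (lift ord0 i) a x (spacetime_shift i) sf Ux).
Qed.

(* [mean] is an integral over a period, not normalised *)
Definition mean i f := lint (ex i) (2 * pi) f.

Let twopi_ge0 : 0 <= 2 * pi :> R.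
Proof. by rewrite mulr_ge0 // pi_ge0. Qed.

Lemma field_line_continuous f i x : field f -> U x ->
  continuous (fun s : R => f (x + s *: ex i)).
Proof.
move=> F Ux; apply: (@line_continuous _ _ U) => //.
  exact: (spacetime_shift i).
by move=> y Uy; exact: field_continuous.
Qed.

Lemma le_mean i f g x : field f -> field g -> U x ->
  (forall s, f (x + s *: ex i) <= g (x + s *: ex i)) ->
  mean i f x <= mean i g x.
Proof.
move=> F G Ux fg; apply: le_rint; [exact: field_line_continuous..|].
by move=> s _; exact: fg.
Qed.

Lemma eq_mean i f g x : (forall s, f (x + s *: ex i) = g (x + s *: ex i)) ->
  mean i f x = mean i g x.
Proof. by move=> fg; congr rint; apply/funext. Qed.

Lemma mean_cst i (c : R) x : mean i (fun=> c) x = c * (2 * pi).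
Proof. by rewrite /mean /lint rint_cst // subr0. Qed.

Lemma meanD i f g x : field f -> field g -> U x ->
  mean i (fun y => f y + g y) x = mean i f x + mean i g x.
Proof. by move=> F G Ux; rewrite /mean /lint rintD //; exact: field_line_continuous. Qed.

Lemma mean_time i (c : R -> R) f x : field f -> U x ->
  mean i (fun y => c (y 0 0) * f y) x = c (x 0 0) * mean i f x.
Proof.
move=> F Ux; rewrite /mean /lint -rintZ; last exact: field_line_continuous.
by congr rint; apply/funext => s; rewrite time_shift.
Qed.

Lemma d_mean i a f x : field f -> U x -> 'd_a (mean i f) x = mean i ('d_a f) x.
Proof.
move=> [sf pf] Ux.
have [|||] // := @is_derive_lint R _ U (ex i) open_spacetime (spacetime_shift i)
  (2 * pi) f (delta_mx 0 a) x twopi_ge0 Ux.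
- by move=> y Uy; exact: (smooth_on_continuous sf Uy).
- by move=> y Uy; exact: (smooth_on_derivable sf Uy).
- by move=> y Uy; exact: (smooth_on_continuous (smooth_on_partial a sf) Uy).
Qed.

Lemma mean_continuous i f x : field f -> U x -> {for x, continuous (mean i f)}.
Proof.
move=> F; apply: (lint_continuous open_spacetime) => //.
  exact: (spacetime_shift i).
by move=> y Uy; exact: field_continuous.
Qed.

Lemma field_mean i f : field f -> field (mean i f).
Proof.
move=> F; split; last first.
  move=> x j Ux; rewrite /mean /lint; congr rint; apply/funext => s.
  by rewrite addrAC; case: F => _; apply; exact: spacetime_shift.
apply/smooth_onP => k; elim: k f F => [|k IH] f F.
  by split=> // x Ux; exact: mean_continuous.
split=> [x Ux|a]; first exact: mean_continuous.
split=> [x Ux|].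
  have [|||] // := @is_derive_lint R _ U (ex i) open_spacetime (spacetime_shift i)
    (2 * pi) f (delta_mx 0 a) x twopi_ge0 Ux.
  - by move=> y Uy; exact: field_continuous.
  - by move=> y Uy; have [] := field_is_derive a F Uy.
  - by move=> y Uy; exact: (field_continuous (field_partial a F) Uy).
apply: (ck_eq_in open_spacetime _ (IH _ (field_partial a F))) => y Uy.
by rewrite d_mean.
Qed.

Lemma mean_dx i f x : field f -> U x -> mean i ('d_(lift ord0 i) f) x = 0.
Proof.
move=> F Ux; rewrite /mean (@lint_derive R _ U (ex i) (spacetime_shift i)) //.
- by case: (F) => _ ->; rewrite // subrr.
- by move=> y Uy; have [] := field_is_derive (lift ord0 i) F Uy.
- by move=> y Uy; exact: (field_continuous (field_partial (lift ord0 i) F) Uy).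
Qed.

Definition means (l : seq 'I_3) f := foldr mean f l.

Lemma field_means l f : field f -> field (means l f).
Proof. by move=> F; elim: l => [|i l IH] //=; exact: field_mean. Qed.

Lemma le_means l f g x : field f -> field g -> U x ->
  (forall y, y 0 0 = x 0 0 -> f y <= g y) -> means l f x <= means l g x.
Proof.
move=> F G; elim: l x => [|i l IH] x Ux fg /=; first exact: fg.
apply: le_mean => //; try exact: field_means.
move=> s; apply: IH; first exact: spacetime_shift.
by move=> y; rewrite time_shift => /fg.
Qed.

Lemma means_cst l (c : R) x : means l (fun=> c) x = c * (2 * pi) ^+ size l.
Proof.
elim: l x => [|i l IH] x /=; first by rewrite mulr1.
rewrite -[LHS]/(mean i (means l (fun=> c)) x).
rewrite (@eq_mean i _ (fun=> c * (2 * pi) ^+ size l)) // mean_cst.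
by rewrite -mulrA -exprSr.
Qed.

Lemma meansD l f g x : field f -> field g -> U x ->
  means l (fun y => f y + g y) x = means l f x + means l g x.
Proof.
move=> F G; elim: l x => [|i l IH] x Ux //=.
rewrite -meanD //; try exact: field_means.
by apply: eq_mean => s; apply: IH; exact: spacetime_shift.
Qed.

Lemma means_time l (c : R -> R) f x : field f -> U x ->
  means l (fun y => c (y 0 0) * f y) x = c (x 0 0) * means l f x.
Proof.
move=> F; elim: l x => [|i l IH] x Ux //=.
rewrite -mean_time //; last exact: field_means.
by apply: eq_mean => s; apply: IH; exact: spacetime_shift.
Qed.

Lemma d_means l a f x : field f -> U x ->
  'd_a (means l f) x = means l ('d_a f) x.
Proof.
move=> F; elim: l x => [|i l IH] x Ux //=.
rewrite d_mean //; last exact: field_means.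
by apply: eq_mean => s; apply: IH; exact: spacetime_shift.
Qed.

Lemma means_dx l i f x : field f -> U x -> i \in l ->
  means l ('d_(lift ord0 i) f) x = 0.
Proof.
move=> F; elim: l x => [|j l IH] x Ux //=; rewrite inE => /orP[/eqP <-|il].
  rewrite -[RHS](@mean_dx i (means l f) x) //; last exact: field_means.
  by apply: eq_mean => s; rewrite d_means //; exact: spacetime_shift.
transitivity (mean j (fun=> 0) x); last by rewrite mean_cst mul0r.
by apply: eq_mean => s; apply: IH => //; exact: spacetime_shift.
Qed.

Lemma means_div l (Q : 'I_3 -> 'rV[R]_4 -> R) x : (forall i, field (Q i)) ->
  (forall i, i \in l) -> U x ->
  means l (fun y => \sum_i 'd_(lift ord0 i) (Q i) y) x = 0.
Proof.
move=> FQ al Ux.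
have FD i := field_partial (lift ord0 i) (FQ i).
have -> : (fun y => \sum_i 'd_(lift ord0 i) (Q i) y) = (fun y =>
    'd_(lift ord0 ord0) (Q ord0) y +
    ('d_(lift ord0 (lift ord0 ord0)) (Q (lift ord0 ord0)) y +
     'd_(lift ord0 (lift ord0 (lift ord0 ord0))) (Q (lift ord0 (lift ord0 ord0))) y)).
  by apply/funext => y; rewrite !big_ord_recl big_ord0 addr0.
rewrite (meansD l (FD _) (fieldD (FD _) (FD _))) // (meansD l (FD _) (FD _)) //.
by rewrite !means_dx // !addr0.
Qed.

(** The integral over the torus kills the divergence of [Q], so the time derivative of [means l E]
    is nonnegative. *)
Lemma means_nondecreasing l E (Q : 'I_3 -> 'rV[R]_4 -> R) x (s : R) :
  field E -> (forall i, field (Q i)) -> (forall i, i \in l) -> U x -> 0 <= s ->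
  (forall y, U y -> \sum_i 'd_(lift ord0 i) (Q i) y <= 'd_ord0 E y) ->
  means l E x <= means l E (x + s *: e0).
Proof.
move=> FE FQ al Ux s0 dE.
have Uh h : 0 <= h -> U (x + h *: e0).
  by move=> h0; rewrite /spacetime /= time_flow ltr_wpDr.
have := @nondecreasing_is_derive R (fun h => means l E (x + h *: e0))
  (fun h => 'd_ord0 (means l E) (x + h *: e0)) 0 s s0.
rewrite scale0r addr0; apply.
- move=> h /andP[h0 _]; apply/is_derive_line.
  by apply: (field_is_derive ord0 (field_means l FE)); exact: Uh.
- move=> h /andP[h0 _]; have Uy := Uh h h0.
  rewrite d_means // -(means_div FQ al Uy).
  apply: le_means => //; last first.
  + by move=> y yt; apply: dE; rewrite /spacetime /= yt.
  + exact: field_partial.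
  + by apply: field_sum => i; exact: field_partial.
Qed.

Lemma sobolev1 i f x : field f -> U x ->
  f x ^+ 2 <= 2 * mean i (fun y => f y ^+ 2 + 'd_(lift ord0 i) f y ^+ 2) x.
Proof.
move=> F Ux; set g := 'd_(lift ord0 i) f.
have G : field g by exact: field_partial.
pose L : R := 2 * pi.
have L1 : 1 <= L by rewrite /L; have := @pi_ge2 R; lra.
(* [k] is the derivative of [(s - L) * f ^+ 2], whose increment over one period is
   [L * f x ^+ 2]. *)
pose k (s : R) := f (x + s *: ex i) ^+ 2
  + (s - L) * (2 * f (x + s *: ex i) * g (x + s *: ex i)).
have cf : continuous (fun s : R => f (x + s *: ex i)) by exact: field_line_continuous.
have cg : continuous (fun s : R => g (x + s *: ex i)) by exact: field_line_continuous.
have ck : continuous k.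
  move=> s; apply: cvgD.
    by rewrite /GRing.exp /=; apply: cvgM; exact: cf.
  apply: cvgM; first by apply: cvgB; [exact: cvg_id|exact: cvg_cst].
  by apply: cvgM; [apply: cvgM; [exact: cvg_cst|exact: cf]|exact: cg].
have Dk s : is_derive s (1 : R) (fun s => (s - L) * f (x + s *: ex i) ^+ 2) (k s).
  have D : is_derive s (1 : R) (fun s : R => f (x + s *: ex i)) (g (x + s *: ex i)).
    by apply/is_derive_line; apply: field_is_derive => //; exact: spacetime_shift.
  apply: is_derive_eq.
  by rewrite /GRing.scale /= /k; ring.
have I : rint 0 L k = L * f x ^+ 2.
  rewrite (FTC2_rint _ ck Dk) ?(le_trans ler01) //.
  by rewrite scale0r addr0; ring.
have FG : field (fun y => f y ^+ 2 + g y ^+ 2) by apply: fieldD; apply: fieldM.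
have cFG : continuous (fun s : R => f (x + s *: ex i) ^+ 2 + g (x + s *: ex i) ^+ 2).
  exact: (field_line_continuous FG Ux).
rewrite -(@ler_pM2l _ L) ?(lt_le_trans ltr01) // -I.
rewrite [2 * _]mulrC mulrA -mulrA -/L.
have -> : L * (mean i (fun y => f y ^+ 2 + g y ^+ 2) x * 2) =
  rint 0 L (fun s => (2 * L) * ((f (x + s *: ex i)) ^+ 2 + g (x + s *: ex i) ^+ 2)).
  rewrite (rintZ _ 0 L cFG).
  by rewrite /mean /lint -/L; ring.
apply: le_rint => //.
  by move=> s; apply: cvgM; [exact: cvg_cst|exact: cFG].
move=> s /andP[s0 sL].
rewrite /k; set u := f _; set w := g _.
rewrite -subr_ge0.
(* For [0 <= s <= L] every coefficient on the right is nonnegative; the third one uses [1 <= L]. *)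
have -> : 2 * L * (u ^+ 2 + w ^+ 2) - (u ^+ 2 + (s - L) * (2 * u * w)) =
  (L - s) * (u + w) ^+ 2 + s * (u ^+ 2 + w ^+ 2) + (L - 1) * u ^+ 2 + L * w ^+ 2.
  by ring.
have L0 : 0 <= L by rewrite (le_trans ler01).
by rewrite !addr_ge0 // mulr_ge0 ?subr_ge0 ?addr_ge0 ?sqr_ge0.
Qed.

(** A sum over the sublists of [l]: iterating the one-dimensional Sobolev inequality differentiates
    at most once in each direction of [l]. *)
Fixpoint sumsq (l : seq 'I_3) f : 'rV[R]_4 -> R :=
  if l is i :: l' then fun x => sumsq l' f x + sumsq l' ('d_(lift ord0 i) f) x
  else fun x => f x ^+ 2.

Lemma field_sumsq l f : field f -> field (sumsq l f).
Proof.
elim: l f => [|i l IH] f F /=; first exact: fieldM.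
by apply: fieldD; [exact: IH|exact/IH/field_partial].
Qed.

Lemma sobolev l f x : field f -> U x ->
  f x ^+ 2 <= 2 ^+ size l * means l (sumsq l f) x.
Proof.
elim: l f x => [|i l IH] f x F Ux /=; first by rewrite mul1r.
have G := field_partial (lift ord0 i) F.
apply: le_trans (sobolev1 i F Ux) _; rewrite exprS -mulrA ler_wpM2l //.
rewrite -[means l]/(foldr mean ^~ l).
rewrite -(@mean_time i (fun=> 2 ^+ size l)) //; last first.
  exact/field_means/(field_sumsq (i :: l) F).
apply: le_mean => //.
- by apply: fieldD; exact: fieldM.
- by apply: fieldM; [exact: field_cst|exact/field_means/(field_sumsq (i :: l) F)].
- move=> s; have Us := spacetime_shift i s Ux.
  rewrite -[foldr mean _ l _]/(means l _ _) /= meansD //; try exact: field_sumsq.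
  by rewrite mulrDr lerD //; exact: IH.
Qed.

End Fields.

(** * The first-order system and its energy *)

#[local] Opaque partial.

Section Maxwell.
Variable R : realType.
Variable p : 'I_3 -> R.
Variable lam : R.
Hypothesis lam_elec : forall i, 1 - p i <= lam.
Hypothesis lam_magn : forall j k, j != k -> p j + p k <= lam.
Hypothesis lam_ge0 : 0 <= lam.

Local Notation U := (@spacetime R).
Local Notation dt := (@partial R 4 R ord0).
Local Notation dx i := (@partial R 4 R (lift ord0 i)).
Local Notation e0 := (delta_mx 0 ord0 : 'rV[R]_4).

(** The magnetic field is kept as a two-form, an antisymmetric array, so that no cross product or
    orientation enters. *)
Record state := State {
  elec : 'I_3 -> 'rV[R]_4 -> R;
  magn : 'I_3 -> 'I_3 -> 'rV[R]_4 -> R;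
  dive : 'rV[R]_4 -> R }.

Record maxwell (w : state) : Prop := Maxwell {
  field_elec : forall i, field (elec w i);
  field_magn : forall j k, field (magn w j k);
  field_dive : field (dive w);
  magn_anti : forall j k x, U x -> magn w k j x = - magn w j k x;
  dt_elec : forall i x, U x -> dt (elec w i) x =
    - (1 - p i) * tpow (-1) x * elec w i x
    + (\sum_j tpow (- p j) x * dx j (magn w j i) x)
    + tpow (- p i) x * dx i (dive w) x;
  dt_magn : forall j k x, U x -> dt (magn w j k) x =
    - (p j + p k) * tpow (-1) x * magn w j k x
    + tpow (- p j) x * dx j (elec w k) x - tpow (- p k) x * dx k (elec w j) x;
  dt_dive : forall x, U x -> dt (dive w) x =
    \sum_i tpow (- p i) x * dx i (elec w i) x }.

Definition dstate l (w : state) : state :=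
  State (fun i => dx l (elec w i)) (fun j k => dx l (magn w j k)) (dx l (dive w)).

Lemma field_tdx m i f : field f -> field (fun x => tpow m x * dx i f x).
Proof. by move=> F; apply: fieldM; [exact: field_tpow|exact: field_partial]. Qed.

Lemma dx_tdx l m i f x : field f -> U x ->
  dx l (fun x => tpow m x * dx i f x) x = tpow m x * dx i (dx l f) x.
Proof.
by move=> F Ux; rewrite (dx_tpowM _ _ (field_partial _ F) Ux) (d_comm l _ F Ux).
Qed.

Lemma dx_ctf l (c : R) m f x : field f -> U x ->
  dx l (fun x => c * tpow m x * f x) x = c * tpow m x * dx l f x.
Proof.
move=> F Ux.
rewrite (@d_eq _ _ (fun x => tpow m x * (c * f x))) //; last by move=> y _; ring.
have Fc := fieldM (field_cst c) F.
rewrite dx_tpowM // (dM _ (field_cst c) F) // partial_cst mulr0 addr0.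
by ring.
Qed.

Lemma field_ctf (c : R) m f : field f -> field (fun x => c * tpow m x * f x).
Proof.
by move=> F; apply: fieldM => //; apply: fieldM; [exact: field_cst|exact: field_tpow].
Qed.

(** The coefficients of the system depend on [t] alone, so space derivatives of a solution solve the
    same system. *)
Lemma maxwell_dstate l w : maxwell w -> maxwell (dstate l w).
Proof.
case=> Fa FB Fd anti Ea EB Ed; split => /=.
- by move=> i; exact: field_partial.
- by move=> j k; exact: field_partial.
- exact: field_partial.
- move=> j k x Ux; rewrite -dN //; apply: d_eq Ux => y Uy; exact: anti.
- move=> i x Ux; rewrite -d_comm // (d_eq _ (Ea i) Ux).
  have FS := @field_sum R _ (index_enum 'I_3) xpredT _ (fun j => field_tdx (- p j) j (FB j i)).
  have F1 := field_ctf (- (1 - p i)) (-1) (Fa i).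
  have F2 := field_tdx (- p i) i Fd.
  rewrite (dD _ (fieldD F1 FS) F2) // (dD _ F1 FS) // dx_ctf // dx_tdx //.
  rewrite d_sum //; last by move=> j; exact: field_tdx.
  by congr (_ + _ + _); apply: eq_bigr => j _; rewrite dx_tdx.
- move=> j k x Ux; rewrite -d_comm // (d_eq _ (EB j k) Ux).
  have F1 := field_ctf (- (p j + p k)) (-1) (FB j k).
  have F2 := field_tdx (- p j) j (Fa k).
  have F3 := field_tdx (- p k) k (Fa j).
  by rewrite (dB _ (fieldD F1 F2) F3) // (dD _ F1 F2) // dx_ctf // !dx_tdx.
- move=> x Ux; rewrite -d_comm // (d_eq _ Ed Ux) d_sum //.
    by apply: eq_bigr => i _; rewrite dx_tdx.
  by move=> i; exact: field_tdx.
Qed.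

Definition energy (w : state) x : R :=
  \sum_i elec w i x ^+ 2 + 2^-1 * (\sum_j \sum_k magn w j k x ^+ 2)
  + dive w x ^+ 2.

(** [\sum_i E_i B_ji] is the Poynting vector up to sign and [E_j * dive] its counterpart for the
    divergence; the weight is that of the energy in [energy_balance]. *)
Definition flux (w : state) j x : R :=
  tpow (2 * lam) x * (tpow (- p j) x *
    (2 * ((\sum_i elec w i x * magn w j i x) + elec w j x * dive w x))).

Lemma field_sq f : field f -> field (fun x : 'rV[R]_4 => f x ^+ 2).
Proof. by move=> F; exact: (fieldM F F). Qed.

Lemma d_sq a f x : field f -> U x ->
  partial a (fun x => f x ^+ 2) x = 2 * f x * partial a f x.
Proof. by move=> F Ux; rewrite [LHS](dM a F F Ux); ring. Qed.

Lemma field_energy w : maxwell w -> field (energy w).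
Proof.
move=> [Fa FB Fd _ _ _ _]; apply: fieldD; last exact: field_sq.
apply: fieldD; first by apply: field_sum => i; exact: field_sq.
apply: fieldM; first exact: field_cst.
by apply: field_sum => i; apply: field_sum => j; exact: field_sq.
Qed.

Lemma field_flux w j : maxwell w -> field (flux w j).
Proof.
move=> [Fa FB Fd _ _ _ _]; apply: fieldM; first exact: field_tpow.
apply: fieldM; first exact: field_tpow.
apply: fieldM; first exact: field_cst.
apply: fieldD; last exact: fieldM.
by apply: field_sum => i; exact: fieldM.
Qed.

Lemma dt_energy w x : maxwell w -> U x ->
  dt (energy w) x = 2 * (\sum_i elec w i x * dt (elec w i) x)
    + (\sum_j \sum_k magn w j k x * dt (magn w j k) x)
    + 2 * dive w x * dt (dive w) x.
Proof.
move=> [Fa FB Fd _ _ _ _] Ux.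
have F1 := @field_sum R _ (index_enum 'I_3) xpredT _ (fun i => field_sq (Fa i)).
have F2 := @field_sum R _ (index_enum 'I_3) xpredT _ (fun i =>
  @field_sum R _ (index_enum 'I_3) xpredT _ (fun j => field_sq (FB i j))).
have F3 := fieldM (field_cst 2^-1) F2.
rewrite (dD _ (fieldD F1 F3) (field_sq Fd)) // (dD _ F1 F3) // d_sq //.
rewrite (dM _ (field_cst _) F2) // partial_cst mulr0 addr0.
congr (_ + _ + _).
  rewrite d_sum //; last by move=> i; exact: field_sq.
  by rewrite mulr_sumr; apply: eq_bigr => i _; rewrite d_sq // mulrA.
rewrite d_sum //; last by move=> i; apply: field_sum => j; exact: field_sq.
rewrite mulr_sumr; apply: eq_bigr => i _.
rewrite d_sum //; last by move=> j; exact: field_sq.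
rewrite mulr_sumr; apply: eq_bigr => j _.
by rewrite d_sq // -!mulrA mulKf.
Qed.

Lemma dx_flux w j x : maxwell w -> U x ->
  dx j (flux w j) x = tpow (2 * lam) x * (tpow (- p j) x *
    (2 * ((\sum_i (elec w i x * dx j (magn w j i) x + magn w j i x * dx j (elec w i) x))
      + (elec w j x * dx j (dive w) x + dive w x * dx j (elec w j) x)))).
Proof.
move=> [Fa FB Fd _ _ _ _] Ux.
have F1 := @field_sum R _ (index_enum 'I_3) xpredT _ (fun i => fieldM (Fa i) (FB j i)).
have F2 := fieldM (Fa j) Fd.
have F3 := fieldM (field_cst 2) (fieldD F1 F2).
have F4 := fieldM (field_tpow (- p j)) F3.
rewrite dx_tpowM // dx_tpowM //; congr (_ * (_ * _)).
rewrite (dM _ (field_cst 2) (fieldD F1 F2)) // partial_cst mulr0 addr0.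
congr (_ * _); rewrite (dD _ F1 F2) // (dM _ (Fa j) Fd) //; congr (_ + _).
rewrite d_sum //; last by move=> i; exact: fieldM.
by apply: eq_bigr => i _; rewrite (dM _ (Fa i) (FB j i)).
Qed.

(** The identity behind [energy_balance], with the derivatives replaced by plain variables. *)
Let energy_algebra (a d' q : 'I_3 -> R) (B Da DB : 'I_3 -> 'I_3 -> R) (d T t : R) :
  (forall j k, B k j = - B j k) ->
  T * (2 * (\sum_i a i * (- (1 - p i) * t * a i + (\sum_j q j * DB j i) + q i * d' i))
     + (\sum_j \sum_k B j k * (- (p j + p k) * t * B j k + q j * Da j k - q k * Da k j))
     + 2 * d * (\sum_i q i * Da i i)
     + 2 * lam * t * (\sum_i a i ^+ 2 + 2^-1 * (\sum_j \sum_k B j k ^+ 2) + d ^+ 2))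
  - \sum_j T * (q j * (2 * ((\sum_i (a i * DB j i + B j i * Da j i))
      + (a j * d' j + d * Da j j))))
  = T * t * (2 * (\sum_i (lam - (1 - p i)) * a i ^+ 2)
     + (\sum_j \sum_k (lam - (p j + p k)) * B j k ^+ 2) + 2 * lam * d ^+ 2).
Proof.
move=> anti.
have diag j : B j j = 0 by have := anti j j; lra.
rewrite !big_ord_recl !big_ord0 !diag.
rewrite (anti ord0 (lift ord0 ord0)) (anti ord0 (lift ord0 (lift ord0 ord0))).
rewrite (anti (lift ord0 ord0) (lift ord0 (lift ord0 ord0))).
by field.
Qed.

(* Antisymmetry turns the terms [B_jk d_k a_j] into [- B_jk d_j a_k], so that
   only the damping terms survive besides the divergence of the flux. *)
Lemma energy_balance w x : maxwell w -> U x ->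
  dt (fun x => tpow (2 * lam) x * energy w x) x - \sum_j dx j (flux w j) x =
  tpow (2 * lam) x * tpow (-1) x *
   (2 * (\sum_i (lam - (1 - p i)) * elec w i x ^+ 2)
    + (\sum_j \sum_k (lam - (p j + p k)) * magn w j k x ^+ 2)
    + 2 * lam * dive w x ^+ 2).
Proof.
move=> W Ux.
rewrite dt_tpowM //; last exact: field_energy.
rewrite dt_energy // /energy.
rewrite (eq_bigr _ (fun j _ => dx_flux j W Ux)).
rewrite (eq_bigr _ (fun i _ => congr1 (fun z => elec w i x * z) (dt_elec W i Ux))).
rewrite [in X in _ + X + _](eq_bigr _ (fun j _ => eq_bigr _ (fun k _ =>
  congr1 (fun z => magn w j k x * z) (dt_magn W j k Ux)))).
rewrite dt_dive //.
exact: (@energy_algebra (fun i => elec w i x) (fun j => dx j (dive w) x)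
  (fun j => tpow (- p j) x) (fun j k => magn w j k x)
  (fun j k => dx j (elec w k) x) (fun j i => dx j (magn w j i) x) (dive w x)
  (tpow (2 * lam) x) (tpow (-1) x) (fun j k => magn_anti W j k Ux)).
Qed.

Lemma energy_balance_ge w x : maxwell w -> U x ->
  \sum_j dx j (flux w j) x <= dt (fun x => tpow (2 * lam) x * energy w x) x.
Proof.
move=> W Ux; rewrite -subr_ge0 energy_balance //.
have diag j : magn w j j x = 0 by have := magn_anti W j j Ux; lra.
apply: mulr_ge0; first by apply: mulr_ge0; exact/ltW/tpow_gt0.
apply: addr_ge0; last by rewrite mulr_ge0 ?sqr_ge0 // mulr_ge0.
apply: addr_ge0.
  by apply: mulr_ge0 => //; apply: sumr_ge0 => i _; rewrite mulr_ge0 ?sqr_ge0 ?subr_ge0.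
apply: sumr_ge0 => j _; apply: sumr_ge0 => k _.
have [<-|jk] := eqVneq j k; first by rewrite diag expr0n mulr0.
by rewrite mulr_ge0 ?sqr_ge0 // subr_ge0 lam_magn.
Qed.

(** The recursion is that of [sumsq], so that the two can be compared term by term in [sumsq_le]. *)
Fixpoint energies (l : seq 'I_3) w : 'rV[R]_4 -> R :=
  if l is i :: l' then fun x => energies l' w x + energies l' (dstate i w) x
  else energy w.

Lemma field_energies l w : maxwell w -> field (energies l w).
Proof.
elim: l w => [|i l IH] w W /=; first exact: field_energy.
apply: fieldD; first exact: IH.
by apply: IH; exact: maxwell_dstate.
Qed.

Definition allx : seq 'I_3 := enum 'I_3.

Lemma energies_nondecreasing l w x (s : R) : maxwell w -> U x -> 0 <= s ->
  tpow (2 * lam) x * means allx (energies l w) x <=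
  tpow (2 * lam) (x + s *: e0) * means allx (energies l w) (x + s *: e0).
Proof.
move=> W Ux s0.
have Us : U (x + s *: e0) by rewrite /spacetime /= time_flow ltr_wpDr.
elim: l w W => [|i l IH] w W.
  have E := field_energy W.
  rewrite -(means_time allx (fun t => t `^ (2 * lam)) E Ux).
  rewrite -(means_time allx (fun t => t `^ (2 * lam)) E Us).
  apply: (@means_nondecreasing R allx _ (flux w)) => //.
  - exact: (fieldM (field_tpow _) E).
  - by move=> j; exact: field_flux.
  - by move=> j; rewrite mem_enum.
  - by move=> y Uy; exact: energy_balance_ge.
have F1 := field_energies l W.
have F2 := field_energies l (maxwell_dstate i W).
rewrite (meansD allx F1 F2 Ux) (meansD allx F1 F2 Us) !mulrDr.
apply: lerD; first exact: IH.
by apply: IH; exact: maxwell_dstate.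
Qed.

Definition bounded_at (w : state) (K : R) x :=
  [/\ forall i, `|elec w i x| <= K, forall j k, `|magn w j k x| <= K
    & `|dive w x| <= K].

Lemma energy_le w K x : bounded_at w K x -> energy w x <= 9 * K ^+ 2.
Proof.
case=> ba bB bd.
have sq z : `|z| <= K -> z ^+ 2 <= K ^+ 2.
  by move=> zK; rewrite -[z ^+ 2]ger0_norm ?sqr_ge0 // normrX ler_sqr ?nnegrE // (le_trans _ zK).
have K2 : 0 <= K ^+ 2 by exact: sqr_ge0.
rewrite /energy.
(* The true total weight is [3 + 9/2 + 1]; the surplus of 1/2 is put into the last term. *)
have -> : 9 * K ^+ 2 = 3 * K ^+ 2 + 2^-1 * (9 * K ^+ 2) + (3/2) * K ^+ 2 by field.
apply: lerD; last by have := sq _ bd; lra.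
apply: lerD.
  have -> : 3 * K ^+ 2 = \sum_(i < 3) K ^+ 2.
    by rewrite !big_ord_recl !big_ord0; ring.
  by apply: ler_sum => i _; exact: sq.
rewrite ler_pM2l ?invr_gt0 //.
have -> : 9 * K ^+ 2 = \sum_(j < 3) \sum_(k < 3) K ^+ 2.
  by rewrite !big_ord_recl !big_ord0; ring.
by apply: ler_sum => j _; apply: ler_sum => k _; exact: sq.
Qed.

Lemma energies_le l w K x :
  (forall s, (size s <= size l)%N -> bounded_at (foldr dstate w s) K x) ->
  energies l w x <= 2 ^+ size l * (9 * K ^+ 2).
Proof.
elim: l w => [|i l IH] w b /=.
  by rewrite mul1r; apply: energy_le; exact: (b [::]).
rewrite exprS -mulrA mulrDl !mul1r; apply: lerD; apply: IH => s sl.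
  by apply: b; exact: leqW.
by rewrite -[foldr _ _ _](foldr_rcons dstate w s i); apply: b; rewrite size_rcons.
Qed.

Definition component w f := [\/ exists i, f = elec w i,
  exists j k, f = magn w j k | f = dive w].

Lemma component_sq w f x : component w f -> f x ^+ 2 <= 2 * energy w x.
Proof.
have sa i : elec w i x ^+ 2 <= \sum_i elec w i x ^+ 2.
  by rewrite (bigD1 i) //= lerDl sumr_ge0 // => j _; exact: sqr_ge0.
have sB j k : magn w j k x ^+ 2 <= \sum_j \sum_k magn w j k x ^+ 2.
  rewrite (bigD1 j) //= (bigD1 k) //= -addrA lerDl addr_ge0 ?sumr_ge0 // => *.
    exact: sqr_ge0.
  by rewrite sumr_ge0 // => *; exact: sqr_ge0.
have Sa : 0 <= \sum_i elec w i x ^+ 2 by rewrite sumr_ge0 // => *; exact: sqr_ge0.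
have SB : 0 <= \sum_j \sum_k magn w j k x ^+ 2.
  by rewrite sumr_ge0 // => *; rewrite sumr_ge0 // => *; exact: sqr_ge0.
have Sd := sqr_ge0 (dive w x).
rewrite /energy => -[[i ->]|[j [k ->]]|->].
- by have := sa i; lra.
- by have := sB j k; lra.
- by lra.
Qed.

Lemma component_dstate l w f : component w f -> component (dstate l w) (dx l f).
Proof.
by case=> [[i ->]|[j [k ->]]|->]; [apply: Or31; exists i|apply: Or32; exists j, k|apply: Or33].
Qed.

Lemma sumsq_le l w f x : component w f -> maxwell w -> U x ->
  sumsq l f x <= 2 * energies l w x.
Proof.
elim: l w f => [|i l IH] w f cf W Ux /=; first exact: component_sq.
rewrite mulrDr; apply: lerD; apply: IH => //; first exact: component_dstate.
exact: maxwell_dstate.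
Qed.

(** The factors are [2 ^+ 3] from the Sobolev inequality in three directions, 2 from [component_sq],
    [2 ^+ 3] from the sublists of directions, 9 from [energy_le], and the volume of the torus. *)
Definition decay_const : R := Num.sqrt (2 ^+ 3 * (2 * (2 ^+ 3 * 9 * (2 * pi) ^+ 3))).

(** The weighted energies are nondecreasing in [t], hence for [t <= 1] bounded by their values at
    time 1; the Sobolev inequality converts this into a pointwise bound. *)
Lemma component_decay w f (K : R) x : component w f -> maxwell w -> 0 <= K -> U x ->
  x 0 0 <= 1 ->
  (forall s (y : 'rV[R]_4), y 0 0 = 1 -> (size s <= 3)%N -> bounded_at (foldr dstate w s) K y) ->
  `|f x| <= decay_const * K * tpow (- lam) x.
Proof.
move=> cf W K0 Ux x1 b.
have Ff : field f by case: W => Fa FB Fd _ _ _ _; case: cf => [[i ->]|[j [k ->]]|->].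
have s3 : size allx = 3%N by rewrite size_enum_ord.
have T0 := tpow_gt0 (2 * lam) Ux.
have step : tpow (2 * lam) x * f x ^+ 2 <= (decay_const * K) ^+ 2.
  rewrite exprMn sqr_sqrtr; last first.
    by rewrite !mulr_ge0 ?exprn_ge0 ?mulr_ge0 ?pi_ge0.
  have := sobolev allx Ff Ux; rewrite s3 => S.
  have FE := field_energies allx W.
  have S2 : means allx (sumsq allx f) x <= 2 * means allx (energies allx w) x.
    rewrite -(means_time allx (fun=> 2) FE Ux).
    apply: le_means => //; first exact: field_sumsq.
      by apply: fieldM => //; exact: field_cst.
    move=> y yx; apply: sumsq_le => //.
    by rewrite /spacetime /= yx.
  have s0 : 0 <= 1 - x 0 0 by rewrite subr_ge0.
  have S3 := energies_nondecreasing allx W Ux s0.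
  set y := x + _ *: e0 in S3.
  have y1 : y 0 0 = 1 by rewrite time_flow addrC subrK.
  have Uy : U y by rewrite /spacetime /= y1.
  have t1 : tpow (2 * lam) y = 1 by rewrite /tpow y1 powR1.
  have S4 : means allx (energies allx w) y <= 2 ^+ 3 * (9 * K ^+ 2) * (2 * pi) ^+ 3.
    have := means_cst allx (2 ^+ 3 * (9 * K ^+ 2)) y; rewrite s3 => <-.
    apply: le_means => //; first exact: field_cst.
    move=> z zy; have := @energies_le allx w K z; rewrite s3; apply => s.
    by apply: b; rewrite zy.
  rewrite t1 mul1r in S3.
  have S5 := le_trans S3 S4.
  have : tpow (2 * lam) x * f x ^+ 2 <= tpow (2 * lam) x * (2 ^+ 3 * (2 * means allx (energies allx w) x)).
    rewrite ler_pM2l //; apply: le_trans S _; rewrite ler_pM2l ?exprn_gt0 //.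
  move=> S6; apply: le_trans S6 _.
  have -> : tpow (2 * lam) x * (2 ^+ 3 * (2 * means allx (energies allx w) x)) =
    16 * (tpow (2 * lam) x * means allx (energies allx w) x) by ring.
  have -> : 2 ^+ 3 * (2 * (2 ^+ 3 * 9 * (2 * pi) ^+ 3)) * K ^+ 2 =
    16 * (2 ^+ 3 * (9 * K ^+ 2) * (2 * pi) ^+ 3) :> R by ring.
  by rewrite ler_pM2l.
have T1 : 0 < tpow lam x by exact: tpow_gt0.
have : `|tpow lam x * f x| <= decay_const * K.
  rewrite -[leRHS]ger0_norm ?mulr_ge0 ?sqrtr_ge0 // -ler_sqr ?nnegrE //.
  rewrite -!normrX ![`|_ ^+ 2|]ger0_norm ?sqr_ge0 //.
  by rewrite exprMn expr2 -tpowD // (_ : lam + lam = 2 * lam) //; ring.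
rewrite normrM (gtr0_norm T1) => h.
rewrite -(@ler_pM2l _ (tpow lam x)) //; apply: le_trans h _.
rewrite mulrCA -tpowD // subrr /tpow powRr0 mulr1.
by [].
Qed.

End Maxwell.

(* [ring] compares its atoms up to conversion, which is intractable for
   iterated derivatives, so that these are abstracted first. *)
Ltac generalize_partials := repeat match goal with
  | |- context [@bigop ?R ?I ?z ?r ?F] =>
    let s := fresh "s" in generalize (@bigop R I z r F); intro s
  end; repeat match goal with
  | |- context [@partial ?R ?n ?W ?a ?f ?x] =>
    let z := fresh "z" in generalize (@partial R n W a f x); intro z
  end.
Ltac pring := generalize_partials; ring.

(** * From the wave equation for a one-form to the first-order system *)

Section Potential.
Variable R : realType.
Variable p : 'I_3 -> R.
Local Notation U := (@spacetime R).
Local Notation dt := (@partial R 4 R ord0).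
Local Notation dx i := (@partial R 4 R (lift ord0 i)).
Local Notation T := (@tpow R (-1)).
Local Notation q j := (@tpow R (- p j)).

(** Together with [wave_space], the coordinate form of the wave operator; [box_time] and [box_space]
    identify them with the components of [box]. *)
Definition wave_time (w : 'I_4 -> 'rV[R]_4 -> R) x : R :=
  - dt (dt (w ord0)) x - T x * dt (w ord0) x + T x ^+ 2 * w ord0 x
  + \sum_j q j x ^+ 2 * (dx j (dx j (w ord0)) x
                         - 2 * p j * T x * dx j (w (lift ord0 j)) x).

Definition wave_space (w : 'I_4 -> 'rV[R]_4 -> R) i x : R :=
  - dt (dt (w (lift ord0 i))) x - (1 - 2 * p i) * T x * dt (w (lift ord0 i)) x
  + \sum_j q j x ^+ 2 * dx j (dx j (w (lift ord0 i))) x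
  - 2 * p i * T x * dx i (w ord0) x.

(** When the exponents sum to 1, the slices have mean curvature [1/t] up to sign, and the last
    component is the divergence of the one-form. The powers of [t] are nested so that [dx_tpowM] and
    [dt_tpowM] strip them one at a time. *)
Definition state_of (w : 'I_4 -> 'rV[R]_4 -> R) : state R := State
  (fun i x => q i x * (dt (w (lift ord0 i)) x - dx i (w ord0) x))
  (fun j k x => q j x * (q k x *
     (dx j (w (lift ord0 k)) x - dx k (w (lift ord0 j)) x)))
  (fun x => (\sum_j q j x * (q j x * dx j (w (lift ord0 j)) x))
     - (dt (w ord0) x + T x * w ord0 x)).

(** The magnetic equation is the closedness of [d omega]. The equations for the electric field and
    the divergence are the space and time components of the wave equation, used to eliminate second
    time derivatives. *)
Lemma maxwell_state_of w : (forall a, field (w a)) ->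
  (forall x, U x -> wave_time w x = 0) ->
  (forall i x, U x -> wave_space w i x = 0) ->
  maxwell p (state_of w).
Proof.
move=> Fw WT WS.
have FP a b := field_partial a (Fw b).
have FPP a b c := field_partial a (FP b c).
have Fa i := fieldB (FP ord0 (lift ord0 i)) (FP (lift ord0 i) ord0).
have FB j k := fieldB (FP (lift ord0 j) (lift ord0 k)) (FP (lift ord0 k) (lift ord0 j)).
have FqB j k := fieldM (field_tpow (- p k)) (FB j k).
have FS j := fieldM (field_tpow (- p j)) (fieldM (field_tpow (- p j)) (FP (lift ord0 j) (lift ord0 j))).
have FTw := fieldM (field_tpow (-1)) (Fw ord0).
have Fd0 := fieldD (FP ord0 ord0) FTw.
have FSum := @field_sum R _ (index_enum 'I_3) xpredT _ FS.
have Dmagn l j k x : U x -> dx l (magn (state_of w) j k) x =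
    q j x * (q k x * (dx l (dx j (w (lift ord0 k))) x - dx l (dx k (w (lift ord0 j))) x)).
  by move=> Ux; rewrite (dx_tpowM _ _ (FqB j k) Ux) (dx_tpowM _ _ (FB j k) Ux)
    (dB _ (FP _ _) (FP _ _) Ux).
have Delec l i x : U x -> dx l (elec (state_of w) i) x =
    q i x * (dx l (dt (w (lift ord0 i))) x - dx l (dx i (w ord0)) x).
  by move=> Ux; rewrite (dx_tpowM _ _ (Fa i) Ux) (dB _ (FP _ _) (FP _ _) Ux).
split.
- by move=> i; exact: (fieldM (field_tpow _) (Fa i)).
- by move=> j k; exact: (fieldM (field_tpow _) (FqB j k)).
- exact: (fieldB FSum Fd0).
- by move=> j k x _ /=; ring.
- move=> i x Ux /=.
  rewrite (dt_tpowM _ (Fa i) Ux) (dB _ (FP _ _) (FP _ _) Ux).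
  rewrite (dB _ FSum Fd0 Ux) (dD _ (FP _ _) FTw Ux) (dx_tpowM _ _ (Fw _) Ux).
  rewrite (d_sum _ xpredT _ FS Ux).
  have E := WS i x Ux.
  have -> : dt (dt (w (lift ord0 i))) x = - (1 - 2 * p i) * T x * dt (w (lift ord0 i)) x
    + \sum_j q j x ^+ 2 * dx j (dx j (w (lift ord0 i))) x
    - 2 * p i * T x * dx i (w ord0) x by move: E; rewrite /wave_space; lra.
  have -> : \sum_j q j x * dx j (magn (state_of w) j i) x =
    q i x * ((\sum_j q j x ^+ 2 * dx j (dx j (w (lift ord0 i))) x)
      - (\sum_j q j x ^+ 2 * dx j (dx i (w (lift ord0 j))) x)).
    rewrite -sumrB mulr_sumr; apply: eq_bigr => j _; rewrite (Dmagn _ _ _ _ Ux); pring.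
  have -> : \sum_j dx i (fun x => q j x * (q j x * dx j (w (lift ord0 j)) x)) x =
    \sum_j q j x ^+ 2 * dx j (dx i (w (lift ord0 j))) x.
    apply: eq_bigr => j _.
    rewrite (dx_tpowM _ _ (fieldM (field_tpow _) (FP _ _)) Ux) (dx_tpowM _ _ (FP _ _) Ux).
    by rewrite (d_comm i _ (Fw _) Ux); pring.
  by rewrite (d_comm i _ (Fw _) Ux); pring.
- move=> j k x Ux /=.
  rewrite (dt_tpowM _ (FqB j k) Ux) (dt_tpowM _ (FB j k) Ux) (dB _ (FP _ _) (FP _ _) Ux).
  rewrite -!(d_comm _ ord0 (Fw _) Ux).
  rewrite (Delec j k x Ux) (Delec k j x Ux).
  by rewrite (d_comm j (lift ord0 k) (Fw ord0) Ux); pring.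
- move=> x Ux /=.
  rewrite (dB _ FSum Fd0 Ux) (dD _ (FP _ _) FTw Ux) (dt_tpowM _ (Fw _) Ux).
  rewrite (d_sum _ xpredT _ FS Ux).
  have E := WT x Ux.
  have -> : dt (dt (w ord0)) x = - T x * dt (w ord0) x + T x ^+ 2 * w ord0 x
    + \sum_j q j x ^+ 2 * (dx j (dx j (w ord0)) x
       - 2 * p j * T x * dx j (w (lift ord0 j)) x).
    by move: E; rewrite /wave_time; lra.
  rewrite (eq_bigr _ (fun i _ => congr1 (fun z => q i x * z) (Delec i i x Ux))).
  have -> : \sum_j dt (fun x => q j x * (q j x * dx j (w (lift ord0 j)) x)) x =
    \sum_j q j x ^+ 2 * (dx j (dt (w (lift ord0 j))) x
       - 2 * p j * T x * dx j (w (lift ord0 j)) x).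
    apply: eq_bigr => j _.
    rewrite (dt_tpowM _ (fieldM (field_tpow _) (FP _ _)) Ux) (dt_tpowM _ (FP _ _) Ux).
    by rewrite -(d_comm j ord0 (Fw _) Ux); pring.
  have -> : \sum_i q i x * (q i x * (dx i (dt (w (lift ord0 i))) x - dx i (dx i (w ord0)) x))
   = (\sum_j q j x ^+ 2 * (dx j (dt (w (lift ord0 j))) x
       - 2 * p j * T x * dx j (w (lift ord0 j)) x)) -
     (\sum_j q j x ^+ 2 * (dx j (dx j (w ord0)) x
       - 2 * p j * T x * dx j (w (lift ord0 j)) x)).
    by rewrite -sumrB; apply: eq_bigr => i _; pring.
  by pring.
Qed.

End Potential.

(** * The wave operator of a Kasner metric *)

Section KasnerBox.
Variable R : realType.
Variables p1 p2 p3 : R.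
Local Notation U := (@spacetime R).
Local Notation "'d_ a" := (@partial R 4 R a) (at level 10, a at level 2, format "''d_' a").
Local Notation T := (@tpow R (-1)).
Local Notation g := (kasner_metric p1 p2 p3).

Definition kexp (i : 'I_3) : R := [:: p1; p2; p3]`_i.

(** The exponent 0 in the time direction allows one formula for all Christoffel symbols. *)
Definition kexp4 (a : 'I_4) : R := [:: 0; p1; p2; p3]`_a.

Lemma kexp4_lift i : kexp4 (lift ord0 i) = kexp i.
Proof. by []. Qed.

Definition kdiag (a : 'I_4) (x : 'rV[R]_4) : R :=
  [:: -1; tpow (2 * p1) x; tpow (2 * p2) x; tpow (2 * p3) x]`_a.

Lemma kdiag_lift i x : kdiag (lift ord0 i) x = tpow (2 * kexp i) x.
Proof. by case: i => [[|[|[|]]]]. Qed.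

Lemma kasner_metricE x a b : g x a b = kdiag a x *+ (a == b).
Proof. by rewrite /kasner_metric !mxE. Qed.

Lemma kdiag_neq0 a x : U x -> kdiag a x != 0.
Proof.
move=> Ux; case: (unliftP ord0 a) => [i ->|->].
  by rewrite kdiag_lift gt_eqF // tpow_gt0.
by rewrite /kdiag /= oppr_eq0 oner_eq0.
Qed.

Lemma inv_metricE x a b : U x -> inv_metric g x a b = (kdiag a x)^-1 *+ (a == b).
Proof.
move=> Ux; rewrite /inv_metric.
pose B : 'M[R]_4 := \matrix_(a, b) ((kdiag a x)^-1 *+ (a == b)).
have gB : g x *m B = 1%:M.
  apply/matrixP => i j; rewrite !mxE (bigD1 i) //= big1 => [|k ki].
    by rewrite kasner_metricE eqxx mxE mulr1n mulrnAr divff ?kdiag_neq0 // addr0.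
  by rewrite kasner_metricE eq_sym (negPf ki) mulr0n mul0r.
have [gu _] := mulmx1_unit gB.
have -> : invmx (g x) = B by rewrite -[LHS]mulmx1 -gB mulKmx.
by rewrite mxE.
Qed.

Lemma partial_metric a b c x : U x ->
  'd_a (fun y => g y b c) x = ((b == c) && (a == ord0))%:R * (2 * kexp4 b * T x * kdiag b x).
Proof.
move=> Ux.
have -> : (fun y => g y b c) = (fun y => kdiag b y *+ (b == c)).
  by apply/funext => y; rewrite kasner_metricE.
have [_|_] /= := eqVneq b c; last first.
  under eq_fun do rewrite mulr0n.
  by rewrite partial_cst mul0r.
under eq_fun do rewrite mulr1n.
case: (unliftP ord0 b) => [i ->|->]; last first.
  by rewrite [kexp4 _]/= /kdiag /= partial_cst mulr0 !mul0r mulr0.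
have -> : kdiag (lift ord0 i) = tpow (2 * kexp i).
  by apply/funext => y; rewrite kdiag_lift.
rewrite kexp4_lift; case: (unliftP ord0 a) => [j ->|->].
  by rewrite partial_tpow // mul0r.
rewrite partial_tpow0 // mul1r tpowD //; ring.
Qed.

Lemma christoffelE c a b x : U x -> christoffel g c a b x =
  T x * (((b == c) && (a == ord0))%:R * kexp4 c + ((a == c) && (b == ord0))%:R * kexp4 c
         + ((a == b) && (c == ord0))%:R * (kexp4 a * kdiag a x)).
Proof.
move=> Ux; rewrite /christoffel (bigD1 c) //= big1 => [|d dc]; last first.
  by rewrite inv_metricE // eq_sym (negPf dc) mulr0n mul0r.
rewrite addr0 inv_metricE // eqxx mulr1n !partial_metric //.
have h := kdiag_neq0 c Ux.
have E1 : ((b == c) && (a == ord0))%:R * (2 * kexp4 b * T x * kdiag b x) =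
          ((b == c) && (a == ord0))%:R * (2 * kexp4 c * T x * kdiag c x).
  by have [->|] := eqVneq b c; rewrite //= !mul0r.
have E2 : ((a == c) && (b == ord0))%:R * (2 * kexp4 a * T x * kdiag a x) =
          ((a == c) && (b == ord0))%:R * (2 * kexp4 c * T x * kdiag c x).
  by have [->|] := eqVneq a c; rewrite //= !mul0r.
(* Only [c = ord0] contributes, and there [- kdiag c x] is 1. *)
have E3 z : ((a == b) && (c == ord0))%:R * z = - kdiag c x * (((a == b) && (c == ord0))%:R * z).
  have [->|] := eqVneq c ord0; last by rewrite andbF !mul0r mulr0.
  by rewrite /kdiag /= opprK mul1r.
rewrite E1 E2 (E3 (2 * _ * _ * _)); by field.
Qed.

Lemma sum_delta (F : 'I_4 -> R) c : \sum_d (d == c)%:R * F d = F c.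
Proof.
rewrite (bigD1 c) //= eqxx mul1r big1 ?addr0 // => d dc.
by rewrite (negPf dc) mul0r.
Qed.

Lemma sum_christoffel a b x (F : 'I_4 -> R) : U x ->
  \sum_d christoffel g d a b x * F d =
  T x * ((a == ord0)%:R * kexp4 b * F b + (b == ord0)%:R * kexp4 a * F a
         + (a == b)%:R * (kexp4 a * kdiag a x) * F ord0).
Proof.
move=> Ux.
transitivity (\sum_d ((d == b)%:R * (T x * (a == ord0)%:R * kexp4 d * F d)
  + (d == a)%:R * (T x * (b == ord0)%:R * kexp4 d * F d)
  + (d == ord0)%:R * (T x * (a == b)%:R * (kexp4 a * kdiag a x) * F d))).
  apply: eq_bigr => d _; rewrite christoffelE // !(eq_sym d).
  by rewrite -!mulnb !natrM; ring.
rewrite !big_split /= !sum_delta; ring.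
Qed.

Variable w : 'rV[R]_4 -> 'rV[R]_4.
Hypothesis Fw : forall a, field (fun x => w x 0 a).
Let v a x := w x 0 a.

Lemma nablaE a c x : U x -> nabla g w a c x = 'd_a (v c) x
  - T x * ((a == ord0)%:R * kexp4 c * v c x + (c == ord0)%:R * kexp4 a * v a x
         + (a == c)%:R * (kexp4 a * kdiag a x) * v ord0 x).
Proof. by move=> Ux; rewrite /nabla (sum_christoffel a c (fun d => v d x)). Qed.

Lemma nabla2E a c x : U x -> nabla2 g w a a c x = 'd_a (nabla g w a c) x
  - T x * (kexp4 a * kdiag a x) * nabla g w ord0 c x
  - T x * ((a == ord0)%:R * kexp4 c * nabla g w a c x
         + (c == ord0)%:R * kexp4 a * nabla g w a a x
         + (a == c)%:R * (kexp4 a * kdiag a x) * nabla g w a ord0 x).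
Proof.
move=> Ux; rewrite /nabla2 (sum_christoffel a a (fun d => nabla g w d c x)) //.
rewrite (sum_christoffel a c (fun d => nabla g w a d x)) // eqxx.
have -> : (a == ord0)%:R * kexp4 a * nabla g w a c x = 0 :> R.
  by have [->|] := eqVneq a ord0; rewrite ?mul0r // mulr0 mul0r.
by rewrite !add0r mul1r !mulrA.
Qed.

Lemma boxE c x : U x -> box g w x 0 c = \sum_a (kdiag a x)^-1 * nabla2 g w a a c x.
Proof.
move=> Ux; rewrite mxE; apply: eq_bigr => a _.
rewrite (bigD1 a) //= big1 ?addr0 => [|b ba]; first by rewrite inv_metricE // eqxx mulr1n.
by rewrite inv_metricE // eq_sym (negPf ba) mulr0n mul0r.
Qed.

Lemma kdiag_inv i x : U x -> (kdiag (lift ord0 i) x)^-1 = tpow (- kexp i) x ^+ 2.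
Proof.
move=> Ux; rewrite kdiag_lift expr2 -tpowD //.
apply: (mulfI (lt0r_neq0 (tpow_gt0 (2 * kexp i) Ux))).
rewrite divff ?gt_eqF ?tpow_gt0 // -tpowD // (_ : _ + _ = 0) ?/tpow ?powRr0 //.
by ring.
Qed.

Hypothesis sum1 : p1 + p2 + p3 = 1.
Hypothesis sum2 : p1 ^+ 2 + p2 ^+ 2 + p3 ^+ 2 = 1.

Lemma sum_kexp : \sum_i kexp i = 1.
Proof. by rewrite !big_ord_recl big_ord0 /kexp /= -sum1; ring. Qed.

Lemma sum_kexp2 : \sum_i kexp i ^+ 2 = 1.
Proof. by rewrite !big_ord_recl big_ord0 /kexp /= -sum2; ring. Qed.

Let lift0F i : (lift ord0 i == ord0 :> 'I_4) = false.
Proof. by []. Qed.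

Let lift0F' i : (ord0 == lift ord0 i :> 'I_4) = false.
Proof. by []. Qed.

Let liftE i j : (lift ord0 i == lift ord0 j :> 'I_4) = (i == j).
Proof. by rewrite (inj_eq lift_inj). Qed.

Let kexp40 : kexp4 ord0 = 0.
Proof. by []. Qed.

Let nabla00 x : U x -> nabla g w ord0 ord0 x = 'd_ord0 (v ord0) x.
Proof. by move=> Ux; rewrite nablaE // kexp40 !(mul0r, mulr0, addr0) subr0. Qed.

Let nabla_x0 i x : U x -> nabla g w (lift ord0 i) ord0 x =
  'd_(lift ord0 i) (v ord0) x - T x * (kexp i * v (lift ord0 i) x).
Proof.
by move=> Ux; rewrite nablaE // lift0F eqxx kexp4_lift !(mul0r, addr0, add0r) mul1r.
Qed.

Let nabla_0x i x : U x -> nabla g w ord0 (lift ord0 i) x =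
  'd_ord0 (v (lift ord0 i)) x - T x * (kexp i * v (lift ord0 i) x).
Proof.
move=> Ux.
by rewrite nablaE // lift0F lift0F' eqxx kexp4_lift !(mul0r, addr0) mul1r.
Qed.

Let nabla_xx i j x : U x -> nabla g w (lift ord0 i) (lift ord0 j) x =
  'd_(lift ord0 i) (v (lift ord0 j)) x
  - T x * (tpow (2 * kexp i) x * ((i == j)%:R * kexp i * v ord0 x)).
Proof.
move=> Ux; rewrite nablaE // !lift0F liftE !kexp4_lift kdiag_lift !(mul0r, add0r).
by pring.
Qed.

(** Both Kasner relations enter: the sum of the exponents multiplies the time derivative of
    [v ord0], and the sum of their squares multiplies [v ord0] itself. *)
Lemma box_time x : U x -> box g w x 0 ord0 = wave_time kexp v x.
Proof.
move=> Ux; rewrite boxE // big_ord_recl.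
have -> : (kdiag ord0 x)^-1 * nabla2 g w ord0 ord0 ord0 x = - 'd_ord0 ('d_ord0 (v ord0)) x.
  rewrite nabla2E // (d_eq _ nabla00 Ux) kexp40 !(mul0r, mulr0, addr0) !subr0.
  by rewrite /kdiag /= invrN invr1 mulN1r.
have Ei i : (kdiag (lift ord0 i) x)^-1 * nabla2 g w (lift ord0 i) (lift ord0 i) ord0 x =
    tpow (- kexp i) x ^+ 2 * ('d_(lift ord0 i) ('d_(lift ord0 i) (v ord0)) x
       - 2 * kexp i * T x * 'd_(lift ord0 i) (v (lift ord0 i)) x)
    - (T x * 'd_ord0 (v ord0) x) * kexp i + (T x ^+ 2 * v ord0 x) * kexp i ^+ 2.
  have Fp := fieldM (field_cst (kexp i)) (Fw (lift ord0 i)).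
  have Fp2 := fieldM (field_tpow (-1)) Fp.
  rewrite nabla2E // lift0F !(mul0r, add0r, addr0).
  rewrite (d_eq _ (nabla_x0 i) Ux) (dB _ (field_partial _ (Fw _)) Fp2 Ux).
  rewrite (dx_tpowM _ _ Fp Ux) (dM _ (field_cst _) (Fw _) Ux) partial_cst mulr0 addr0.
  rewrite nabla00 // nabla_xx // !eqxx !mul1r !kexp4_lift -(kdiag_lift i x) -(kdiag_inv i Ux).
  have h := kdiag_neq0 (lift ord0 i) Ux.
  by rewrite /v; generalize_partials; field.
rewrite (eq_bigr _ (fun i _ => Ei i)) big_split /= sumrB -!mulr_sumr sum_kexp sum_kexp2 /wave_time.
set S := (X in _ + (X - _ + _) = _); set S' := (X in _ = _ + X).
have -> : S' = S by []; by pring.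
Qed.

(** The terms of order zero have coefficients [- (p_j + p_j^2)], [p_j * \sum_i p_i] and [p_j^2]
    times [1/t^2], and cancel because the exponents sum to 1. *)
Lemma box_space j x : U x -> box g w x 0 (lift ord0 j) = wave_space kexp v j x.
Proof.
move=> Ux; rewrite boxE // big_ord_recl.
have -> : (kdiag ord0 x)^-1 * nabla2 g w ord0 ord0 (lift ord0 j) x =
   - 'd_ord0 ('d_ord0 (v (lift ord0 j))) x + 2 * kexp j * T x * 'd_ord0 (v (lift ord0 j)) x
   - (kexp j + kexp j ^+ 2) * T x ^+ 2 * v (lift ord0 j) x.
  have Fp := fieldM (field_cst (kexp j)) (Fw (lift ord0 j)).
  have Fp2 := fieldM (field_tpow (-1)) Fp.
  rewrite nabla2E // eqxx lift0F lift0F' kexp40 kexp4_lift !(mul0r, mulr0, addr0) subr0 mul1r.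
  rewrite (d_eq _ (nabla_0x j) Ux) (dB _ (field_partial _ (Fw _)) Fp2 Ux).
  rewrite (dt_tpowM _ Fp Ux) (dM _ (field_cst _) (Fw _) Ux) partial_cst mulr0 addr0.
  rewrite nabla_0x // [kdiag _ _]/(-1) invrN invr1.
  by rewrite /v; pring.
have Ei i : (kdiag (lift ord0 i) x)^-1 * nabla2 g w (lift ord0 i) (lift ord0 i) (lift ord0 j) x =
    tpow (- kexp i) x ^+ 2 * 'd_(lift ord0 i) ('d_(lift ord0 i) (v (lift ord0 j))) x
    - (T x * ('d_ord0 (v (lift ord0 j)) x - T x * (kexp j * v (lift ord0 j) x))) * kexp i
    - (i == j)%:R * (2 * kexp i * T x * 'd_(lift ord0 i) (v ord0) x
                     - kexp i ^+ 2 * T x ^+ 2 * v (lift ord0 i) x).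
  have Fp := fieldM (field_cst ((i == j)%:R * kexp i)) (Fw ord0).
  have Fp2 := fieldM (field_tpow (2 * kexp i)) Fp.
  have Fp3 := fieldM (field_tpow (-1)) Fp2.
  rewrite nabla2E // !lift0F liftE !(mul0r, add0r).
  rewrite (d_eq _ (nabla_xx i j) Ux) (dB _ (field_partial _ (Fw _)) Fp3 Ux).
  rewrite (dx_tpowM _ _ Fp2 Ux) (dx_tpowM _ _ Fp Ux).
  rewrite (dM _ (field_cst _) (Fw _) Ux) partial_cst mulr0 addr0.
  rewrite nabla_0x // nabla_x0 // !kexp4_lift -(kdiag_lift i x) -(kdiag_inv i Ux).
  have h := kdiag_neq0 (lift ord0 i) Ux.
  by rewrite /v; generalize_partials; field.
have E2 (F : 'I_3 -> R) : \sum_i (i == j)%:R * F i = F j.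
  rewrite (bigD1 j) //= eqxx mul1r big1 ?addr0 // => i ij.
  by rewrite (negPf ij) mul0r.
rewrite (eq_bigr _ (fun i _ => Ei i)) !sumrB -!mulr_sumr sum_kexp E2 /wave_space.
set S := (X in _ + (X - _ - _) = _); set S' := (X in _ = _ + X - _).
have -> : S' = S by []; by pring.
Qed.

End KasnerBox.

(** * Functions of one variable whose derivative is bounded by a power *)

Section PowerBounds.
Variable R : realType.
Implicit Types (z dz : R -> R) (C r s : R).

Lemma powR_le1 (t a b : R) : 0 < t <= 1 -> a <= b -> t `^ b <= t `^ a.
Proof. by move=> t01 ab; apply: ger_powR. Qed.

(* the right-hand side is the integral of the bound on the derivative *)
Lemma power_variation z dz C r s s' : r != 0 -> 0 < s -> s <= s' ->
  (forall u, s <= u <= s' -> is_derive u (1 : R) z (dz u)) ->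
  (forall u, s <= u <= s' -> `|dz u| <= C * u `^ (r - 1)) ->
  `|z s' - z s| <= C / r * (s' `^ r - s `^ r).
Proof.
move=> r0 s0 ss' dzE dzC.
have D (e : R) u : s <= u <= s' ->
    is_derive u (1 : R) (fun u => C / r * u `^ r + e * z u)
      (C * u `^ (r - 1) + e * dz u).
  move=> us; have u0 : 0 < u by case/andP: us => su _; exact: lt_le_trans su.
  have Dz := dzE u us; have Dp := is_derive1_powR r u0.
  apply: is_derive_eq.
  by rewrite /GRing.scale /=; field.
have P u : s <= u <= s' -> 0 <= C * u `^ (r - 1) + 1 * dz u.
  by move=> /dzC; rewrite mul1r ler_norml => /andP[h _]; rewrite addrC -lerBlDr sub0r.
have N u : s <= u <= s' -> 0 <= C * u `^ (r - 1) + (-1) * dz u.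
  by move=> /dzC; rewrite mulN1r subr_ge0 ler_norml => /andP[].
have h1 := nondecreasing_is_derive ss' (D 1) P.
have h2 := nondecreasing_is_derive ss' (D (-1)) N.
by rewrite ler_norml; apply/andP; split; lra.
Qed.

(** Adding [C / r * s ^ r] makes [z] nondecreasing and bounded below on []0, 1]], so that it
    converges at 0, and the added term tends to 0. *)
Lemma power_cvg z dz C r : 0 < r -> 0 <= C ->
  (forall u : R, 0 < u <= 1 -> is_derive u (1 : R) z (dz u)) ->
  (forall u : R, 0 < u <= 1 -> `|dz u| <= C * u `^ (r - 1)) ->
  exists l : R, z s @[s --> 0^'+] --> l.
Proof.
move=> r0 C0 dzE dzC.
have V s s' : 0 < s -> s <= s' -> s' <= 1 -> `|z s' - z s| <= C / r * (s' `^ r - s `^ r).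
  move=> s0 ss' s'1; apply: (@power_variation _ dz) => //; first exact: lt0r_neq0.
    by move=> u /andP[su us]; apply: dzE; rewrite (lt_le_trans s0 su) (le_trans us).
  by move=> u /andP[su us]; apply: dzC; rewrite (lt_le_trans s0 su) (le_trans us).
pose Z s := z s + C / r * s `^ r.
have cr : 0 <= C / r by rewrite divr_ge0 // ltW.
have cZ : Z s @[s --> 0^'+] --> inf [set Z s | s in [set` `]0, 1]]].
  apply: nondecreasing_at_right_cvgr.
  - by rewrite bnd_simp.
  - move=> s s' ; rewrite !in_itv /= => /andP[s0 _] /andP[_ s1] ss'.
    have := V s s' s0 ss' s1; rewrite ler_norml => /andP[h _].
    by rewrite /Z; lra.
  - exists (z 1 - C / r); move=> y [s /=]; rewrite in_itv /= => /andP[s0 s1] <-.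
    have := V s 1 s0 s1 (lexx _); rewrite powR1 ler_norml => /andP[_ h].
    by have := mulr_ge0 cr (powR_ge0 s r); rewrite /Z; lra.
exists (inf [set Z s | s in [set` `]0, 1]]] - C / r * 0).
have -> : z = (fun s => Z s - C / r * s `^ r) by apply/funext => s; rewrite /Z addrK.
apply: cvgB => //; apply: cvgM; first exact: cvg_cst.
exact: powR_cvg0.
Qed.

(** For [r < 0] the bound on the derivative is not integrable at 0. Integration from [s] to 1
    permits growth like [s ^ r], which also absorbs [z 1] because [1 <= s ^ r]. *)
Lemma power_growth z dz C r s : r < 0 -> 0 <= C -> 0 < s <= 1 ->
  (forall u : R, 0 < u <= 1 -> is_derive u (1 : R) z (dz u)) ->
  (forall u : R, 0 < u <= 1 -> `|dz u| <= C * u `^ (r - 1)) ->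
  `|z s| <= (`|z 1| + C / - r) * s `^ r.
Proof.
move=> r0 C0 /andP[s0 s1] dzE dzC.
have V : `|z 1 - z s| <= C / r * (1 `^ r - s `^ r).
  apply: (@power_variation _ dz) => //; first by rewrite lt_eqF.
    by move=> u /andP[su us]; apply: dzE; rewrite (lt_le_trans s0 su).
  by move=> u /andP[su us]; apply: dzC; rewrite (lt_le_trans s0 su).
have S1 : 1 <= s `^ r.
  by rewrite -(powRr0 s); apply: powR_le1; rewrite ?s0 // ltW.
rewrite powR1 in V.
have cr : 0 <= C / - r by rewrite divr_ge0 // oppr_ge0 ltW.
have -> : z s = z 1 - (z 1 - z s) by rewrite subKr.
apply: le_trans (ler_normB _ _) _.
rewrite mulrDl; apply: lerD; first by rewrite ler_peMr.
apply: le_trans V _; rewrite invrN mulrN in cr *.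
have -> : C / r * (1 - s `^ r) = - (C / r) * s `^ r - - (C / r) by ring.
by rewrite lerBlDr lerDl.
Qed.

End PowerBounds.

Section KasnerExponents.
Variables (R : realType) (p1 p2 p3 : R).
Hypothesis hp : kasner_exponents p1 p2 p3.
Hypothesis hflat : p3 < 1.
Local Notation p := (kexp p1 p2 p3).

Lemma kasner_p1_lt0 : p1 < 0.
Proof.
case: hp => h12 h23 h1 h2; rewrite ltNge; apply/negP => p0.
(* Twice this sum is the squared sum of the exponents minus the sum of their squares. If all
   exponents were nonnegative, every product would vanish and leave [(0, 0, 1)], against
   [p3 < 1]. *)
have e : p1 * p2 + p1 * p3 + p2 * p3 = 0 by nra.
have a : 0 <= p1 * p2 by nra.
have b : 0 <= p1 * p3 by nra.
have c : 0 <= p2 * p3 by nra.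
have c0 : p2 * p3 = 0 by lra.
have p20 : p2 = 0 by move/eqP: c0; rewrite mulf_eq0 => /orP[/eqP //|/eqP ?]; lra.
by move: hflat; lra.
Qed.

Lemma kasner_sum12 : p1 + p2 = 1 - p3.
Proof. by case: hp => _ _ h1 _; lra. Qed.

Lemma kasner_p2_gt0 : 0 < p2.
Proof. by have := kasner_p1_lt0; have := kasner_sum12; move: hflat; lra. Qed.

Lemma kexp_le3 i : p i <= p3.
Proof. by case: hp => h12 h23 _ _; case: i => [[|[|[|]]]] //= ?; rewrite /kexp /=; lra. Qed.

Lemma kexp_ge1 i : p1 <= p i.
Proof. by case: hp => h12 h23 _ _; case: i => [[|[|[|]]]] //= ?; rewrite /kexp /=; lra. Qed.

Lemma kexp_lam_elec i : 1 - p i <= 1 - p1.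
Proof. by have := kexp_ge1 i; lra. Qed.

(** The extreme case is [p2 + p3 = 1 - p1]: B_23 shares the largest damping rate with E_1. *)
Lemma kexp_lam_magn (j k : 'I_3) : j != k -> p j + p k <= 1 - p1.
Proof.
case: hp => h12 h23 h1 _.
case: j => [[|[|[|]]]] //= ?; case: k => [[|[|[|]]]] //= ?; rewrite /kexp /= => _; lra.
Qed.

Lemma kexp_lam_ge0 : 0 <= 1 - p1.
Proof. by have := kasner_p1_lt0; lra. Qed.

End KasnerExponents.

(** * Asymptotics of the field components *)

Section Asymptotics.
Variables (R : realType) (p1 p2 p3 : R).
Hypothesis hp : kasner_exponents p1 p2 p3.
Hypothesis hflat : p3 < 1.
Local Notation p := (kexp p1 p2 p3).
Local Notation lam := (1 - p1).
Local Notation U := (@spacetime R).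
Local Notation dt := (@partial R 4 R ord0).
Local Notation dx i := (@partial R 4 R (lift ord0 i)).
Local Notation T := (@tpow R (-1)).
Local Notation ex i := (delta_mx 0 (lift ord0 i) : 'rV[R]_4).
Local Notation e0 := (delta_mx 0 ord0 : 'rV[R]_4).
Local Notation pt := (@spacetime_point R).
Implicit Types (f : 'rV[R]_4 -> R) (x z : 'rV[R]_4) (y : 'rV[R]_3) (t s : R) (w : state R).

Lemma pt_time t y : pt t y 0 ord0 = t.
Proof.
rewrite /spacetime_point mxE; case: splitP => [j _|j /=]; last by [].
by rewrite mxE ord1 eqxx mulr1n.
Qed.

Lemma pt_space t y i : pt t y 0 (lift ord0 i) = y 0 i.
Proof.
rewrite /spacetime_point mxE; case: splitP => [j /= e|j /= e].
  by have := ltn_ord j; rewrite -e.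
by congr (y 0 _); apply/val_inj; move: e; rewrite /= => -[].
Qed.

Lemma pt_eq t y (x : 'rV[R]_4) : x 0 ord0 = t ->
  (forall i, x 0 (lift ord0 i) = y 0 i) -> x = pt t y.
Proof.
move=> xt xy; apply/rowP => a; case: (unliftP ord0 a) => [i ->|->].
  by rewrite pt_space.
by rewrite pt_time.
Qed.

Lemma pt_flow t s y : pt (t + s) y = pt t y + s *: e0.
Proof.
apply/esym/pt_eq => [|i]; first by rewrite time_flow pt_time.
by rewrite coord_line pt_space mxE /= mulr0 addr0.
Qed.

Lemma pt_shift t s y i : pt t (y + s *: delta_mx 0 i) = pt t y + s *: ex i.
Proof.
apply/esym/pt_eq => [|k]; first by rewrite time_shift pt_time.
by rewrite coord_line pt_space !mxE (inj_eq lift_inj).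
Qed.

Lemma spacetime_pt t y : 0 < t -> U (pt t y).
Proof. by rewrite /spacetime /= pt_time. Qed.

Lemma tpow_pt m t y : tpow m (pt t y) = t `^ m.
Proof. by rewrite /tpow pt_time. Qed.

Lemma is_derive_time f t y : field f -> 0 < t ->
  is_derive t (1 : R) (fun t => f (pt t y)) (dt f (pt t y)).
Proof.
move=> F t0.
have -> : (fun t => f (pt t y)) = (fun t => f (pt 0 y + t *: e0)).
  by apply/funext => s; rewrite -pt_flow add0r.
apply/is_derive_line; rewrite -pt_flow add0r.
by apply: field_is_derive => //; exact: spacetime_pt.
Qed.

Lemma is_derive_space f t y i s : field f -> 0 < t ->
  is_derive s (1 : R) (fun s => f (pt t (y + s *: delta_mx 0 i)))
    (dx i f (pt t (y + s *: delta_mx 0 i))).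
Proof.
move=> F t0.
have -> : (fun s => f (pt t (y + s *: delta_mx 0 i))) = (fun s => f (pt t y + s *: ex i)).
  by apply/funext => z; rewrite pt_shift.
apply/is_derive_line; rewrite pt_shift.
by apply: field_is_derive => //; apply: spacetime_shift; exact: spacetime_pt.
Qed.

Definition dxs (l : seq 'I_3) f := foldr (fun i g => dx i g) f l.

Lemma field_dxs l f : field f -> field (dxs l f).
Proof. by move=> F; elim: l => [|i l IH] //=; exact: field_partial. Qed.

Lemma dxs_eq l f g x : (forall z, U z -> f z = g z) -> U x -> dxs l f x = dxs l g x.
Proof. by move=> fg; elim: l x => [|i l IH] x Ux /=; [exact: fg|exact: d_eq]. Qed.

Lemma dxsD l f g x : field f -> field g -> U x ->
  dxs l (fun z => f z + g z) x = dxs l f x + dxs l g x.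
Proof.
move=> F G; elim: l x => [|i l IH] x Ux //=.
by rewrite -(dD _ (field_dxs l F) (field_dxs l G) Ux); apply: d_eq.
Qed.

Lemma dxsB l f g x : field f -> field g -> U x ->
  dxs l (fun z => f z - g z) x = dxs l f x - dxs l g x.
Proof.
move=> F G; elim: l x => [|i l IH] x Ux //=.
by rewrite -(dB _ (field_dxs l F) (field_dxs l G) Ux); apply: d_eq.
Qed.

Lemma dxs_tpowM l m f x : field f -> U x ->
  dxs l (fun z => tpow m z * f z) x = tpow m x * dxs l f x.
Proof.
move=> F; elim: l x => [|i l IH] x Ux //=.
by rewrite -(dx_tpowM _ _ (field_dxs l F) Ux); apply: d_eq.
Qed.

Lemma elec_dstates l w i : elec (foldr (@dstate R) w l) i = dxs l (elec w i).
Proof. by elim: l => //= j l <-. Qed.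

Lemma magn_dstates l w j k : magn (foldr (@dstate R) w l) j k = dxs l (magn w j k).
Proof. by elim: l => //= i l <-. Qed.

Lemma dive_dstates l w : dive (foldr (@dstate R) w l) = dxs l (dive w).
Proof. by elim: l => //= i l <-. Qed.

Lemma maxwell_dstates l w : maxwell p w -> maxwell p (foldr (@dstate R) w l).
Proof. by move=> W; elim: l => //= i l; exact: maxwell_dstate. Qed.

Lemma component_dstates l w f : component w f ->
  component (foldr (@dstate R) w l) (dxs l f).
Proof. by move=> cf; elim: l => //= i l; exact: component_dstate. Qed.

(** [N] counts the derivatives to be spent: 3 for the Sobolev inequality, a fourth because the time
    derivative of a component involves space derivatives, then one for each further derivative of a
    profile and one for a Taylor remainder. *)
Definition data_bound w (N : nat) (K : R) := forall f, component w f ->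
  forall l x, x 0 0 = 1 -> (size l <= N)%N -> `|dxs l f x| <= K.

Lemma data_bound_dstates w N K l k : data_bound w N K -> (size l + k <= N)%N ->
  data_bound (foldr (@dstate R) w l) k K.
Proof.
move=> b lN f cf s x x1 sk.
have [g cg ->] : exists2 g, component w g & f = dxs l g.
  case: cf => [[i ->]|[i [j ->]]|->].
  - by rewrite elec_dstates; exists (elec w i) => //; apply: Or31; exists i.
  - by rewrite magn_dstates; exists (magn w i j) => //; apply: Or32; exists i, j.
  - by rewrite dive_dstates; exists (dive w) => //; apply: Or33.
rewrite /dxs -foldr_cat; apply: b => //.
by rewrite size_cat addnC (leq_trans _ lN) // leq_add2l.
Qed.

Lemma data_bound_at w (K : R) l (x : 'rV[R]_4) : data_bound w 3 K -> x 0 ord0 = 1 -> (size l <= 3)%N ->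
  bounded_at (foldr (@dstate R) w l) K x.
Proof.
move=> b x1 l3; split=> [i|j k|].
- by rewrite elec_dstates; apply: b => //; apply: Or31; exists i.
- by rewrite magn_dstates; apply: b => //; apply: Or32; exists j, k.
- by rewrite dive_dstates; apply: b => //; apply: Or33.
Qed.

Local Notation C0 := (decay_const R).

Lemma component_bound w f K x : maxwell p w -> data_bound w 3 K -> 0 <= K ->
  component w f -> U x -> x 0 0 <= 1 -> `|f x| <= C0 * K * tpow (- lam) x.
Proof.
move=> W b K0 cf Ux x1.
apply: (component_decay (kexp_lam_elec hp) (kexp_lam_magn hp) (kexp_lam_ge0 hp hflat)
  cf W K0 Ux x1) => l y y1 l3.
exact: data_bound_at.
Qed.

Lemma dx_component_bound w f K x i : maxwell p w -> data_bound w 4 K -> 0 <= K ->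
  component w f -> U x -> x 0 0 <= 1 -> `|dx i f x| <= C0 * K * tpow (- lam) x.
Proof.
move=> W b K0 cf Ux x1.
apply: (@component_bound (dstate i w)) => //; first exact: maxwell_dstate.
  exact: (@data_bound_dstates _ _ _ [:: i] 3 b).
exact: component_dstate.
Qed.

(** Pairs a component with its damping rate [m], so that no damping term is left in the equation for
    [t^m * f]. *)
Definition damped w m f := (exists2 i, m = 1 - p i & f = elec w i) \/
  (exists j k, m = p j + p k /\ f = magn w j k).

Lemma damped_component w m f : damped w m f -> component w f.
Proof.
by case=> [[i _ ->]|[j [k [_ ->]]]]; [apply: Or31; exists i|apply: Or32; exists j, k].
Qed.

Lemma C0_ge0 : 0 <= C0.
Proof. exact: sqrtr_ge0. Qed.

(** With the damping gone, only space derivatives remain, each of size [t^(-lam)] with a weight at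
    most [t^(-p3)]. The factor 4 counts three magnetic terms and one from the divergence; a magnetic
    component has only two terms. *)
Lemma dt_damped w m f K x : maxwell p w -> data_bound w 4 K -> 0 <= K ->
  damped w m f -> U x -> x 0 0 <= 1 ->
  `|dt (fun x => tpow m x * f x) x| <= 4 * (C0 * K) * tpow (m - lam - p3) x.
Proof.
move=> W b K0 df Ux x1.
have M0 : 0 <= C0 * K by rewrite mulr_ge0 // C0_ge0.
have cB j k : component w (magn w j k) by apply: Or32; exists j, k.
have ca i : component w (elec w i) by apply: Or31; exists i.
have cd : component w (dive w) by apply: Or33.
have term i g : component w g ->
    `|tpow (- p i) x * dx i g x| <= (C0 * K) * tpow (- lam - p3) x.
  move=> cg; rewrite normrM (gtr0_norm (tpow_gt0 _ Ux)).
  have h : tpow (- p i) x <= tpow (- p3) x.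
    apply: powR_le1; first by rewrite x1 andbT; exact: Ux.
    by have := kexp_le3 hp i; lra.
  apply: (@le_trans _ _ (tpow (- p3) x * (C0 * K * tpow (- lam) x))).
    apply: ler_pM => //; first exact/ltW/tpow_gt0.
    exact: (dx_component_bound i W b).
  by rewrite tpowD //; rewrite le_eqVlt; apply/orP; left; apply/eqP; ring.
have Tm : 0 < tpow m x by exact: tpow_gt0.
have -> : 4 * (C0 * K) * tpow (m - lam - p3) x =
    tpow m x * (4 * ((C0 * K) * tpow (- lam - p3) x)).
  by rewrite -addrA tpowD //; ring.
have F : field f by case: W => Fa FB Fd _ _ _ _; case: df => [[i _ ->]|[j [k [_ ->]]]].
rewrite dt_tpowM // normrM (gtr0_norm Tm) ler_pM2l //.
set B := _ * tpow (- lam - p3) x in term *.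
have B0 : 0 <= B by rewrite mulr_ge0 //; exact/ltW/tpow_gt0.
case: df => [[i -> ->]|[j [k [-> ->]]]].
  rewrite (dt_elec W) //.
  set S := \sum_j _; set D := _ * dx i _ _; set E := elec w i x.
  have -> : - (1 - p i) * tpow (-1) x * E + S + D + (1 - p i) * tpow (-1) x * E = S + D.
    by ring.
  have hS : `|S| <= 3 * B.
    apply: le_trans (ler_norm_sum _ _ _) _.
    have -> : 3 * B = \sum_(j < 3) B by rewrite !big_ord_recl big_ord0; ring.
    by apply: ler_sum => j _; exact: term.
  have hD : `|D| <= B by exact: term.
  by apply: le_trans (ler_normD _ _) _; lra.
rewrite (dt_magn W) //.
set D := _ * dx j _ _; set D' := _ * dx k _ _; set E := magn w j k x.
have -> : - (p j + p k) * tpow (-1) x * E + D - D' + (p j + p k) * tpow (-1) x * E = D - D'.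
  by ring.
have hD : `|D| <= B by exact: term.
have hD' : `|D'| <= B by exact: term.
by apply: le_trans (ler_normB _ _) _; lra.
Qed.

(** For the rate [lam] the derivative is of size [t^(-p3)], integrable at 0 because [p3 < 1]. *)
Lemma damped_cvg w f K y : maxwell p w -> data_bound w 4 K -> 0 <= K ->
  damped w lam f ->
  exists l : R, t `^ lam * f (pt t y) @[t --> 0^'+] --> l.
Proof.
move=> W b K0 df.
have F : field f.
  by case: W => Fa FB Fd _ _ _ _; case: df => [[i _ ->]|[j [k [_ ->]]]].
have M0 : 0 <= C0 * K by rewrite mulr_ge0 // C0_ge0.
pose h x := tpow lam x * f x.
have Fh : field h by exact: fieldM (field_tpow _) F.
have -> : (fun t => t `^ lam * f (pt t y)) = (fun t => h (pt t y)).
  by apply/funext => t; rewrite /h tpow_pt.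
apply: (@power_cvg R _ (fun t => dt h (pt t y)) (4 * (C0 * K)) (1 - p3)).
- by rewrite subr_gt0.
- by rewrite mulr_ge0.
- by move=> u /andP[u0 _]; exact: is_derive_time.
- move=> u /andP[u0 u1].
  have := @dt_damped w lam f K (pt u y) W b K0 df (spacetime_pt y u0).
  rewrite pt_time => /(_ u1); rewrite tpow_pt.
  by rewrite (_ : lam - lam - p3 = 1 - p3 - 1) //; ring.
Qed.

(** Here [t^m * f] may grow like the negative power [r = m - lam + 1 - p3]; the remaining factor
    [t^(lam - m)] turns this into the positive power [1 - p3]. *)
Lemma damped_decay w m f K y t : maxwell p w -> data_bound w 4 K -> 0 <= K ->
  damped w m f -> m - lam + 1 - p3 < 0 -> 0 < t <= 1 ->
  `|t `^ lam * f (pt t y)| <=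
  (K + 4 * (C0 * K) / - (m - lam + 1 - p3)) * t `^ (1 - p3).
Proof.
move=> W b K0 df m0 /andP[t0 t1].
have F : field f.
  by case: W => Fa FB Fd _ _ _ _; case: df => [[i _ ->]|[j [k [_ ->]]]].
have M0 : 0 <= C0 * K by rewrite mulr_ge0 // C0_ge0.
pose h x := tpow m x * f x.
have Fh : field h by exact: fieldM (field_tpow _) F.
set r := m - lam + 1 - p3 in m0 *.
have G := @power_growth R (fun t => h (pt t y)) (fun t => dt h (pt t y))
  (4 * (C0 * K)) r t m0.
have {}G : `|h (pt t y)| <= (`|h (pt 1 y)| + 4 * (C0 * K) / - r) * t `^ r.
  apply: G; first by rewrite mulr_ge0.
  - by rewrite t0.
  - by move=> u /andP[u0 _]; exact: is_derive_time.
  - move=> u /andP[u0 u1].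
    have := @dt_damped w m f K (pt u y) W b K0 df (spacetime_pt y u0).
    rewrite pt_time => /(_ u1); rewrite tpow_pt.
    by rewrite (_ : m - lam - p3 = r - 1) // /r; ring.
have h1 : `|h (pt 1 y)| <= K.
  rewrite /h tpow_pt powR1 mul1r.
  by apply: (b f (damped_component df) [::]); rewrite ?pt_time.
have -> : t `^ lam * f (pt t y) = t `^ (lam - m) * h (pt t y).
  rewrite /h tpow_pt mulrA -powRD; last by rewrite (lt0r_neq0 t0) implybT.
  by rewrite subrK.
rewrite normrM (gtr0_norm (powR_gt0 _ t0)).
have -> : 1 - p3 = (lam - m) + r by rewrite /r; ring.
rewrite [in X in _ <= X]powRD; last by rewrite (lt0r_neq0 t0) implybT.
rewrite [X in _ <= X]mulrCA ler_pM2l ?powR_gt0 //.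
apply: le_trans G _; rewrite ler_wpM2r ?powR_ge0 //.
by rewrite lerD2r.
Qed.

Lemma cvg_norm_le (g : R -> R) (l M : R) : g t @[t --> 0^'+] --> l ->
  (forall t, 0 < t <= 1 -> `|g t| <= M) -> `|l| <= M.
Proof.
move=> gl gM; apply: (@closed_cvg _ _ _ (at_right_proper_filter (0 : R)) g
  [set u : R | `|u| <= M] _ _ _ gl).
- have -> : [set u : R | `|u| <= M] = Num.norm @^-1` [set u | u <= M] by [].
  by apply: closed_comp => [u _|]; [exact: norm_continuous|exact: closed_le].
- near=> t; apply: gM; apply/andP; split; near: t.
    exact: nbhs_right_gt.
  by apply: nbhs_right_le.
Unshelve. all: by end_near. Qed.

End Asymptotics.

Section CoordinatePath.
Variable R : realType.
Implicit Types (y z u : 'rV[R]_3).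
Local Notation e i := (delta_mx 0 i : 'rV[R]_3).

Lemma row_shiftE u i (s : R) k :
  (u + s *: e i) 0 k = if k == i then u 0 k + s else u 0 k.
Proof.
rewrite !mxE eqxx /=; case: eqVneq => _; first by rewrite mulr1.
by rewrite mulr0 addr0.
Qed.

Let i0 : 'I_3 := ord0.
Let i1 : 'I_3 := lift ord0 ord0.
Let i2 : 'I_3 := lift ord0 (lift ord0 ord0).

Lemma I3P (k : 'I_3) : [\/ k = i0, k = i1 | k = i2].
Proof.
case: (unliftP ord0 k) => [k' ->|->]; last by apply: Or31.
case: (unliftP ord0 k') => [k'' ->|->]; last by apply: Or32.
by rewrite ord1; apply: Or33.
Qed.

(** The coordinates are changed one at a time, so that one-variable estimates suffice. The premise
    records that intermediate points mix coordinates of [y] and [z], which keeps them inside any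
    cube around [y] containing [z]. *)
Lemma coord_path (G : 'rV[R]_3 -> R) y z (L : 'I_3 -> R) :
  (forall u i, (forall k, u 0 k = y 0 k \/ u 0 k = z 0 k) -> u 0 i = y 0 i ->
     `|G (u + (z 0 i - y 0 i) *: e i) - G u| <= L i) ->
  `|G z - G y| <= \sum_i L i.
Proof.
move=> H.
pose u1 := y + (z 0 i0 - y 0 i0) *: e i0.
pose u2 := u1 + (z 0 i1 - y 0 i1) *: e i1.
have u1E k : u1 0 k = if k == i0 then z 0 k else y 0 k.
  by rewrite /u1 row_shiftE; case: eqVneq => // ->; rewrite subrKC.
have u2E k : u2 0 k = if k == i1 then z 0 k else u1 0 k.
  by rewrite /u2 row_shiftE; case: eqVneq => // ->; rewrite u1E subrKC.
have zE : z = u2 + (z 0 i2 - y 0 i2) *: e i2.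
  apply/rowP => k; rewrite row_shiftE u2E u1E.
  by case: (I3P k) => -> //=; rewrite subrKC.
have H0 : `|G u1 - G y| <= L i0 by apply: H => // k; left.
have H1 : `|G u2 - G u1| <= L i1.
  by apply: H => [k|]; rewrite u1E //; case: ifP; [right|left].
have H2 : `|G z - G u2| <= L i2.
  rewrite {1}zE; apply: H => [k|]; rewrite u2E u1E //.
  by case: ifP => _; [right|case: ifP => _; [right|left]].
rewrite !big_ord_recl big_ord0 addr0.
have -> : G z - G y = (G u1 - G y) + ((G u2 - G u1) + (G z - G u2)) by ring.
by do 2 (apply: le_trans (ler_normD _ _) _; apply: lerD => //).
Qed.

End CoordinatePath.

Lemma cvg_sumr (R : realType) (T I : Type) (F : set_system T) (FF : Filter F)
    (r : seq I) (f : I -> T -> R) (l : I -> R) :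
  (forall i, f i t @[t --> F] --> l i) ->
  \sum_(i <- r) f i t @[t --> F] --> \sum_(i <- r) l i.
Proof.
move=> h; elim: r => [|i r IH].
  rewrite big_nil; under eq_fun do rewrite big_nil.
  exact: cvg_cst.
rewrite big_cons; under eq_fun do rewrite big_cons.
exact: cvgD.
Qed.

(** * Limits of the weighted components and their dependence on the space point *)

Section Profile.
Variables (R : realType) (p1 p2 p3 : R).
Hypothesis hp : kasner_exponents p1 p2 p3.
Hypothesis hflat : p3 < 1.
Local Notation p := (kexp p1 p2 p3).
Local Notation lam := (1 - p1).
Local Notation U := (@spacetime R).
Local Notation dx i := (@partial R 4 R (lift ord0 i)).
Local Notation e i := (delta_mx 0 i : 'rV[R]_3).
Local Notation pt := (@spacetime_point R).
Local Notation C0 := (decay_const R).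
Implicit Types (f : 'rV[R]_4 -> R) (y : 'rV[R]_3) (t s : R) (w : state R).

Lemma field_component w f : maxwell p w -> component w f -> field f.
Proof. by case=> Fa FB Fd _ _ _ _ [[i ->]|[j [k ->]]|->]. Qed.

Lemma powR_inv t (a : R) : 0 < t -> t `^ a * t `^ (- a) = 1.
Proof.
move=> t0; rewrite -powRD ?subrr ?powRr0 //.
by rewrite (lt0r_neq0 t0) implybT.
Qed.

(** The weight cancels the rate [t^(-lam)] of the space derivative, so the Lipschitz constant is
    independent of [t] and survives the limit. *)
Lemma scaled_taylor1 w f K t y i s : maxwell p w -> data_bound w 4 K -> 0 <= K ->
  component w f -> 0 < t <= 1 ->
  `|t `^ lam * f (pt t (y + s *: e i)) - t `^ lam * f (pt t y)| <= C0 * K * `|s|.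
Proof.
move=> W b K0 cf /andP[t0 t1].
have F := field_component W cf.
have tl : 0 < t `^ lam by exact: powR_gt0.
rewrite -mulrBr normrM (gtr0_norm tl).
have := @MVT_le R (fun s => f (pt t (y + s *: e i))) (fun s => dx i f (pt t (y + s *: e i)))
  0 s (C0 * K * t `^ (- lam)).
rewrite scale0r addr0 subr0 => H.
have {}H : `|f (pt t (y + s *: e i)) - f (pt t y)| <= C0 * K * t `^ (- lam) * `|s|.
  apply: H => [z _|z _]; first exact: is_derive_space.
  rewrite -[t `^ _](tpow_pt _ t (y + z *: e i)).
  apply: (dx_component_bound hp hflat i W b K0 cf); first exact: spacetime_pt.
  by rewrite pt_time.
apply: (@le_trans _ _ (t `^ lam * (C0 * K * t `^ (- lam) * `|s|))).
  by rewrite ler_pM2l.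
by rewrite -[X in X <= _](_ : C0 * K * `|s| * (t `^ lam * t `^ (- lam)) = _);
  [rewrite powR_inv // mulr1|ring].
Qed.

Lemma scaled_taylor2 w f K t y i s : maxwell p w -> data_bound w 5 K -> 0 <= K ->
  component w f -> 0 < t <= 1 ->
  `|t `^ lam * f (pt t (y + s *: e i)) - t `^ lam * f (pt t y)
    - s * (t `^ lam * dx i f (pt t y))| <= C0 * K * s ^+ 2.
Proof.
move=> W b K0 cf t01; have /andP[t0 t1] := t01.
have F := field_component W cf.
have M0 : 0 <= C0 * K by rewrite mulr_ge0 // C0_ge0.
have W' := maxwell_dstate i W.
have b' := @data_bound_dstates _ w 5 K [:: i] 4 b isT.
have cf' := component_dstate i cf.
pose d z := t `^ lam * dx i f (pt t (y + z *: e i)).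
have dl z : `|d z - d 0| <= C0 * K * `|z|.
  by rewrite /d scale0r addr0; exact: (scaled_taylor1 _ _ _ W' b' K0 cf' t01).
pose g z := t `^ lam * f (pt t (y + z *: e i)) - z * d 0.
have gd z : is_derive z (1 : R) g (d z - d 0).
  have D := is_derive_space y i z F t0.
  apply: is_derive_eq.
  by rewrite scaler0 add0r [_%:A]mulr1.
have : `|g s - g 0| <= C0 * K * `|s| * `|s - 0|.
  apply: (MVT_le (g := fun z => d z - d 0)) => z zs.
  apply: le_trans (dl z) _; rewrite ler_wpM2l //.
  move: zs => /andP[]; rewrite ge_min le_max => z1 z2.
  by move: z1 z2; case: (ger0P s) => hs; case: (ger0P z) => hz; lra.
rewrite /g {2}/d scale0r addr0 mul0r subr0 subr0 /d scale0r addr0.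
rewrite -mulrA -expr2 real_normK ?num_real //.
by rewrite addrAC.
Qed.

(** [lim] is meaningful only where the limit exists, which [cvg_profile] ensures for components
    damped at rate [lam]. *)
Definition profile f y : R := lim (t `^ lam * f (pt t y) @[t --> 0^'+]).

Lemma cvg_profile w f K y : maxwell p w -> data_bound w 4 K -> 0 <= K ->
  damped p1 p2 p3 w lam f -> t `^ lam * f (pt t y) @[t --> 0^'+] --> profile f y.
Proof.
move=> W b K0 df; have [l h] := damped_cvg hp hflat y W b K0 df.
by rewrite /profile (cvg_lim _ h).
Qed.

Lemma damped_dstates w m f l : damped p1 p2 p3 w m f ->
  damped p1 p2 p3 (foldr (@dstate R) w l) m (dxs l f).
Proof.
case=> [[i -> ->]|[j [k [-> ->]]]].
  by left; exists i; rewrite ?elec_dstates.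
by right; exists j, k; rewrite magn_dstates.
Qed.

Lemma cvg_profile_dxs w f K l y N : maxwell p w -> data_bound w N K -> 0 <= K ->
  (size l + 4 <= N)%N -> damped p1 p2 p3 w lam f ->
  t `^ lam * dxs l f (pt t y) @[t --> 0^'+] --> profile (dxs l f) y.
Proof.
move=> W b K0 lN df; apply: cvg_profile K0 _.
- exact: (maxwell_dstates l W).
- exact: (data_bound_dstates b lN).
- exact: damped_dstates.
Qed.

Lemma profile_le w f K l y N : maxwell p w -> data_bound w N K -> 0 <= K ->
  (size l + 4 <= N)%N -> damped p1 p2 p3 w lam f ->
  `|profile (dxs l f) y| <= C0 * K.
Proof.
move=> W b K0 lN df.
apply: (cvg_norm_le (@cvg_profile_dxs _ _ _ _ y _ W b K0 lN df)) => t /andP[t0 t1].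
have l3 : (size l + 3 <= N)%N by apply: leq_trans lN; rewrite leq_add2l.
have := component_bound hp hflat (maxwell_dstates l W) (data_bound_dstates b l3) K0
  (component_dstates l (damped_component df)) (spacetime_pt y t0).
rewrite pt_time => /(_ t1) h.
rewrite normrM (gtr0_norm (powR_gt0 _ t0)).
apply: (@le_trans _ _ (t `^ lam * (C0 * K * t `^ (- lam)))).
  by rewrite ler_pM2l ?powR_gt0 // -[t `^ (- lam)](tpow_pt _ t y).
rewrite -[X in X <= _](_ : C0 * K * (t `^ lam * t `^ (- lam)) = _);
  [by rewrite powR_inv // mulr1|ring].
Qed.

Lemma profile_lipschitz w f K l y i s N : maxwell p w -> data_bound w N K -> 0 <= K ->
  (size l + 4 <= N)%N -> damped p1 p2 p3 w lam f ->
  `|profile (dxs l f) (y + s *: e i) - profile (dxs l f) y| <= C0 * K * `|s|.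
Proof.
move=> W b K0 lN df.
have c1 := @cvg_profile_dxs _ _ _ _ (y + s *: e i) _ W b K0 lN df.
have c2 := @cvg_profile_dxs _ _ _ _ y _ W b K0 lN df.
apply: (cvg_norm_le (cvgB c1 c2)) => t t01.
exact: (scaled_taylor1 _ _ _ (maxwell_dstates l W) (data_bound_dstates b lN) K0
  (component_dstates l (damped_component df)) t01).
Qed.

(** This makes [profile (dxs (i :: l) f)] the derivative of [profile (dxs l f)] without an exchange
    of derivative and limit: the remainder estimate holds for each [t] and passes to the limit. *)
Lemma profile_taylor w f K l y i s N : maxwell p w -> data_bound w N K -> 0 <= K ->
  (size l + 5 <= N)%N -> damped p1 p2 p3 w lam f ->
  `|profile (dxs l f) (y + s *: e i) - profile (dxs l f) y
    - s * profile (dxs (i :: l) f) y| <= C0 * K * s ^+ 2.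
Proof.
move=> W b K0 lN df.
have l4 : (size l + 4 <= N)%N by apply: leq_trans lN; rewrite leq_add2l.
have l4' : (size (i :: l) + 4 <= N)%N by apply: leq_trans lN; rewrite /= addSnnS.
have c1 := @cvg_profile_dxs _ _ _ _ (y + s *: e i) _ W b K0 l4 df.
have c2 := @cvg_profile_dxs _ _ _ _ y _ W b K0 l4 df.
have c3 := @cvg_profile_dxs _ _ _ _ y _ W b K0 l4' df.
apply: (cvg_norm_le (cvgB (cvgB c1 c2) (cvgM (cvg_cst s) c3))) => t t01.
exact: (scaled_taylor2 _ _ _ (maxwell_dstates l W) (data_bound_dstates b lN) K0
  (component_dstates l (damped_component df)) t01).
Qed.

Lemma profileE f y (l : R) : t `^ lam * f (pt t y) @[t --> 0^'+] --> l ->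
  profile f y = l.
Proof. by move=> h; rewrite /profile; exact: (cvg_lim _ h). Qed.

(** A Lipschitz bound uniform in [t] lets the space point move with [t], as it does along a
    geodesic. *)
Lemma cvg_along w f K y (c : R -> 'rV[R]_3) : maxwell p w -> data_bound w 4 K ->
  0 <= K -> damped p1 p2 p3 w lam f -> (forall i, c t 0 i @[t --> 0^'+] --> y 0 i) ->
  t `^ lam * f (pt t (c t)) @[t --> 0^'+] --> profile f y.
Proof.
move=> W b K0 df cy.
have h1 := @cvg_profile _ _ _ y W b K0 df.
pose D t := \sum_i C0 * K * `|c t 0 i - y 0 i|.
have D0 : D t @[t --> 0^'+] --> (0 : R).
  rewrite -[X in _ --> X](_ : \sum_(i < 3) C0 * K * 0 = 0); last first.
    by rewrite big1 // => i _; rewrite mulr0.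
  apply: cvg_sumr => i; apply: cvgM; first exact: cvg_cst.
  have := cvg_norm (cvgB (cy i) (cvg_cst (y 0 i))); rewrite subrr normr0; exact.
have h2 : t `^ lam * f (pt t (c t)) - t `^ lam * f (pt t y) @[t --> 0^'+] --> (0 : R).
  apply/norm_cvg0P; apply: (squeeze_cvgr _ (cvg_cst 0) D0).
  near=> t; rewrite normr_ge0 /=.
  have t01 : 0 < t <= 1.
    by apply/andP; split; near: t; [exact: nbhs_right_gt|exact: nbhs_right_le].
  apply: (@coord_path R (fun u => t `^ lam * f (pt t u))) => u i _ _.
  exact: (scaled_taylor1 _ _ _ W b K0 (damped_component df) t01).
rewrite -[X in _ --> X]add0r.
have -> : (fun t => t `^ lam * f (pt t (c t))) = (fun t =>
    t `^ lam * f (pt t (c t)) - t `^ lam * f (pt t y) + t `^ lam * f (pt t y)).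
  by apply/funext => t; rewrite subrK.
exact: cvgD.
Unshelve. all: by end_near. Qed.

End Profile.

(** * Zeros that are flat to third order *)

Section FlatPoints.
Variable R : realType.
Implicit Types (y z u : 'rV[R]_3) (l : seq 'I_3) (r A : R).
Local Notation e i := (delta_mx 0 i : 'rV[R]_3).
Local Notation L := (2 * pi : R).

Lemma is_derive_quadratic (g : R -> R) (s d M : R) :
  (forall h, `|g (s + h) - g s - h * d| <= M * h ^+ 2) -> is_derive s (1 : R) g d.
Proof.
move=> H.
suff c : h^-1 *: (g (h *: 1 + s) - g s) @[h --> (0 : R)^'] --> d.
  by split; [apply/cvg_ex; exists d|exact: (cvg_lim _ c)].
apply/cvgrPdist_le => /= eps eps0.
have M0 : 0 <= M by have := H 1; rewrite expr1n mulr1; exact: le_trans.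
near=> h.
have h0 : h != 0 by near: h; exact: nbhs_dnbhs_neq.
rewrite [h *: 1]mulr1 [h + s]addrC -[_ *: _]/(_ * _).
have -> : d - h^-1 * (g (s + h) - g s) = - h^-1 * (g (s + h) - g s - h * d).
  by field.
rewrite normrM normrN normfV mulrC ler_pdivrMr ?normr_gt0 //.
apply: le_trans (H h) _.
rewrite -real_normK ?num_real // expr2 mulrA ler_wpM2r //.
have hM : `|h| < eps / (M + 1).
  by near: h; apply: dnbhs0_lt; rewrite divr_gt0 // ltr_wpDl.
have M1 : 0 < M + 1 by rewrite ltr_wpDl.
apply: (@le_trans _ _ ((M + 1) * `|h|)); first by rewrite ler_wpM2r // lerDl.
by rewrite mulrC -ler_pdivlMr // ltW.
Unshelve. all: by end_near. Qed.

(** [F l] stands for the derivative of a profile along the directions in [l]; the hypotheses below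
    are what the limit of the Taylor estimates provides. *)
Variables (F : seq 'I_3 -> 'rV[R]_3 -> R) (M : R).
Hypothesis M0 : 0 <= M.
Hypothesis F_lipschitz : forall l y i s, (size l <= 3)%N ->
  `|F l (y + s *: e i) - F l y| <= M * `|s|.
Hypothesis F_taylor : forall l y i s, (size l <= 2)%N ->
  `|F l (y + s *: e i) - F l y - s * F (i :: l) y| <= M * s ^+ 2.
Hypothesis F_periodic : forall l y i, F l (y + L *: e i) = F l y.

Definition cube r y z := forall k : 'I_3, `|z 0 k - y 0 k| <= r.

Lemma cube_lipschitz l r y z : (size l <= 3)%N -> cube r y z ->
  `|F l z - F l y| <= 3 * M * r.
Proof.
move=> l3 b; have -> : 3 * M * r = \sum_(i < 3) M * r.
  by rewrite !big_ord_recl big_ord0; ring.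
apply: coord_path => u i _ _; apply: le_trans (F_lipschitz _ _ _ l3) _.
by rewrite ler_wpM2l.
Qed.

Lemma F_is_derive l y i s : (size l <= 2)%N ->
  is_derive s (1 : R) (fun s => F l (y + s *: e i)) (F (i :: l) (y + s *: e i)).
Proof.
move=> l2; apply: (@is_derive_quadratic _ _ _ M) => h.
by rewrite scalerDl addrA; exact: F_taylor.
Qed.

Lemma cube_step l A r y z : (size l <= 2)%N -> 0 <= r ->
  (forall i z, cube r y z -> `|F (i :: l) z| <= A) -> cube r y z ->
  `|F l z - F l y| <= 3 * A * r.
Proof.
move=> l2 r0 FA b.
have A0 : 0 <= A.
  by apply: le_trans (FA ord0 y _) => // k; rewrite subrr normr0.
have -> : 3 * A * r = \sum_(i < 3) A * r.
  by rewrite !big_ord_recl big_ord0; ring.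
apply: coord_path => u i uk ui; set d := z 0 i - y 0 i.
apply: (@le_trans _ _ (A * `|d - 0|)); last by rewrite subr0 ler_wpM2l //; exact: b.
rewrite -[X in _ - F l X]addr0 -[X in _ - F l (_ + X)](scale0r (e i)).
apply: (@MVT_le R (fun s => F l (u + s *: e i)) (fun s => F (i :: l) (u + s *: e i)))
  => s sd; first exact: F_is_derive.
apply: FA => k; rewrite row_shiftE; case: eqVneq => [->|_].
  rewrite ui addrAC subrr add0r; apply: le_trans (b i).
  rewrite -/d; move: sd => /andP[]; rewrite ge_min le_max.
  by case: (ger0P d) => hd; case: (ger0P s) => hs s1 s2; lra.
by case: (uk k) => ->; [rewrite subrr normr0|exact: b].
Qed.

(** The empty list is left out, so that adding a constant to the function does not affect
    flatness. *)
Definition flat d y := forall l, (0 < size l <= 3)%N -> `|F l y| <= d.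

(** Each integration over the cube gains a factor [r]: derivatives of order 3, 2, 1 are of size [r],
    [r^2], [r^3]. The constants follow [a -> 1 + 3 a] from [1 + 3 M], where 1 accounts for [d] and 3
    for the coordinates. *)
Lemma flat_oscillation d r y z : 0 <= r <= 1 -> d <= r ^+ 4 -> flat d y ->
  cube r y z -> `|F [::] z - F [::] y| <= 3 * (13 + 27 * M) * r ^+ 4.
Proof.
move=> /andP[r0 r1] dr fl.
have r21 : r ^+ 2 <= r by rewrite expr2 ler_piMr.
have r32 : r ^+ 3 <= r ^+ 2 by rewrite exprS ler_piMl // exprn_ge0.
have r43 : r ^+ 4 <= r ^+ 3 by rewrite exprS ler_piMl // exprn_ge0.
have up l u B : `|F l u - F l y| <= B -> `|F l y| <= d -> `|F l u| <= d + B.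
  move=> h1 h2; have -> : F l u = F l y + (F l u - F l y) by rewrite subrKC.
  by apply: le_trans (ler_normD _ _) _; apply: lerD.
have A3 l u : size l = 3%N -> cube r y u -> `|F l u| <= (1 + 3 * M) * r.
  move=> l3 b; have := up l u _ (cube_lipschitz _ b) (fl l _); rewrite l3 => /(_ isT isT).
  move=> h; apply: le_trans h _.
  have -> : (1 + 3 * M) * r = r + 3 * M * r by ring.
  by rewrite lerD2r; lra.
have A2 l u : size l = 2%N -> cube r y u -> `|F l u| <= (4 + 9 * M) * r ^+ 2.
  move=> l2 b.
  have S : `|F l u - F l y| <= 3 * ((1 + 3 * M) * r) * r.
    apply: cube_step => //; first by rewrite l2.
    by move=> i v; apply: A3; rewrite /= l2.
  have := up l u _ S (fl l _); rewrite l2 => /(_ isT) h.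
  apply: le_trans h _.
  have -> : (4 + 9 * M) * r ^+ 2 = r ^+ 2 + 3 * ((1 + 3 * M) * r) * r by ring.
  by rewrite lerD2r; lra.
have A1 l u : size l = 1%N -> cube r y u -> `|F l u| <= (13 + 27 * M) * r ^+ 3.
  move=> l1 b.
  have S : `|F l u - F l y| <= 3 * ((4 + 9 * M) * r ^+ 2) * r.
    apply: cube_step => //; first by rewrite l1.
    by move=> i v; apply: A2; rewrite /= l1.
  have := up l u _ S (fl l _); rewrite l1 => /(_ isT) h.
  apply: le_trans h _.
  have -> : (13 + 27 * M) * r ^+ 3 = r ^+ 3 + 3 * ((4 + 9 * M) * r ^+ 2) * r by ring.
  by rewrite lerD2r; lra.
move=> b; have -> : 3 * (13 + 27 * M) * r ^+ 4 = 3 * ((13 + 27 * M) * r ^+ 3) * r by ring.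
by apply: cube_step => // i v; exact: A1.
Qed.

Lemma F_period l y i (n : nat) : F l (y + (n%:R * L) *: e i) = F l y.
Proof.
elim: n => [|n IH]; first by rewrite mul0r scale0r addr0.
by rewrite -natr1 mulrDl mul1r scalerDl addrA F_periodic.
Qed.

Lemma F_int_period l y i (n : int) : F l (y + (n%:~R * L) *: e i) = F l y.
Proof.
case: n => n; first exact: F_period.
rewrite -(F_period l _ i n.+1) -addrA -scalerDl -mulrDl NegzE mulrNz.
by rewrite addNr mul0r scale0r addr0.
Qed.

Definition reduce y : 'rV[R]_3 :=
  \row_i (y 0 i - (Num.floor (y 0 i / L))%:~R * L).

Lemma L_gt0 : 0 < L.
Proof. by rewrite mulr_gt0 // pi_gt0. Qed.

Lemma reduceP y i : 0 <= reduce y 0 i < L.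
Proof.
rewrite mxE; have /andP[h1 h2] := floor_itv (y 0 i / L).
move: h1 h2; rewrite ler_pdivlMr ?L_gt0 // ltr_pdivrMr ?L_gt0 // intrD mulrDl mul1r => h1 h2.
by apply/andP; split; lra.
Qed.

Lemma F_reduce l y : F l (reduce y) = F l y.
Proof.
apply/eqP; rewrite -subr_eq0 -normr_le0.
have -> : 0 = \sum_(i < 3) 0 :> R by rewrite big1.
apply: coord_path => u i _ _; rewrite mxE addrAC subrr add0r -mulNr -mulrNz.
by rewrite F_int_period subrr normr0.
Qed.

(* Two values of [- F [::]] at nearly flat points of the same small cube are at
   distance O(r^4), whereas there are only O(r^-3) cubes. *)
Lemma exists_nonflat_shift (eps : R) : 0 < eps -> exists c d : R,
  [/\ 0 < c < eps, 0 < d & forall y, `|F [::] y + c| <= d -> ~ flat d y].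
Proof.
move=> eps0.
pose C := 3 * (13 + 27 * M).
have C0 : 0 <= C by rewrite /C; move: M0; lra.
(* The first summand makes [N^3 + 1] shifts of step [eta] fit below [eps / 2], the second makes
   [r <= 1]. *)
pose N := ((Num.truncn (4 * (C + 3) * L ^+ 4 / eps)).+1 + (Num.truncn L).+1)%N.
have N0 : (0 < N)%N by [].
have Npos : 0 < N%:R :> R by rewrite ltr0n.
have NB : 4 * (C + 3) * L ^+ 4 / eps <= N%:R.
  have e0 : 0 <= 4 * (C + 3) * L ^+ 4 / eps.
    apply: divr_ge0; last exact: ltW.
    apply: mulr_ge0; last exact/exprn_ge0/ltW/L_gt0.
    by rewrite mulr_ge0 // addr_ge0.
  have /andP[_ /ltW h] := truncn_itv e0.
  by apply: le_trans h _; rewrite ler_nat leq_addr.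
pose r := L / N%:R.
have r0 : 0 < r by rewrite divr_gt0 // L_gt0.
have r1 : r <= 1.
  rewrite ler_pdivrMr // mul1r; have /andP[_ /ltW h] := truncn_itv (ltW L_gt0).
  by apply: le_trans h _; rewrite ler_nat leq_addl.
pose d := r ^+ 4.
have d0 : 0 < d by exact: exprn_gt0.
(* Two errors of size [d] and an oscillation [C * d] add up to less than [eta], so shifts whose bad
   points share a cube coincide. *)
pose eta := (C + 3) * d.
have eta0 : 0 < eta by rewrite mulr_gt0 //; lra.
have small : (N ^ 3).+1%:R * eta <= eps / 2.
  apply: (@le_trans _ _ (2 * N%:R ^+ 3 * eta)).
    rewrite ler_pM2r // -natrX -natrM ler_nat mul2n -addnn -addn1 leq_add2l.
    by rewrite expn_gt0 N0.
  have -> : 2 * N%:R ^+ 3 * eta = 2 * (C + 3) * L ^+ 4 / N%:R.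
    by rewrite /eta /d /r; field; rewrite gt_eqF.
  rewrite ler_pdivrMr //; move: NB; rewrite ler_pdivrMr //; lra.
pose c (j : 'I_(N ^ 3).+1) := j.+1%:R * eta.
apply: contrapT => H.
have B j : exists y, `|F [::] y + c j| <= d /\ flat d y.
  apply: contrapT => H'; apply: H; exists (c j), d; split=> //.
    rewrite mulr_gt0 //=; apply: (@le_lt_trans _ _ (eps / 2)); last by lra.
    apply: le_trans small; rewrite ler_pM2r // ler_nat; exact: ltn_ord.
  by move=> y y1 y2; apply: H'; exists y.
have [Y YP] := choice B.
(* The index of the cube of the fundamental domain that contains [y]: [N^3] cubes against [N^3 + 1]
   shifts. The shape [N.-1.+1] is what [inord] requires. *)
pose k (y : 'rV[R]_3) : {ffun 'I_3 -> 'I_N.-1.+1} :=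
  [ffun i => inord (Num.truncn (reduce y 0 i / r))].
have kP y i : (k y i : nat)%:R * r <= reduce y 0 i <= (k y i).+1%:R * r.
  have /andP[h1 h2] := reduceP y i.
  have q0 : 0 <= reduce y 0 i / r by rewrite divr_ge0 // ltW.
  have /andP[t1 t2] := truncn_itv q0.
  rewrite ffunE inordK; last first.
    rewrite prednK // -(ltr_nat R); apply: le_lt_trans t1 _.
    by rewrite ltr_pdivrMr // /r mulrCA divff ?mulr1 // gt_eqF.
  by rewrite -ler_pdivlMr // t1 /= -ler_pdivrMr // ltW.
have kcube y z : k y = k z -> cube r (reduce y) (reduce z).
  move=> kyz i; have := kP y i; have := kP z i; rewrite -kyz -natr1 mulrDl mul1r.
  by move=> /andP[h1 h2] /andP[h3 h4]; rewrite ler_norml; apply/andP; split; lra.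
have inj : injective (fun j => k (Y j)).
  move=> j j' /kcube b; have [a1 f1] := YP j; have [a2 f2] := YP j'.
  have fr : flat d (reduce (Y j)) by move=> l l3; rewrite F_reduce; exact: f1.
  have r01 : 0 <= r <= 1 by rewrite (ltW r0).
  have := flat_oscillation r01 (lexx _) fr b; rewrite !F_reduce -/C => o.
  have cc : `|c j - c j'| < eta.
    have -> : c j - c j' = (F [::] (Y j) + c j) - (F [::] (Y j') + c j')
       + (F [::] (Y j') - F [::] (Y j)) by ring.
    apply: le_lt_trans (ler_normD _ _) _; apply: (@le_lt_trans _ _ (d + d + C * d)).
      by apply: lerD => //; apply: le_trans (ler_normB _ _) _; exact: lerD.
    by rewrite /eta; lra.
  have far (i i' : nat) : (i < i')%N -> eta <= i'.+1%:R * eta - i.+1%:R * eta.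
    by move=> ii'; rewrite -mulrBl ler_peMl ?(ltW eta0) // lerBrDr nat1r ler_nat.
  apply/val_inj; move: cc; rewrite ltr_norml /c => /andP[h1 h2].
  by case: (ltngtP j j') => [/far h|/far h|//]; exfalso; lra.
have := leq_card _ inj; rewrite card_ffun !card_ord prednK //.
by rewrite ltnn.
Qed.

End FlatPoints.

(** * Null sets of geodesics *)

Section Measurability.
Variable R : realType.

Lemma measurable_factor d (T : measurableType d) (I : countType) (phi : T -> I) (g : I -> R) :
  (forall a, measurable [set x | phi x = a]) -> measurable_fun setT (g \o phi).
Proof.
move=> mphi _ B mB; rewrite setTI.
have -> : (g \o phi) @^-1` B = \bigcup_(a in [set a | B (g a)]) [set x | phi x = a].
  apply/seteqP; split=> x /=; first by exists (phi x).
  by move=> [a /= Ba ->].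
rewrite bigcup_mkcond; apply: countable_bigcupT_measurable => [|a].
  exact: countableP.
by case: ifP.
Qed.

(** Rounding the coordinates down to multiples of [1 / (n + 1)] gives functions with countably many
    values, which converge pointwise by the Lipschitz bound. *)
Lemma measurable_lipschitz d (T : measurableType d) (psi : 'I_3 -> T -> R)
    (G : 'rV[R]_3 -> R) (M : R) : 0 <= M ->
  (forall y i s, `|G (y + s *: delta_mx 0 i) - G y| <= M * `|s|) ->
  (forall k, measurable_fun setT (psi k)) ->
  measurable_fun setT (fun x => G (\row_k psi k x)).
Proof.
move=> M0 GM mpsi.
pose phi n x : {ffun 'I_3 -> int} := [ffun k => Num.floor (psi k x * n.+1%:R)].
pose g n (a : {ffun 'I_3 -> int}) := G (\row_k ((a k)%:~R / n.+1%:R)).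
apply: (measurable_fun_cvg (h := fun n => g n \o phi n)) => [n|x _].
  apply: measurable_factor => a.
  have -> : [set x | phi n x = a] = \bigcap_(k : 'I_3) (psi k) @^-1`
      `[(a k)%:~R / n.+1%:R, (a k + 1)%:~R / n.+1%:R[%classic.
    apply/seteqP; split=> x /=.
      move=> <- k _ /=; rewrite in_itv /= ffunE.
      by rewrite ler_pdivrMr // ltr_pdivlMr //; exact: floor_itv.
    move=> h; apply/ffunP => k; rewrite ffunE; apply: floor_def.
    have := h k I; rewrite /= in_itv /=.
    by rewrite ler_pdivrMr // ltr_pdivlMr.
  apply: fin_bigcap_measurable => // k _; rewrite -[X in measurable X]setTI.
  by apply: mpsi.
apply/cvgrPdist_le => e e0; near=> n.
have n0 : 0 < n.+1%:R :> R by [].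
apply: (@le_trans _ _ (\sum_(k < 3) M * n.+1%:R^-1)).
  apply: (@coord_path R G) => u i _ _; apply: le_trans (GM _ _ _) _.
  rewrite ler_wpM2l // !mxE ffunE.
  have /andP[h1 h2] := floor_itv (psi i x * n.+1%:R).
  rewrite -(ler_pM2r n0) mulVf ?gt_eqF // -[X in _ * X](gtr0_norm n0) -normrM mulrBl.
  rewrite divfK ?gt_eqF //; move: h2; rewrite intrD => h2.
  by rewrite ler_norml; apply/andP; split; lra.
have -> : \sum_(k < 3) M * n.+1%:R^-1 = 3 * M / n.+1%:R.
  by rewrite !big_ord_recl big_ord0; field.
rewrite ler_pdivrMr // [e * _]mulrC -ler_pdivrMr //.
apply: (@le_trans _ _ n%:R); last by rewrite ler_nat.
by near: n; exact: nbhs_infty_ger.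
Unshelve. all: by end_near. Qed.

End Measurability.

(** * Null sets of the six-dimensional Lebesgue measure by slicing *)

Section NullSets.
Variable R : realType.
Local Notation lambda := (@lebesgue_measure R).
Local Open Scope ereal_scope.

Section SigmaFiniteProduct.
Context d1 d2 (T1 : measurableType d1) (T2 : measurableType d2).
Variables (m1 : {sigma_finite_measure set T1 -> \bar R})
  (m2 : {sigma_finite_measure set T2 -> \bar R}).

(* The library declares no sigma-finite structure on a product of two
   sigma-finite measures that type inference can find. *)
Definition sfprod : set (T1 * T2)%type -> \bar R := m1 \x m2.

HB.instance Definition _ := Measure.copy sfprod (m1 \x m2).

Let sfprod_sigma_finite : sigma_finite setT sfprod.
Proof.
have /sigma_finiteP[F [TF ndF Foo]] := sigma_finiteT m1.
have /sigma_finiteP[G [TG ndG Goo]] := sigma_finiteT m2.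
exists (fun n => F n `*` G n).
  rewrite -setXTT TF TG; apply/seteqP; split=> -[x y] /=.
    move=> [[n _ Fnx] [k _ Gky]]; exists (maxn n k) => //; split.
    - by move: x Fnx; exact/subsetPset/ndF/leq_maxl.
    - by move: y Gky; exact/subsetPset/ndG/leq_maxr.
  by move=> [n _ []/= ? ?]; split; exists n.
move=> k; have [mF Fk] := Foo k; have [mG Gk] := Goo k.
split; first exact: measurableX.
by rewrite [sfprod _]product_measure1E // lte_mul_pinfty // ge0_fin_numE.
Qed.

HB.instance Definition _ := Measure_isSigmaFinite.Build _ _ _ sfprod
  sfprod_sigma_finite.

End SigmaFiniteProduct.

Lemma null_xsection d1 d2 (T1 : measurableType d1) (T2 : measurableType d2)
    (m1 : {measure set T1 -> \bar R}) (m2 : {sigma_finite_measure set T2 -> \bar R})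
    (A : set (T1 * T2)) :
  (forall x, m2 (xsection A x) = 0) -> (m1 \x m2) A = 0.
Proof.
move=> h; rewrite /product_measure1.
by rewrite [LHS](eq_integral (fun=> 0)) ?integral0 // => x _; exact: h.
Qed.

(** The product measure integrates sections over the first factor; uniqueness of the product measure
    gives the other order. *)
Lemma null_ysection d1 d2 (T1 : measurableType d1) (T2 : measurableType d2)
    (m1 : {sigma_finite_measure set T1 -> \bar R})
    (m2 : {sigma_finite_measure set T2 -> \bar R}) (A : set (T1 * T2)) :
  measurable A -> (forall y, m1 (ysection A y) = 0) -> (m1 \x m2) A = 0.
Proof.
move=> mA h.
rewrite (@product_measure_unique _ _ _ _ _ m1 m2 (m1 \x^ m2)) //; last first.
  by move=> X Y mX mY; rewrite [LHS]product_measure2E.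
rewrite /product_measure2 [LHS](eq_integral (fun=> 0)) ?integral0 // => y _.
exact: h.
Qed.

Local Notation l2 := (sfprod lambda lambda).
Local Notation l3 := (sfprod l2 lambda).
Local Notation l4 := (sfprod l3 lambda).
Local Notation l5 := (sfprod l4 lambda).
Local Notation mR := (measurableTypeR R).

Lemma lebesgue6U (A B : set (mR * mR * mR * mR * mR * mR)%type) :
  (@lebesgue6 R).-negligible A -> (@lebesgue6 R).-negligible B ->
  (@lebesgue6 R).-negligible (A `|` B).
Proof. exact: (@negligibleU _ _ _ (sfprod l5 lambda)). Qed.

(** Takes care of the geodesics with vanishing third momentum. *)
Lemma null_last_zero : (@lebesgue6 R).-negligible
  [set q : (mR * mR * mR * mR * mR * mR)%type | q.2 = 0%R :> R].
Proof.
apply/(@negligibleP _ _ _ (sfprod l5 lambda)).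
  rewrite -[X in measurable X]setTI.
  have m := @measurable_snd _ _ (mR * mR * mR * mR * mR)%type mR.
  exact: (m measurableT [set 0%R : mR] (measurable_set1 (0%R : R))).
apply: (@null_xsection _ _ _ _ l5 lambda) => x.
rewrite (_ : xsection _ _ = [set 0%R : R]); first exact: lebesgue_measure_set1.
by apply/seteqP; split=> y; rewrite /xsection /= ?inE.
Qed.

(** Fixing the velocity and then the other two base coordinates leaves a line in direction [i], on
    which a countable set is null. *)
Lemma lebesgue6_null (A : set (mR * mR * mR * mR * mR * mR)%type) (i : 'I_3) :
  measurable A ->
  (forall x1 x2 x3 v1 v2 v3 : R,
    countable [set s : R | A (x1 + (i == 0 :> nat)%:R * s, x2 + (i == 1 :> nat)%:R * s,
      x3 + (i == 2 :> nat)%:R * s, v1, v2, v3)%R]) ->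
  lebesgue6 A = 0.
Proof.
move=> mA cA; rewrite -[@lebesgue6 R]/(sfprod l5 lambda).
apply: (@null_ysection _ _ _ _ l5 lambda _ mA) => v3; set A5 := ysection A v3.
have m5 : measurable A5 by exact: measurable_ysection.
apply: (@null_ysection _ _ _ _ l4 lambda _ m5) => v2; set A4 := ysection A5 v2.
have m4 : measurable A4 by exact: measurable_ysection.
apply: (@null_ysection _ _ _ _ l3 lambda _ m4) => v1; set A3 := ysection A4 v1.
have m3 : measurable A3 by exact: measurable_ysection.
have A3E x1 x2 x3 : A3 (x1, x2, x3) -> A (x1, x2, x3, v1, v2, v3).
  by move=> /ysectionP /ysectionP /ysectionP.
case: (I3P i) => ei.
- apply: (@null_ysection _ _ _ _ l2 lambda _ m3) => x3.
  apply: (@null_ysection _ _ _ _ lambda lambda _ (measurable_ysection x3 m3)) => x2.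
  apply: countable_lebesgue_measure0; apply: sub_countable (cA 0%R x2 x3 v1 v2 v3).
  (* With the base coordinate in direction [i] set to 0, the parameter [s] is that coordinate. *)
  apply: subset_card_le => s /ysectionP /ysectionP /A3E.
  by rewrite ei /= !mul0r mul1r !addr0 add0r.
- apply: (@null_ysection _ _ _ _ l2 lambda _ m3) => x3.
  apply: (@null_xsection _ _ _ _ lambda lambda) => x1.
  apply: countable_lebesgue_measure0; apply: sub_countable (cA x1 0%R x3 v1 v2 v3).
  apply: subset_card_le => s /xsectionP /ysectionP /A3E.
  by rewrite ei /= !mul0r mul1r !addr0 add0r.
- apply: (@null_xsection _ _ _ _ l2 lambda) => -[x1 x2].
  apply: countable_lebesgue_measure0; apply: sub_countable (cA x1 x2 0%R v1 v2 v3).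
  apply: subset_card_le => s /xsectionP /A3E.
  by rewrite ei /= !mul0r mul1r !addr0 add0r.
Qed.

End NullSets.

Section ZeroSets.
Variable R : realType.
Local Notation e i := (delta_mx 0 i : 'rV[R]_3).
Local Notation mR := (measurableTypeR R).

Lemma mfst d d1 d2 (T : measurableType d) (T1 : measurableType d1)
    (T2 : measurableType d2) (f : T -> T1 * T2) :
  measurable_fun setT f -> measurable_fun setT (fun x => (f x).1).
Proof. exact: measurableT_comp measurable_fst. Qed.

Lemma msnd d d1 d2 (T : measurableType d) (T1 : measurableType d1)
    (T2 : measurableType d2) (f : T -> T1 * T2) :
  measurable_fun setT f -> measurable_fun setT (fun x => (f x).2).
Proof. exact: measurableT_comp measurable_snd. Qed.

(** Zeros with a slope of at least [1 / (n + 1)] are at least [eta] apart, by the quadratic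
    remainder, so that [floor (s / eta)] separates them. *)
Lemma countable_simple_zeros (g g' : R -> R) (M : R) : 0 <= M ->
  (forall s h, `|g (s + h) - g s - h * g' s| <= M * h ^+ 2) ->
  countable [set s | g s = 0 /\ g' s != 0].
Proof.
move=> M0 gM.
pose A n := [set s | g s = 0 /\ n.+1%:R^-1 <= `|g' s|].
apply: (@sub_countable _ _ _ (\bigcup_n A n)).
  apply: subset_card_le => s /= [gs g's]; exists (Num.truncn (`|g' s|^-1)) => //; split=> //.
  have g0 : 0 < `|g' s| by rewrite normr_gt0.
  rewrite -[leRHS]invrK lef_pV2 ?posrE ?invr_gt0 //.
  by have /andP[_ /ltW] := truncn_itv (ltW (etrans (invr_gt0 _) g0)).
apply: bigcup_countable => // n _.
pose eta : R := (n.+1%:R * (M + 1))^-1.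
have n0 : 0 < n.+1%:R :> R by [].
have M1 : 0 < M + 1 by lra.
have eta0 : 0 < eta by rewrite invr_gt0 mulr_gt0.
apply/countable_injP; exists (fun s => choice.pickle (Num.floor (s / eta))).
move=> s s' /set_mem [gs g's] /set_mem [gs' _] /(pcan_inj choice.pickleK) fE.
have d : `|s' - s| < eta.
  have /andP[h1 h2] := floor_itv (s / eta); have /andP[h3 h4] := floor_itv (s' / eta).
  move: h1 h2 h3 h4; rewrite -fE !intrD; set k := (Num.floor _)%:~R.
  rewrite !ler_pdivlMr // !ltr_pdivrMr // mulrDl mul1r => h1 h2 h3 h4.
  by rewrite ltr_norml; apply/andP; split; lra.
apply: contrapT => /eqP; rewrite eq_sym -subr_eq0 -normr_gt0 => h0.
have := gM s (s' - s); rewrite [s + _]addrC subrK gs gs' subrr sub0r normrN normrM.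
rewrite -real_normK ?num_real // expr2 [M * _]mulrCA ler_pM2l // leNgt => /negP; apply.
apply: lt_le_trans g's; apply: (@le_lt_trans _ _ (M * eta)); first by rewrite ler_wpM2l // ltW.
rewrite /eta invfM mulrCA gtr_pMr ?invr_gt0 // ltr_pdivrMr //; lra.
Qed.

Variables (F : seq 'I_3 -> 'rV[R]_3 -> R) (M : R).
Hypothesis M0 : 0 <= M.
Hypothesis F_lipschitz : forall l y i s, (size l <= 3)%N ->
  `|F l (y + s *: e i) - F l y| <= M * `|s|.
Hypothesis F_taylor : forall l y i s, (size l <= 2)%N ->
  `|F l (y + s *: e i) - F l y - s * F (i :: l) y| <= M * s ^+ 2.

(** Otherwise the value 0 propagates from [F [::]] to every derivative of order at most 3, and [y]
    is flat. *)
Lemma nonflat_zero (d : R) y : 0 <= d -> F [::] y = 0 -> ~ flat F d y ->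
  exists l i, [/\ (size l <= 2)%N, F l y = 0 & F (i :: l) y != 0].
Proof.
move=> d0 F0 nf; apply: contrapT => H; apply: nf => l /andP[_ l3].
suff -> : F l y = 0 by rewrite normr0.
elim: l l3 => //= i l IH l3; apply/eqP; apply: contrapT => /negP h.
by apply: H; exists l, i; split=> //; apply: IH; exact: ltnW.
Qed.

Variable Y : 'I_3 -> mR * mR * mR -> mR.
Hypothesis mY : forall k, measurable_fun setT (Y k).

Definition shifted_base (q : mR * mR * mR * mR * mR * mR) : 'rV[R]_3 :=
  let: (x1, x2, x3, v1, v2, v3) := q in
  \row_k ([:: x1; x2; x3]`_k + Y k (v1, v2, v3)).

Lemma measurable_shifted_base (G : 'rV[R]_3 -> R) :
  (forall y i s, `|G (y + s *: e i) - G y| <= M * `|s|) ->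
  measurable_fun setT (G \o shifted_base).
Proof.
move=> GM.
have -> : G \o shifted_base = fun q => G (\row_k
    ([:: q.1.1.1.1.1; q.1.1.1.1.2; q.1.1.1.2]`_k + Y k (q.1.1.2, q.1.2, q.2))).
  by apply/funext => -[[[[[x1 x2] x3] v1] v2] v3].
have m0 : measurable_fun [set: mR * mR * mR * mR * mR * mR] id by exact: measurable_id.
have m1 := mfst m0; have m2 := mfst m1; have m3 := mfst m2; have m4 := mfst m3.
apply: (measurable_lipschitz M0 GM) => k; apply: measurable_funD.
  by case: (I3P k) => ->; [exact: (mfst m4)|exact: (msnd m4)|exact: (msnd m3)].
apply: (measurableT_comp (mY k)); apply: (measurable_fun_pair _ (msnd m0)).
exact: measurable_fun_pair (msnd m2) (msnd m1).
Qed.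

Lemma null_nonflat_zeros (d : R) : 0 <= d ->
  (@lebesgue6 R).-negligible
    [set q | F [::] (shifted_base q) = 0 /\ ~ flat F d (shifted_base q)].
Proof.
move=> d0.
pose N (a : seq 'I_3 * 'I_3) := [set q | [/\ (size a.1 <= 2)%N,
  F a.1 (shifted_base q) = 0 & F (a.2 :: a.1) (shifted_base q) != 0]].
pose N' n := if choice.unpickle n is Some a then N a else set0.
pose mu := sfprod (sfprod (sfprod (sfprod (sfprod (@lebesgue_measure R)
  (@lebesgue_measure R)) (@lebesgue_measure R)) (@lebesgue_measure R))
  (@lebesgue_measure R)) (@lebesgue_measure R).
apply: (@negligibleS _ _ _ mu (\bigcup_n N' n)).
  move=> q [q0 /(nonflat_zero d0 q0)[l [i H]]].
  by exists (choice.pickle (l, i)) => //; rewrite /N' choice.pickleK.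
apply: negligible_bigcup => n; rewrite /N'.
case: (choice.unpickle n) => [[l i]|]; last exact: negligible_set0.
have [l2|l2] := boolP (size l <= 2)%N; last first.
  have -> : N (l, i) = set0; last exact: negligible_set0.
  by apply/seteqP; split=> q // -[]; rewrite (negbTE l2).
have mF l' : (size l' <= 3)%N -> measurable_fun setT (F l' \o shifted_base).
  by move=> l3; apply: measurable_shifted_base => y j s; exact: F_lipschitz.
have mN : measurable (N (l, i)).
  have -> : N (l, i) = ((F l \o shifted_base) @^-1` [set 0 : mR]) `&`
     ((F (i :: l) \o shifted_base) @^-1` [set~ (0 : mR)]).
    by apply/seteqP; split=> q /=; [case=> _ h /eqP|case=> h /eqP].
  apply: measurableI; rewrite -[X in measurable X]setTI.
    by apply: mF => //; exact: leqW.
  by apply: mF => //; exact: measurableC.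
apply/negligibleP => //; apply: (lebesgue6_null (i := i)) => // x1 x2 x3 v1 v2 v3.
pose y := shifted_base (x1, x2, x3, v1, v2, v3).
apply: (@sub_countable _ _ _ [set s | F l (y + s *: e i) = 0 /\ F (i :: l) (y + s *: e i) != 0]).
  apply: subset_card_le => s /= [_].
  suff -> : shifted_base (x1 + (i == 0 :> nat)%:R * s, x2 + (i == 1 :> nat)%:R * s,
      x3 + (i == 2 :> nat)%:R * s, v1, v2, v3) = y + s *: e i by [].
  apply/rowP => k; rewrite row_shiftE !mxE.
  by case: (I3P k) => ->; case: (I3P i) => ->; rewrite /= ?mul0r ?mul1r ?addr0 // addrAC.
apply: (countable_simple_zeros M0) => s h.
by rewrite scalerDl addrA; exact: F_taylor.
Qed.

End ZeroSets.

(** * Timelike geodesics *)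

Section Primitive.
Variable R : realType.
Implicit Types (a u : R) (f : R -> R).

(** At most one of the two integrals is nonzero: this is the integral from [a] to [u] with its
    sign. *)
Definition prim a f u : R := rint a u f - rint u a f.

Lemma prim_id a f : prim a f a = 0.
Proof. exact: subrr. Qed.

Lemma rint_gt a b f : b < a -> rint a b f = 0.
Proof.
by move=> ba; rewrite /rint set_itv_ge ?Rintegral_set0 // bnd_simp -ltNge.
Qed.

Lemma rint_split a b c f : a <= b -> b <= c -> continuous f ->
  rint a c f = rint a b f + rint b c f.
Proof.
move=> ab bc cf; have ifc := continuous_segment_integrable a c cf.
have := @Rintegral_itvB R f (BLeft a) (BRight c) b ifc; rewrite !bnd_simp => /(_ ab bc).
rewrite Rintegral_itv_obnd_cbnd; last first.
  apply: integrableS (continuous_segment_integrable b c cf) => //.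
  by move=> x /=; rewrite !in_itv /= => /andP[/ltW -> ->].
by rewrite /rint => <-; rewrite addrC subrK.
Qed.

(** Near [u] the signed integral differs by a constant from an integral whose lower limit [b] lies
    below both [a] and [u]. *)
Lemma is_derive_prim a f u : continuous f -> is_derive u (1 : R) (prim a f) (f u).
Proof.
move=> cf; pose b := Num.min a u - 1.
have ba : b < a by rewrite /b; case: (ltP a u) => ?; lra.
have bu : b < u by rewrite /b; case: (ltP a u) => ?; lra.
have bE x : b < x -> rint b x f - rint b a f = prim a f x.
  move=> bx; rewrite /prim; case: (ltgtP a x) => [ax|xa|<-].
  - by rewrite (rint_gt _ ax) (@rint_split b a x) ?ltW //; ring.
  - by rewrite (rint_gt _ xa) (@rint_split b x a) ?ltW //; ring.
  - by rewrite !subrr.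
apply: (@near_eq_is_derive _ _ _ (fun x => rint b x f - rint b a f)).
  by near=> x; apply: bE; near: x; exact: lt_nbhsr.
have D := FTC1_rint bu cf.
by apply: is_derive_eq; rewrite subr0.
Unshelve. all: by end_near. Qed.

End Primitive.

(** * Geodesics parametrized by the logarithm of time *)

Section GeodesicFlow.
Variables (R : realType) (p1 p2 p3 : R).
Local Notation p := (kexp p1 p2 p3).
Local Notation U := (@spacetime R).
Local Notation pt := (@spacetime_point R).
Implicit Types (c : 'I_3 -> R) (u s : R).

(* Along a geodesic with conserved momenta c_k = t^(2 p_k) x_k', the functions of
   u = ln t are (t')^2, the slope of -s, and the slope of -x_k / c_k. *)
Definition speed2 c u : R := 1 + \sum_k c k ^+ 2 * expR (- 2 * p k * u).
Definition speed c u : R := Num.sqrt (speed2 c u).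
Definition time_slope c u : R := expR u / speed c u.
Definition space_slope c (k : 'I_3) u : R := expR ((1 - 2 * p k) * u) / speed c u.

Lemma speed2_ge1 c u : 1 <= speed2 c u.
Proof.
by rewrite lerDl sumr_ge0 // => k _; rewrite mulr_ge0 ?sqr_ge0 ?expR_ge0.
Qed.

Lemma speed_ge1 c u : 1 <= speed c u.
Proof.
rewrite -sqrtr1 ler_sqrt ?speed2_ge1 //; exact: le_trans (speed2_ge1 c u).
Qed.

Lemma speed_gt0 c u : 0 < speed c u.
Proof. exact: lt_le_trans (speed_ge1 c u). Qed.

Lemma speed_sqr c u : speed c u ^+ 2 = speed2 c u.
Proof. by rewrite sqr_sqrtr //; exact: le_trans (speed2_ge1 c u). Qed.

Definition dspeed2 c u : R := \sum_k c k ^+ 2 * (- 2 * p k * expR (- 2 * p k * u)).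

Lemma is_derive_expRM (a u : R) : is_derive u (1 : R) (fun u => expR (a * u)) (a * expR (a * u)).
Proof.
have D1 : is_derive u (1 : R) (fun u => a * u) a.
  have := is_deriveZ a (is_derive_id u (1 : R)).
  by rewrite [a *: 1]mulr1.
have D2 := is_derive_expR (a * u).
have := @is_derive1_comp _ expR (fun u => a * u) u _ _ D2 D1.
by rewrite mulrC.
Qed.

Lemma is_derive_speed2 c u : is_derive u (1 : R) (speed2 c) (dspeed2 c u).
Proof.
rewrite /speed2 /dspeed2 !big_ord_recl big_ord0.
have -> : (fun u => 1 + \sum_k c k ^+ 2 * expR (- 2 * p k * u)) =
  (fun u => 1 + (c ord0 ^+ 2 * expR (- 2 * p ord0 * u) +
   (c (lift ord0 ord0) ^+ 2 * expR (- 2 * p (lift ord0 ord0) * u) +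
   (c (lift ord0 (lift ord0 ord0)) ^+ 2 * expR (- 2 * p (lift ord0 (lift ord0 ord0)) * u) + 0)))).
  by apply/funext => v; rewrite !big_ord_recl big_ord0.
have D k := is_derive_expRM (- 2 * p k) u.
have D0 := D ord0; have D1 := D (lift ord0 ord0); have D2 := D (lift ord0 (lift ord0 ord0)).
apply: is_derive_eq; rewrite /GRing.scale /=; ring.
Qed.

Lemma is_derive_speed c u :
  is_derive u (1 : R) (speed c) (dspeed2 c u / (2 * speed c u)).
Proof.
have D1 := is_derive_speed2 c u.
have D2 : is_derive (speed2 c u) (1 : R) Num.sqrt (2 * speed c u)^-1.
  by apply: is_derive1_sqrt; exact: lt_le_trans (speed2_ge1 c u).
by rewrite mulrC; exact: is_derive1_comp D2 D1.
Qed.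

Lemma speed_continuous c : continuous (speed c).
Proof. by apply: is_derive_continuous => u; exact: is_derive_speed. Qed.

Lemma time_slope_continuous c : continuous (time_slope c).
Proof.
move=> u; apply: cvgM; first exact: continuous_expR.
by apply: cvgV; [exact: lt0r_neq0 (speed_gt0 c u)|exact: speed_continuous].
Qed.

Lemma space_slope_continuous c k : continuous (space_slope c k).
Proof.
move=> u; apply: cvgM; last first.
  by apply: cvgV; [exact: lt0r_neq0 (speed_gt0 c u)|exact: speed_continuous].
exact: (is_derive_continuous (is_derive_expRM (1 - 2 * p k))).
Qed.

Lemma time_slope_gt0 c u : 0 < time_slope c u.
Proof. by rewrite divr_gt0 ?expR_gt0 ?speed_gt0. Qed.

(** The speed dominates its single term [|c_k| * expR (- p_k u)]. This raises the exponent from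
    [1 - 2 p_k], which can be negative, to [1 - p_k], so that geodesics have an endpoint. *)
Lemma space_slope_le c k u : `|c k * space_slope c k u| <= expR ((1 - p k) * u).
Proof.
rewrite /space_slope mulrA normrM normfV (gtr0_norm (speed_gt0 c u)).
rewrite ler_pdivrMr ?speed_gt0 // normrM (ger0_norm (expR_ge0 _)).
have -> : (1 - 2 * p k) * u = (1 - p k) * u + (- p k * u) by ring.
rewrite expRD mulrCA ler_pM2l ?expR_gt0 //.
have s0 := ltW (speed_gt0 c u).
rewrite -(ler_pXn2r (n := 2)) ?nnegrE ?(mulr_ge0 _ (expR_ge0 _)) //.
rewrite speed_sqr exprMn real_normK ?num_real // -expRM_natl.
have -> : 2%:R * (- p k * u) = - 2 * p k * u by ring.
rewrite /speed2 (bigD1 k) //= addrCA lerDl addr_ge0 // sumr_ge0 // => j _.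
by rewrite mulr_ge0 ?sqr_ge0 ?expR_ge0.
Qed.

End GeodesicFlow.

Section Geodesics.
Variables (R : realType) (p1 p2 p3 : R).
Local Notation p := (kexp p1 p2 p3).
Local Notation g := (kasner_metric p1 p2 p3).
Local Notation U := (@spacetime R).
Local Notation pt := (@spacetime_point R).
Local Notation speed := (speed p1 p2 p3).
Local Notation speed2 := (speed2 p1 p2 p3).
Local Notation dspeed2 := (dspeed2 p1 p2 p3).
Local Notation time_slope := (time_slope p1 p2 p3).
Local Notation space_slope := (space_slope p1 p2 p3).
Implicit Types (c : 'I_3 -> R) (u s : R).

Lemma is_derive_row n (f : R -> 'rV[R]_n) s (d : 'rV[R]_n) :
  (forall a, is_derive s (1 : R) (fun s => f s 0 a) (d 0 a)) ->
  is_derive s (1 : R) f d.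
Proof.
move=> D; have Df : derivable f s 1.
  by apply/derivable_mxP => i j; rewrite (ord1 i); have [] := D j.
split=> //; rewrite derive_mx //; apply/rowP => a; rewrite mxE.
by have [_ <-] := D a.
Qed.

Lemma is_derive_comp n (f : R -> 'rV[R]_n) s a : derivable f s 1 ->
  is_derive s (1 : R) (fun s => f s 0 a) (derive1 f s 0 a).
Proof.
move=> D; split; first by move/derivable_mxP: (D); exact.
by rewrite derive1E derive_mx // mxE.
Qed.

Lemma christoffel_sum_time x (v : 'rV[R]_4) : U x ->
  \sum_a \sum_b christoffel g ord0 a b x * v 0 a * v 0 b =
  tpow (-1) x * \sum_k p k * tpow (2 * p k) x * v 0 (lift ord0 k) ^+ 2.
Proof.
move=> Ux; under eq_bigr do under eq_bigr do rewrite christoffelE //.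
by rewrite !big_ord_recl !big_ord0 /= /kexp4 /kdiag /kexp /=; ring.
Qed.

Lemma christoffel_sum_space x (v : 'rV[R]_4) k : U x ->
  \sum_a \sum_b christoffel g (lift ord0 k) a b x * v 0 a * v 0 b =
  tpow (-1) x * (2 * p k) * v 0 ord0 * v 0 (lift ord0 k).
Proof.
move=> Ux; under eq_bigr do under eq_bigr do rewrite christoffelE //.
by rewrite !big_ord_recl !big_ord0; case: (I3P k) => -> /=;
  rewrite /kexp4 /kdiag /kexp /=; ring.
Qed.

Lemma gdot_kasner x (v : 'rV[R]_4) : gdot g x v v =
  - v 0 ord0 ^+ 2 + \sum_k tpow (2 * p k) x * v 0 (lift ord0 k) ^+ 2.
Proof.
rewrite /gdot; under eq_bigr do under eq_bigr do rewrite kasner_metricE.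
rewrite !big_ord_recl !big_ord0 /= /kdiag /kexp /=; ring.
Qed.

Section ModelGeodesic.
Variables (c : 'I_3 -> R) (u0 s0 : R) (x0 : 'rV[R]_3).

(** Proper time as a function of [ln t]; it decreases because the geodesic is past directed. *)
Definition affine_parameter u : R := s0 - prim u0 (time_slope c) u.
Local Notation S := affine_parameter.

Definition position u : 'rV[R]_3 :=
  \row_k (x0 0 k - c k * prim u0 (space_slope c k) u).

Definition velocity u : 'rV[R]_4 :=
  pt (- speed c u) (\row_k (c k * expR (- 2 * p k * u))).

(** The inverse of [affine_parameter] on its range; the default 0 is met only outside the parameter
    interval of the model geodesic. *)
Definition log_time s : R := xget 0 [set u | S u = s].
Local Notation L := log_time.

Definition model_geodesic s : 'rV[R]_4 := pt (expR (L s)) (position (L s)).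

Lemma is_derive_affine u : is_derive u (1 : R) S (- time_slope c u).
Proof.
have D := is_derive_prim u0 u (@time_slope_continuous R p1 p2 p3 c).
by have := is_deriveB (is_derive_cst s0 u (1 : R)) D; rewrite sub0r.
Qed.

Lemma affine_decreasing u u' : u < u' -> S u' < S u.
Proof.
move=> uu'; have [w _ e] := @MVT_is_derive R S (fun u => - time_slope c u) u u'
  (ltW uu') (fun w _ => is_derive_affine w).
by rewrite -subr_lt0 e pmulr_llt0 ?subr_gt0 // oppr_lt0 time_slope_gt0.
Qed.

Lemma log_timeK : cancel S L.
Proof.
move=> u; rewrite /L; case: xgetP => [v _ /= vu|/(_ u)/=]; last by [].
case: (ltgtP v u) => // h; have := affine_decreasing h; rewrite vu ltxx //.
Qed.

Lemma affine_continuous : continuous S.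
Proof. exact: is_derive_continuous is_derive_affine. Qed.

Lemma is_derive_log_time u : is_derive (S u) (1 : R) L (- time_slope c u)^-1.
Proof.
apply: is_derive_inverse (is_derive_affine u) _.
- by near=> v; exact: log_timeK.
- by near=> v; exact: affine_continuous.
- by rewrite oppr_eq0 gt_eqF // time_slope_gt0.
Unshelve. all: by end_near. Qed.

Lemma is_derive_along (f : R -> R) (df : R) u : is_derive u (1 : R) f df ->
  is_derive (S u) (1 : R) (f \o L) (df * (- time_slope c u)^-1).
Proof.
move=> Df; apply: is_derive1_comp (is_derive_log_time u).
by rewrite log_timeK.
Qed.

Lemma affine_IVT u u' s : u' <= u -> S u <= s <= S u' -> exists w, S w = s.
Proof.
move=> uu' /andP[h1 h2].
have h : Num.min (S u') (S u) <= s <= Num.max (S u') (S u).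
  by apply/andP; split; [rewrite ge_min h1 orbT|rewrite le_max h2].
by have [w _ ws] := IVT uu' (continuous_subspaceT affine_continuous) h; exists w.
Qed.

Lemma affine_range_interval : is_interval (range S).
Proof.
move=> _ _ [u _ <-] [u' _ <-] s sE.
have uu' : u' <= u.
  rewrite leNgt; apply/negP => /affine_decreasing h3; case/andP: sE => h1 h2.
  by move: (le_trans h1 h2); rewrite leNgt h3.
by have [v vs] := affine_IVT uu' sE; exists v.
Qed.

Lemma affine_range_open : open (range S).
Proof.
rewrite openE => _ [u _ <-]; rewrite /interior; near=> s.
have [v vs] : exists w, S w = s; last by exists v.
apply: (@affine_IVT (u + 1) (u - 1)); first by lra.
apply/andP; split; apply: ltW; near: s.
  by apply: lt_nbhsr; apply: affine_decreasing; lra.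
by apply: lt_nbhsl; apply: affine_decreasing; lra.
Unshelve. all: by end_near. Qed.

Lemma is_derive_model u : is_derive (S u) (1 : R) model_geodesic (velocity u).
Proof.
have e0 := expR_gt0 u; have sp0 := speed_gt0 p1 p2 p3 c u.
apply: is_derive_row => a; case: (unliftP ord0 a) => [k ->|->].
- have -> : (fun s => model_geodesic s 0 (lift ord0 k)) =
      (fun u => x0 0 k - c k * prim u0 (space_slope c k) u) \o L.
    by apply/funext => s; rewrite pt_space mxE.
  have D := is_derive_prim u0 u (@space_slope_continuous R p1 p2 p3 c k).
  have D' : is_derive u (1 : R) (fun u => x0 0 k - c k * prim u0 (space_slope c k) u)
      (- (c k * space_slope c k u)).
    have := is_deriveB (is_derive_cst (x0 0 k) u (1 : R)) (is_deriveZ (c k) D).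
    by rewrite sub0r.
  have := is_derive_along D'; congr is_derive; rewrite pt_space mxE.
  rewrite /space_slope /time_slope invrN mulrNN invf_div.
  have -> : (1 - 2 * p k) * u = u + (-2 * p k * u) by ring.
  by rewrite expRD; field; rewrite !gt_eqF.
- have -> : (fun s => model_geodesic s 0 ord0) = expR \o L.
    by apply/funext => s; rewrite pt_time.
  have := is_derive_along (is_derive_expR u); congr is_derive; rewrite pt_time.
  by rewrite /time_slope invrN mulrN invf_div; field; rewrite gt_eqF.
Qed.

Definition acceleration u : 'rV[R]_4 := pt (dspeed2 c u * expR (- u) / 2)
  (\row_k (2 * p k * (c k * expR (- 2 * p k * u)) * speed c u * expR (- u))).

Lemma derive1_model u : derive1 model_geodesic (S u) = velocity u.
Proof. by rewrite derive1E; have [_ ->] := is_derive_model u. Qed.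

Lemma is_derive_velocity u :
  is_derive (S u) (1 : R) (derive1 model_geodesic) (acceleration u).
Proof.
have e0 := expR_gt0 u; have sp0 := speed_gt0 p1 p2 p3 c u.
apply: (@near_eq_is_derive _ _ _ (velocity \o L)).
  (* The formula for the velocity holds on the range of [S], which is open and hence suffices for a
     derivative. *)
  have : range S (S u) by exists u.
  move/affine_range_open; rewrite /interior => H; near=> s.
  have [v _ <-] : range S s by near: s.
  by rewrite /= log_timeK derive1_model.
apply: is_derive_row => a; case: (unliftP ord0 a) => [k ->|->].
- have -> : (fun s => (velocity \o L) s 0 (lift ord0 k)) =
      (fun u => c k * expR (- 2 * p k * u)) \o L.
    by apply/funext => s; rewrite /= pt_space mxE.
  have := is_derive_along (is_deriveZ (c k) (is_derive_expRM (- 2 * p k) u)).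
  congr is_derive; rewrite pt_space mxE /GRing.scale /=.
  rewrite /time_slope invrN invf_div expRN; field; by rewrite gt_eqF.
- have -> : (fun s => (velocity \o L) s 0 ord0) = (fun u => - speed c u) \o L.
    by apply/funext => s; rewrite /= pt_time.
  have := is_derive_along (is_deriveN (is_derive_speed p1 p2 p3 c u)).
  congr is_derive; rewrite pt_time.
  by rewrite /time_slope invrN invf_div expRN; field; rewrite !gt_eqF.
Unshelve. all: by end_near. Qed.

Lemma tpow_expR (m u : R) y : tpow m (pt (expR u) y) = expR (m * u).
Proof. by rewrite tpow_pt -expRM mulrC. Qed.

Lemma model_geodesicP : geodesic_on g U (range S) model_geodesic.
Proof.
split; [exact: affine_range_open|exact: affine_range_interval|by exists (S 0); exists 0|].
move=> _ [u _ <-].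
have Um : U (model_geodesic (S u)) by apply: spacetime_pt; exact: expR_gt0.
have [D1 _] := is_derive_model u; have [D2 E2] := is_derive_velocity u.
have e0 := expR_gt0 u; have sp0 := speed_gt0 p1 p2 p3 c u.
apply: (And4 Um D1 D2) => a; rewrite derive1_model derive1E E2.
case: (unliftP ord0 a) => [k ->|->].
- rewrite christoffel_sum_space // /acceleration /velocity !pt_space !pt_time !mxE.
  by rewrite tpow_expR log_timeK mulN1r; ring.
- rewrite christoffel_sum_time // pt_time tpow_expR log_timeK mulN1r.
  rewrite /dspeed2 mulrAC big_distrl big_distrl mulr_sumr /= -big_split /= big1 // => k _.
  rewrite tpow_expR log_timeK pt_space mxE exprMn -expRM_natl.
  have -> : 2%:R * (- 2 * p k * u) = - 2 * p k * u + - 2 * p k * u by ring.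
  have h : expR (2 * p k * u) * expR (- 2 * p k * u) = 1.
    by rewrite -expRD (_ : _ + _ = 0) ?expR0 //; ring.
  rewrite expRD.
  transitivity (c k ^+ 2 * expR (- 2 * p k * u) * p k * expR (- u) *
     (expR (2 * p k * u) * expR (- 2 * p k * u) - 1)); first by field.
  by rewrite h subrr mulr0.
Qed.

End ModelGeodesic.
End Geodesics.

Section TimelikeGeodesics.
Variables (R : realType) (p1 p2 p3 : R).
Local Notation p := (kexp p1 p2 p3).
Local Notation g := (kasner_metric p1 p2 p3).
Local Notation U := (@spacetime R).
Local Notation pt := (@spacetime_point R).
Local Notation speed := (speed p1 p2 p3).
Local Notation speed2 := (speed2 p1 p2 p3).
Local Notation time_slope := (time_slope p1 p2 p3).
Local Notation space_slope := (space_slope p1 p2 p3).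
Local Notation affine_parameter := (affine_parameter p1 p2 p3).
Local Notation position := (position p1 p2 p3).
Local Notation velocity := (velocity p1 p2 p3).

Lemma interval_constant (I : set R) (f : R -> R) s0 s : is_interval I ->
  I s0 -> I s -> (forall r, I r -> is_derive r (1 : R) f 0) -> f s = f s0.
Proof.
move=> itvI I0 Is D.
have seg r : Num.min s0 s <= r <= Num.max s0 s -> I r.
  by case: (leP s0 s) => _ rE; [exact: itvI I0 Is r rE|exact: itvI Is I0 r rE].
have := @MVT_le R f (fun=> 0) s0 s 0 (fun r rE => D r (seg r rE)).
rewrite mul0r => h; apply/eqP; rewrite -subr_eq0 -normr_le0; apply: h => r _.
by rewrite normr0.
Qed.

Variables (I : set R) (gamma : R -> 'rV[R]_4) (s0 : R).
Hypotheses (geo : timelike_geodesic p1 p2 p3 I gamma) (I0 : I s0).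

Local Notation t s := (gamma s 0 ord0).
Local Notation v s := (derive1 gamma s).

Definition momentum k : R := tpow (2 * p k) (gamma s0) * v s0 0 (lift ord0 k).
Local Notation c := momentum.
Local Notation u0 := (ln (t s0)).
Local Notation S := (affine_parameter c u0 s0).
Definition base_point : 'rV[R]_3 := \row_k gamma s0 0 (lift ord0 k).
Local Notation x0 := base_point.

Let geoI : geodesic_on g U I gamma. Proof. by case: geo => -[]. Qed.
Let itvI : is_interval I. Proof. by case: geoI. Qed.
Let t_gt0 s : I s -> 0 < t s. Proof. by case: geoI => _ _ _ h /h[]. Qed.

Let is_derive_gamma s a : I s -> is_derive s (1 : R) (fun s => gamma s 0 a) (v s 0 a).
Proof. by case: geoI => _ _ _ h /h[_ D _ _]; exact: is_derive_comp. Qed.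

Let is_derive_v s a : I s ->
  is_derive s (1 : R) (fun s => v s 0 a)
    (- \sum_b \sum_d christoffel g a b d (gamma s) * v s 0 b * v s 0 d).
Proof.
case: geoI => _ _ _ h /h[_ _ D E]; have := is_derive_comp a D.
by congr is_derive; apply/eqP; rewrite -addr_eq0; apply/eqP; exact: E.
Qed.

Let is_derive_ln_t s : I s -> is_derive s (1 : R) (fun s => ln (t s)) (v s 0 ord0 / t s).
Proof.
move=> Is; have := is_derive1_comp (is_derive1_ln (t_gt0 Is)) (is_derive_gamma ord0 Is).
by rewrite mulrC.
Qed.

Let tpowE (m : R) s : I s -> tpow m (gamma s) = expR (m * ln (t s)).
Proof. by move=> Is; rewrite mulrC expRM lnK // posrE t_gt0. Qed.

(** The metric does not depend on the space coordinates, so [t^(2 p_k) x_k'] is conserved; the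
    geodesic equation makes its derivative vanish. *)
Lemma momentumE s k : I s -> v s 0 (lift ord0 k) = c k * expR (- 2 * p k * ln (t s)).
Proof.
move=> Is.
have D r : I r -> is_derive r (1 : R)
    (fun s => expR (2 * p k * ln (t s)) * v s 0 (lift ord0 k)) 0.
  move=> Ir; have D1 := is_derive1_comp (is_derive_expRM (2 * p k) _) (is_derive_ln_t Ir).
  have D2 := is_derive_v (lift ord0 k) Ir.
  have Ur : U (gamma r) by case: geoI => _ _ _ h; have [] := h r Ir.
  have := is_deriveM D1 D2; congr is_derive; rewrite /GRing.scale /=.
  rewrite christoffel_sum_space // /tpow powRN powRr1 ?ltW ?t_gt0 //; ring.
have := interval_constant itvI I0 Is D; rewrite /c tpowE // => <-.
rewrite mulrAC -expRD (_ : _ + _ = 0) ?expR0 ?mul1r //; ring.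
Qed.

(** The normalization determines the square of [t'] and past directedness its sign. *)
Lemma time_velocityE s : I s -> v s 0 ord0 = - speed c (ln (t s)).
Proof.
move=> Is; have [_ /(_ s Is)[]] := geo; rewrite gdot_kasner => e neg.
have sq : v s 0 ord0 ^+ 2 = speed c (ln (t s)) ^+ 2.
  rewrite speed_sqr /speed2; move: e.
  rewrite (eq_bigr (fun k => c k ^+ 2 * expR (- 2 * p k * ln (t s)))) => [|k _].
    by move=> e; lra.
  rewrite momentumE // tpowE // exprMn mulrCA; congr (_ * _).
  rewrite -expRM_natl -expRD; congr expR; ring.
have := speed_gt0 p1 p2 p3 c (ln (t s)); move/eqP: sq.
have n : v s 0 ord0 < 0 by exact: neg.
by rewrite eqf_sqr => /orP[/eqP e' h|/eqP -> //]; move: n; rewrite e' ltNge ltW.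
Qed.

Lemma affine_ln_t s : I s -> S (ln (t s)) = s.
Proof.
move=> Is.
have D r : I r -> is_derive r (1 : R) (fun s => S (ln (t s)) - s) 0.
  move=> Ir; have D1 := is_derive1_comp (is_derive_affine p1 p2 p3 c u0 s0 _) (is_derive_ln_t Ir).
  have := is_deriveB D1 (is_derive_id r (1 : R)); congr is_derive.
  rewrite time_velocityE // /time_slope lnK ?posrE ?t_gt0 //.
  have := t_gt0 Ir; have := speed_gt0 p1 p2 p3 c (ln (t r)) => sp0 t0.
  by field; rewrite !gt_eqF.
have := interval_constant itvI I0 Is D; have -> : S u0 = s0 - prim u0 (time_slope c) u0 by [].
rewrite prim_id subr0 subrr.
by move/eqP; rewrite subr_eq0 => /eqP.
Qed.

Lemma space_ln_t s k : I s ->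
  gamma s 0 (lift ord0 k) = x0 0 k - c k * prim u0 (space_slope c k) (ln (t s)).
Proof.
move=> Is.
have D r : I r -> is_derive r (1 : R) (fun s => gamma s 0 (lift ord0 k)
    + c k * prim u0 (space_slope c k) (ln (t s))) 0.
  move=> Ir; have D1 := is_derive1_comp
    (is_derive_prim u0 _ (@space_slope_continuous R p1 p2 p3 c k)) (is_derive_ln_t Ir).
  have := is_deriveD (is_derive_gamma (lift ord0 k) Ir) (is_deriveZ (c k) D1).
  congr is_derive; rewrite /GRing.scale /= momentumE // time_velocityE //.
  rewrite /space_slope mulrBl mul1r.
  have -> : - 2 * p k * ln (t r) = - (2 * p k * ln (t r)) by ring.
  rewrite expRD lnK ?posrE ?t_gt0 //.
  have := t_gt0 Ir; have := speed_gt0 p1 p2 p3 c (ln (t r)) => sp0 t0.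
  by field; rewrite !gt_eqF.
have := interval_constant itvI I0 Is D; rewrite prim_id mulr0 addr0 mxE => <-.
by rewrite addrK.
Qed.

Lemma log_time_ln_t s : I s -> log_time p1 p2 p3 c u0 s0 s = ln (t s).
Proof. by move=> Is; rewrite -{1}(affine_ln_t Is) log_timeK. Qed.

(** The model curve is a geodesic on [range S] that agrees with [gamma] on [I], so inextendibility
    forces equality. Hence [ln t] takes every real value along [gamma], and [t] reaches 0 in the
    limit. *)
Lemma timelike_geodesic_range : I = range S.
Proof.
have [[_ inext] _] := geo; apply/esym.
apply: inext (model_geodesicP p1 p2 p3 c u0 s0 x0) _ _ => s Is.
  by exists (ln (t s)) => //; exact: affine_ln_t.
rewrite /model_geodesic log_time_ln_t // lnK ?posrE ?t_gt0 //; apply/esym/pt_eq => // k.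
by rewrite mxE; exact: space_ln_t.
Qed.

Lemma timelike_geodesicE u : [/\ I (S u), gamma (S u) = pt (expR u) (position c u0 x0 u)
  & v (S u) = velocity c u].
Proof.
have Is : I (S u) by rewrite timelike_geodesic_range; exists u.
have lt : ln (t (S u)) = u by rewrite -log_time_ln_t // log_timeK.
split=> //; apply: pt_eq => [|k].
- by rewrite -{2}lt lnK // posrE t_gt0.
- by rewrite space_ln_t // lt [RHS]mxE.
- by rewrite time_velocityE // lt.
- by rewrite momentumE // lt [RHS]mxE.
Qed.

End TimelikeGeodesics.

(** * Endpoints of geodesics at the singularity and their measurability *)

Section Drift.
Variables (R : realType) (p1 p2 p3 : R).
Hypothesis hp : kasner_exponents p1 p2 p3.
Hypothesis hflat : p3 < 1.
Local Notation p := (kexp p1 p2 p3).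
Local Notation space_slope := (space_slope p1 p2 p3).
Local Notation speed := (speed p1 p2 p3).
Local Notation speed2 := (speed2 p1 p2 p3).
Local Notation position := (position p1 p2 p3).
Local Notation mR := (measurableTypeR R).
Implicit Types (c : 'I_3 -> R) (u t : R).

(** The displacement in the k-th space direction from [t = expR u0] down to the singularity. A limit
    along integers displays it as a limit of a sequence of functions measurable in the momenta. *)
Definition drift c u0 k : R := lim (c k * rint (- n%:R) u0 (space_slope c k) @[n --> \oo]).

Lemma cvg_prim_slope c u0 k : exists l : R,
  c k * prim u0 (space_slope c k) (ln t) @[t --> 0^'+] --> l.
Proof.
have p0 : 0 < 1 - p k by have := kexp_le3 hp k; move: hflat; lra.
apply: (@power_cvg R _ (fun t => c k * (space_slope c k (ln t) * t^-1)) 1 (1 - p k)) => // t /andP[t0 _].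
  have D := is_derive1_comp (is_derive_prim u0 (ln t) (@space_slope_continuous R p1 p2 p3 c k))
    (is_derive1_ln t0).
  exact: (is_deriveZ (c k) D).
have -> : 1 * t `^ (1 - p k - 1) = t `^ (1 - p k) * t^-1.
  by rewrite mul1r [LHS]powRD ?(gt_eqF t0) ?implybT // powRN powRr1 // ltW.
rewrite mulrA normrM normfV (gtr0_norm t0) ler_pM2r ?invr_gt0 //.
have := space_slope_le p1 p2 p3 c k (ln t).
by rewrite [(1 - p k) * _]mulrC expRM lnK ?posrE.
Qed.

Lemma expRN_nat_cvg : expR (- n%:R : R) @[n --> \oo] --> 0^'+.
Proof.
move=> P [e /= e0 H]; suff : \forall n \near \oo, P (expR (- n%:R)) by [].
near=> n; apply: H; last exact: expR_gt0.
rewrite /= sub0r normrN gtr0_norm ?expR_gt0 // -[ltRHS]lnK ?posrE // ltr_expR ltrNl.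
by near: n; exact: nbhs_infty_gtr.
Unshelve. all: by end_near. Qed.

Lemma cvg_drift c u0 k :
  c k * rint (- n%:R) u0 (space_slope c k) @[n --> \oo] --> drift c u0 k /\
  c k * prim u0 (space_slope c k) (ln t) @[t --> 0^'+] --> - drift c u0 k.
Proof.
have [l cl] := cvg_prim_slope c u0 k.
have h1 : c k * prim u0 (space_slope c k) (- n%:R) @[n --> \oo] --> l.
  have -> : (fun n : nat => c k * prim u0 (space_slope c k) (- n%:R)) =
      (fun t => c k * prim u0 (space_slope c k) (ln t)) \o (fun n => expR (- n%:R)).
    by apply/funext => n; rewrite /= expRK.
  exact: cvg_comp expRN_nat_cvg cl.
have h2 : c k * rint (- n%:R) u0 (space_slope c k) @[n --> \oo] --> - l.
  apply: (cvg_trans _ (cvgN h1)); apply: near_eq_cvg; near=> n.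
  rewrite !fctE /prim (@rint_gt _ u0) ?sub0r ?mulrN ?opprK // ltrNl.
  by near: n; exact: nbhs_infty_gtr.
have e : drift c u0 k = - l by exact: (cvg_lim _ h2).
by rewrite e opprK.
Unshelve. all: by end_near. Qed.

Lemma cvg_position c u0 x0 k :
  position c u0 x0 (ln t) 0 k @[t --> 0^'+] --> x0 0 k + drift c u0 k.
Proof.
have -> : (fun t => position c u0 x0 (ln t) 0 k) =
    (fun t => x0 0 k - c k * prim u0 (space_slope c k) (ln t)).
  by apply/funext => t; rewrite mxE.
by rewrite -[drift _ _ _]opprK; apply: cvgB (cvg_drift c u0 k).2; exact: cvg_cst.
Qed.

(** The momenta in terms of the velocity coordinates of the chart; [a k] will be
    [tstar ^ (2 p_k)]. *)
Definition vmom (a : 'I_3 -> R) (v : mR * mR * mR) (k : 'I_3) : R :=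
  a k * [:: v.1.1; v.1.2; v.2]`_k.

Lemma measurable_vmom a k : measurable_fun setT (fun v => vmom a v k).
Proof.
apply: measurable_funM; first exact: measurable_cst.
have m0 : measurable_fun [set: mR * mR * mR] id by exact: measurable_id.
have m1 := mfst m0.
by case: (I3P k) => ->; [exact: (mfst m1)|exact: (msnd m1)|exact: (msnd m0)].
Qed.

Lemma measurable_space_slope a k :
  measurable_fun setT (fun q : (mR * mR * mR) * mR => space_slope (vmom a q.1) k q.2).
Proof.
have m0 : measurable_fun [set: (mR * mR * mR) * mR] id by exact: measurable_id.
have mE (r : R) : measurable_fun setT (fun q : (mR * mR * mR) * mR => expR (r * q.2)).
  apply: (measurableT_comp (@measurable_expR R)).
  by apply: measurable_funM; [exact: measurable_cst|exact: (msnd m0)].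
apply: measurable_funM; first exact: mE.
have -> : (fun q : (mR * mR * mR) * mR => (speed (vmom a q.1) q.2)^-1) =
   (fun q => speed2 (vmom a q.1) q.2 `^ (- 2^-1)).
  apply/funext => q; rewrite powRN powR12_sqrt //; exact: le_trans (speed2_ge1 _ _ _ _ _).
apply: (measurableT_comp (measurable_powR _)).
apply: measurable_funD; first exact: measurable_cst.
apply: measurable_sum => j; apply: measurable_funM; last exact: mE.
apply: measurable_funX; exact: (measurableT_comp (measurable_vmom a j)) (mfst m0).
Qed.

(** Tonelli gives measurability of the integral in the parameter. It needs a nonnegative integrand,
    which is why the signed factor [c k] stands outside the integral. *)
Lemma measurable_drift a u0 k : measurable_fun setT (fun v => drift (vmom a v) u0 k : mR).
Proof.
apply: (measurable_fun_cvg (h := fun n v =>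
  vmom a v k * rint (- n%:R) u0 (space_slope (vmom a v) k))) => [n|v _]; last exact: (cvg_drift _ _ _).1.
apply: measurable_funM; first exact: measurable_vmom.
pose D : set R := `[- n%:R, u0]%classic.
pose f (q : (mR * mR * mR) * mR) : \bar R := (space_slope (vmom a q.1) k q.2 * \1_D q.2)%:E.
have mf : measurable_fun setT f.
  apply/measurable_EFinP; apply: measurable_funM; first exact: measurable_space_slope.
  apply: (measurableT_comp (@measurable_indic _ _ R setT D _)); last exact: measurable_snd.
  exact: measurable_itv.
have f0 q : (0 <= f q)%E.
  by rewrite lee_fin mulr_ge0 // divr_ge0 ?expR_ge0 // ltW ?speed_gt0.
have mF := @measurable_fun_fubini_tonelli_F _ _ _ _ R (@lebesgue_measure R) f mf f0.
have -> : (fun v => rint (- n%:R) u0 (space_slope (vmom a v) k)) =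
    fine \o fubini_F (@lebesgue_measure R) f.
  apply/funext => v; rewrite /rint /Rintegral /= [in LHS]integral_mkcond.
  congr fine; apply: eq_integral => u _.
  by rewrite /f patchE indicE /=; case: ifPn => _; rewrite ?mulr1 ?mulr0.
apply: (measurableT_comp _ mF); exact: fine_measurable.
Qed.

End Drift.

(** * Energy density along geodesics *)

Section EnergyDensity.
Variables (R : realType) (p1 p2 p3 : R).
Hypothesis hp : kasner_exponents p1 p2 p3.
Hypothesis hflat : p3 < 1.
Local Notation p := (kexp p1 p2 p3).
Local Notation kdiag := (kdiag p1 p2 p3).
Local Notation g := (kasner_metric p1 p2 p3).
Local Notation U := (@spacetime R).
Local Notation pt := (@spacetime_point R).

Lemma sum_inv_metric x c (F : 'I_4 -> R) : U x ->
  \sum_d inv_metric g x c d * F d = (kdiag c x)^-1 * F c.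
Proof.
move=> Ux; rewrite (bigD1 c) //= big1 => [|d dc]; rewrite inv_metricE //.
  by rewrite eqxx mulr1n addr0.
by rewrite eq_sym (negbTE dc) mulr0n mul0r.
Qed.

Lemma stress_energyE x (F : 'M[R]_4) (v : 'rV[R]_4) : U x ->
  \sum_a \sum_b stress_energy g x F a b * v 0 a * v 0 b =
  (4 * pi)^-1 * ((\sum_c (kdiag c x)^-1 * (\sum_a v 0 a * F a c) ^+ 2)
    - 4^-1 * gdot g x v v *
      \sum_m \sum_k (kdiag m x)^-1 * (kdiag k x)^-1 * F m k ^+ 2).
Proof.
move=> Ux; pose F2 := \sum_m \sum_k \sum_a \sum_b
  inv_metric g x m a * inv_metric g x k b * F m k * F a b.
have -> : \sum_m \sum_k (kdiag m x)^-1 * (kdiag k x)^-1 * F m k ^+ 2 = F2.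
  apply: eq_bigr => m _; apply: eq_bigr => k _.
  rewrite (eq_bigr (fun a => inv_metric g x m a * ((kdiag k x)^-1 * (F m k * F a k)))).
    by rewrite sum_inv_metric //; ring.
  move=> a _; rewrite -(sum_inv_metric k (fun b => F m k * F a b)) // mulr_sumr.
  by apply: eq_bigr => b _; ring.
have T a b : \sum_c \sum_d inv_metric g x c d * F a c * F b d =
    \sum_c (kdiag c x)^-1 * F a c * F b c.
  apply: eq_bigr => c _; rewrite -mulrA -(sum_inv_metric c (fun d => F a c * F b d)) //.
  by apply: eq_bigr => d _; ring.
rewrite /gdot; under eq_bigr do under eq_bigr do rewrite mxE T -/F2.
rewrite !big_ord_recl !big_ord0 /=; ring.
Qed.

(** The first two terms are the squared norm of the one-form obtained by inserting [v] into [F]; the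
    last is a quarter of the invariant F_ab F^ab, by [gdot g x v v = -1]. *)
Lemma energy_frame x (F : 'M[R]_4) (v : 'rV[R]_4) (e z : 'I_3 -> R)
    (m : 'I_3 -> 'I_3 -> R) : U x ->
  gdot g x v v = -1 -> (forall a b, F b a = - F a b) ->
  (forall i, e i = tpow (- p i) x * F ord0 (lift ord0 i)) ->
  (forall j k, m j k = tpow (- p j) x * (tpow (- p k) x * F (lift ord0 j) (lift ord0 k))) ->
  (forall i, v 0 (lift ord0 i) = tpow (- p i) x * z i) ->
  \sum_a \sum_b stress_energy g x F a b * v 0 a * v 0 b =
  (4 * pi)^-1 * (- (\sum_i z i * e i) ^+ 2
    + \sum_i (v 0 ord0 * e i + \sum_j z j * m j i) ^+ 2
    + 2^-1 * (2^-1 * (\sum_j \sum_k m j k ^+ 2) - \sum_i e i ^+ 2)).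
Proof.
move=> Ux vv anti eE mE vE; rewrite stress_energyE // vv; congr (_ * _).
have F0 a : F a a = 0 by have := anti a a; lra.
have k0 : kdiag ord0 x = -1 by [].
have i01 := anti (lift ord0 ord0) (lift ord0 (lift ord0 ord0)).
have i02 := anti (lift ord0 ord0) (lift ord0 (lift ord0 (lift ord0 ord0))).
have i12 := anti (lift ord0 (lift ord0 ord0)) (lift ord0 (lift ord0 (lift ord0 ord0))).
rewrite !big_ord_recl !big_ord0 !eE !mE !vE !k0 !kdiag_inv // !F0.
by rewrite !(anti ord0) i01 i02 i12; field.
Qed.

End EnergyDensity.

Section EnergyBlowUp.
Variables (R : realType) (p1 p2 p3 : R).
Hypothesis hp : kasner_exponents p1 p2 p3.
Hypothesis hflat : p3 < 1.
Local Notation p := (kexp p1 p2 p3).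
Local Notation lam := (1 - p1).
Local Notation g := (kasner_metric p1 p2 p3).
Local Notation U := (@spacetime R).
Local Notation pt := (@spacetime_point R).
Local Notation position := (position p1 p2 p3).
Local Notation velocity := (velocity p1 p2 p3).
Local Notation drift := (drift p1 p2 p3).
Let i0 : 'I_3 := ord0.
Let i1 : 'I_3 := lift ord0 ord0.
Let i2 : 'I_3 := lift ord0 (lift ord0 ord0).

Lemma sum3 (F : 'I_3 -> R) : \sum_i F i = F i0 + F i1 + F i2.
Proof. by rewrite !big_ord_recl big_ord0 addr0 addrA. Qed.

Lemma decay_cvg0 (f : R -> R) (C r : R) : 0 < r ->
  (forall t, 0 < t <= 1 -> `|f t| <= C * t `^ r) -> f t @[t --> 0^'+] --> 0.
Proof.
move=> r0 fC.
have h : C * t `^ r @[t --> 0^'+] --> (0 : R).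
  rewrite -[X in _ --> X](mulr0 C); apply: cvgM; [exact: cvg_cst|exact: powR_cvg0].
apply/norm_cvg0P; apply: (squeeze_cvgr _ (cvg_cst 0) h).
near=> t; rewrite normr_ge0 /=; apply: fC; apply/andP; split; near: t.
  exact: nbhs_right_gt.
exact: nbhs_right_le.
Unshelve. all: by end_near. Qed.

Lemma cvg_sqr (F : set_system R) (FF : Filter F) (f : R -> R) (l : R) :
  f t @[t --> F] --> l -> f t ^+ 2 @[t --> F] --> l ^+ 2.
Proof. by move=> fl; under eq_fun do rewrite expr2; rewrite expr2; exact: cvgM. Qed.

Lemma powR_ln (r t : R) : 0 < t -> t `^ r = expR (r * ln t).
Proof. by move=> t0; rewrite mulrC expRM lnK. Qed.

Lemma gdot_velocity c t y : 0 < t ->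
  gdot g (pt t y) (velocity c (ln t)) (velocity c (ln t)) = -1.
Proof.
move=> t0; rewrite gdot_kasner pt_time sqrrN speed_sqr /speed2.
under [X in _ + X]eq_bigr => k _.
  rewrite pt_space mxE tpow_pt (powR_ln _ t0) exprMn mulrCA -expRM_natl -expRD.
  rewrite (_ : _ + _ = - 2 * p k * ln t); last by ring.
  over.
by rewrite opprD subrK.
Qed.

Lemma ext_d_anti (omega : 'rV[R]_4 -> 'rV[R]_4) x a b :
  ext_d omega x b a = - ext_d omega x a b.
Proof. by rewrite !mxE opprB. Qed.

(** Applied with [r = t^lam] for the fields and [s = t^p3] for the velocity; then [(r * s)^2] is
    [t^(2 p2 + 4 p3)]. *)
Lemma rescaled_energy x (F : 'M[R]_4) (v : 'rV[R]_4) (e z : 'I_3 -> R)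
    (m : 'I_3 -> 'I_3 -> R) (r s : R) : U x ->
  gdot g x v v = -1 -> (forall a b, F b a = - F a b) ->
  (forall i, e i = tpow (- p i) x * F ord0 (lift ord0 i)) ->
  (forall j k, m j k = tpow (- p j) x * (tpow (- p k) x * F (lift ord0 j) (lift ord0 k))) ->
  (forall i, v 0 (lift ord0 i) = tpow (- p i) x * z i) ->
  (r * s) ^+ 2 * \sum_a \sum_b stress_energy g x F a b * v 0 a * v 0 b =
  (4 * pi)^-1 * (- (\sum_i (s * z i) * (r * e i)) ^+ 2
    + \sum_i ((s * v 0 ord0) * (r * e i) + \sum_j (s * z j) * (r * m j i)) ^+ 2
    + 2^-1 * s ^+ 2 * (2^-1 * (\sum_j \sum_k (r * m j k) ^+ 2) - \sum_i (r * e i) ^+ 2)).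
Proof.
move=> Ux vv anti eE mE vE; rewrite (energy_frame Ux vv anti eE mE vE) !sum3; ring.
Qed.

Variables (w : state R) (K : R) (omega : 'rV[R]_4 -> 'rV[R]_4).
Hypotheses (W : maxwell p w) (b : data_bound w 4 K) (K0 : 0 <= K).
Hypothesis elecE : forall x i, U x ->
  elec w i x = tpow (- p i) x * ext_d omega x ord0 (lift ord0 i).
Hypothesis magnE : forall x j k, U x ->
  magn w j k x = tpow (- p j) x * (tpow (- p k) x * ext_d omega x (lift ord0 j) (lift ord0 k)).
Variables (c : 'I_3 -> R) (u0 : R) (x0 : 'rV[R]_3).

Definition endpoint : 'rV[R]_3 := \row_k (x0 0 k + drift c u0 k).
Local Notation pos t := (position c u0 x0 (ln t)).
Local Notation vel t := (velocity c (ln t)).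

Let damped_elec0 : damped p1 p2 p3 w lam (elec w i0).
Proof. by left; exists i0. Qed.

Let damped_magn12 : damped p1 p2 p3 w lam (magn w i1 i2).
Proof. by right; exists i1, i2; split=> //; case: hp => _ _ h _; rewrite /kexp /=; lra. Qed.

Let cX k : pos t 0 k @[t --> 0^'+] --> endpoint 0 k.
Proof. by rewrite [endpoint 0 k]mxE; exact: cvg_position. Qed.

Lemma decaying_component m f : damped p1 p2 p3 w m f -> m - lam + 1 - p3 < 0 ->
  t `^ lam * f (pt t (pos t)) @[t --> 0^'+] --> 0.
Proof.
move=> df mlt; apply: (@decay_cvg0 _
  (K + 4 * (decay_const R * K) / - (m - lam + 1 - p3)) (1 - p3)) => [|t t01].
  by move: hflat; lra.
exact: (damped_decay hp hflat _ W b K0 df mlt t01).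
Qed.

Definition elec_limit i := if i == i0 then profile p1 (elec w i0) endpoint else 0.

Definition magn_limit j k := (j == i1)%:R * (k == i2)%:R * profile p1 (magn w i1 i2) endpoint
  - (j == i2)%:R * (k == i1)%:R * profile p1 (magn w i1 i2) endpoint.

(** The exponent to be negative in [decaying_component] is [2 p1] for E_2 and [2 p1 + p2 - p3] for
    E_3; in [cvg_magn] the same values occur for B_13 and B_12. *)
Lemma cvg_elec i : t `^ lam * elec w i (pt t (pos t)) @[t --> 0^'+] --> elec_limit i.
Proof.
have n1 := kasner_p1_lt0 hp hflat; case: (hp) => h12 h23 hs _.
case: (I3P i) => ->; rewrite /elec_limit /=.
- exact: (cvg_along hp hflat W b K0 damped_elec0 cX).
- apply: (@decaying_component (1 - p i1)); first by left; exists i1.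
  rewrite /kexp /=; lra.
- apply: (@decaying_component (1 - p i2)); first by left; exists i2.
  by rewrite /kexp /=; move: hflat; lra.
Qed.

Lemma cvg_magn j k : t `^ lam * magn w j k (pt t (pos t)) @[t --> 0^'+] --> magn_limit j k.
Proof.
have n1 := kasner_p1_lt0 hp hflat; case: (hp) => h12 h23 hs _.
have diag l : t `^ lam * magn w l l (pt t (pos t)) @[t --> 0^'+] --> 0.
  apply: cvg_near_cst; near=> t.
  have t0 : 0 < t by near: t; exact: nbhs_right_gt.
  by have := magn_anti W l l (spacetime_pt (pos t) t0) => h; nra.
have D l m : p l + p m - lam + 1 - p3 < 0 ->
    t `^ lam * magn w l m (pt t (pos t)) @[t --> 0^'+] --> 0.
  by apply: decaying_component; right; exists l, m.
have B := cvg_along hp hflat W b K0 damped_magn12 cX.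
case: (I3P j) => ->; case: (I3P k) => ->; rewrite /magn_limit /= ?mul1r ?mul0r ?mulr0 ?mulr1 ?subr0 ?sub0r //.
all: try by apply: D; rewrite /kexp /=; lra.
apply: cvg_trans (cvgN B); apply: near_eq_cvg; near=> t.
have t0 : 0 < t by near: t; exact: nbhs_right_gt.
by rewrite !fctE -mulrN -(magn_anti W _ _ (spacetime_pt (pos t) t0)).
Unshelve. all: by end_near. Qed.

(** [z] is a limit of rescaled frame velocities. For the second direction it depends on whether
    [p2 = p3], so the statement fixes only the other two. *)
Lemma cvg_momentum i : exists z : R, t `^ (p3 - p i) * c i @[t --> 0^'+] --> z /\
  (i = i0 -> z = 0) /\ (i = i2 -> z = c i2).
Proof.
have n1 := kasner_p1_lt0 hp hflat; case: (hp) => h12 h23 hs _.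
have h0 : p i < p3 -> t `^ (p3 - p i) * c i @[t --> 0^'+] --> 0.
  move=> pi3; rewrite -[X in _ --> X](mul0r (c i)).
  by apply: cvgM; [apply: powR_cvg0; rewrite subr_gt0|exact: cvg_cst].
have h1 : p i = p3 -> t `^ (p3 - p i) * c i @[t --> 0^'+] --> c i.
  by move=> ->; rewrite subrr; under eq_fun do rewrite powRr0 mul1r; exact: cvg_cst.
case: (I3P i) => ie.
- exists 0; split; last by split=> //; rewrite ie.
  by apply: h0; rewrite ie /kexp /=; move: hflat; lra.
- case: (ltP p2 p3) => h; [exists 0|exists (c i)]; split; try by split=> //; rewrite ie.
    by apply: h0; rewrite ie.
  by apply: h1; rewrite ie /kexp /=; lra.
- exists (c i); split; last by split=> //; rewrite ie.
  by apply: h1; rewrite ie.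
Qed.

Lemma energy_blowup : c i2 != 0 -> profile p1 (elec w i0) endpoint != 0 ->
  exists2 l : R, 0 < l &
    t `^ (2 * p2 + 4 * p3) * (\sum_a \sum_b stress_energy g (pt t (pos t))
      (ext_d omega (pt t (pos t))) a b * vel t 0 a * vel t 0 b) @[t --> 0^'+] --> l.
Proof.
move=> c2 D0.
have [z /all_and2[cz /all_and2[z0 z2]]] := choice cvg_momentum.
have p30 : 0 < p3 by have := kasner_p2_gt0 hp hflat; case: hp => _ h23 _ _; lra.
have cs : t `^ p3 @[t --> 0^'+] --> 0 := powR_cvg0 p30.
pose nu t := t `^ p3 * vel t 0 ord0.
(* The factor [t^p3] suppresses the summand 1 of [speed2] and leaves the norm of the limit
   velocity. *)
have cnu : nu t @[t --> 0^'+] --> - Num.sqrt (\sum_i z i ^+ 2).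
  have h : Num.sqrt ((t `^ p3) ^+ 2 + \sum_i (t `^ (p3 - p i) * c i) ^+ 2) @[t --> 0^'+]
      --> Num.sqrt (\sum_i z i ^+ 2).
    apply: continuous_cvg; first exact: sqrt_continuous.
    rewrite -[X in _ --> X]add0r -[X in _ --> X + _](expr0n R 2).
    apply: cvgD; first exact: cvg_sqr.
    by apply: cvg_sumr => i; exact: cvg_sqr.
  apply: cvg_trans (cvgN h); apply: near_eq_cvg; near=> t.
  have t0 : 0 < t by near: t; exact: nbhs_right_gt.
  rewrite !fctE /nu /velocity pt_time mulrN; congr (- _).
  rewrite -[t `^ p3 in RHS]ger0_norm ?powR_ge0 // -sqrtr_sqr /speed -sqrtrM ?sqr_ge0 //.
  congr Num.sqrt; rewrite /speed2 mulrDr mulr1 mulr_sumr; congr (_ + _).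
  apply: eq_bigr => i _; rewrite exprMn [in RHS]mulrCA [RHS]mulrC; congr (_ * _).
  by rewrite !(powR_ln _ t0) -!expRM_natl -expRD; congr expR; ring.
pose s := Num.sqrt (\sum_i z i ^+ 2).
exists ((4 * pi)^-1 * (- (\sum_i z i * elec_limit i) ^+ 2
    + \sum_i (- s * elec_limit i + \sum_j z j * magn_limit j i) ^+ 2
    + 2^-1 * 0 ^+ 2 * (2^-1 * (\sum_j \sum_k (magn_limit j k) ^+ 2) - \sum_i (elec_limit i) ^+ 2))).
  rewrite mulr_gt0 ?invr_gt0 ?mulr_gt0 ?pi_gt0 // !sum3 /elec_limit /magn_limit /= (z0 i0) // (z2 i2) //.
  have s2 : s ^+ 2 = z i1 ^+ 2 + c i2 ^+ 2.
    rewrite sqr_sqrtr; last by apply: sumr_ge0 => i _; exact: sqr_ge0.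
    by rewrite sum3 (z0 i0) // (z2 i2) // expr0n add0r.
  set D := profile _ (elec _ _) _ in D0 *; set B := profile _ (magn _ _ _) _.
  apply: (@lt_le_trans _ _ (c i2 ^+ 2 * D ^+ 2)).
    by rewrite mulr_gt0 // lt_def sqrf_eq0 sqr_ge0 andbT.
  set E := (X in _ <= X).
  (* As [z i0] vanishes, the electric limit is orthogonal to the velocity limit and the negative
     square drops out. *)
  have -> : E = s ^+ 2 * D ^+ 2 + (c i2 * B) ^+ 2 + (z i1 * B) ^+ 2 by rewrite /E; ring.
  rewrite s2; have := sqr_ge0 (c i2 * B); have := sqr_ge0 (z i1 * B).
  by have := sqr_ge0 (z i1 * D); rewrite exprMn; lra.
have ce := cvg_elec; have cm := cvg_magn.
have lim : (4 * pi)^-1 * (- (\sum_i (t `^ (p3 - p i) * c i) * (t `^ lam * elec w i (pt t (pos t)))) ^+ 2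
    + \sum_i (nu t * (t `^ lam * elec w i (pt t (pos t)))
         + \sum_j (t `^ (p3 - p j) * c j) * (t `^ lam * magn w j i (pt t (pos t)))) ^+ 2
    + 2^-1 * (t `^ p3) ^+ 2 * (2^-1 * (\sum_j \sum_k (t `^ lam * magn w j k (pt t (pos t))) ^+ 2)
       - \sum_i (t `^ lam * elec w i (pt t (pos t))) ^+ 2)) @[t --> 0^'+] -->
  (4 * pi)^-1 * (- (\sum_i z i * elec_limit i) ^+ 2
    + \sum_i (- s * elec_limit i + \sum_j z j * magn_limit j i) ^+ 2
    + 2^-1 * 0 ^+ 2 * (2^-1 * (\sum_j \sum_k (magn_limit j k) ^+ 2) - \sum_i (elec_limit i) ^+ 2)).
  apply: cvgM; first exact: cvg_cst.
  apply: cvgD; first apply: cvgD.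
  - apply: cvgN; apply: cvg_sqr; apply: cvg_sumr => i; apply: cvgM; [exact: cz|exact: ce].
  - apply: cvg_sumr => i; apply: cvg_sqr; apply: cvgD; first by apply: cvgM.
    by apply: cvg_sumr => j; apply: cvgM; [exact: cz|exact: cm].
  - apply: cvgM; first by apply: cvgM; [exact: cvg_cst|exact: cvg_sqr].
    apply: cvgB; last by apply: cvg_sumr => i; apply: cvg_sqr; exact: ce.
    apply: cvgM; first exact: cvg_cst.
    by apply: cvg_sumr => j; apply: cvg_sumr => k; apply: cvg_sqr; exact: cm.
apply: cvg_trans lim; apply: near_eq_cvg; near=> t.
have t0 : 0 < t by near: t; exact: nbhs_right_gt.
have Ux := spacetime_pt (pos t) t0.
have zE i : vel t 0 (lift ord0 i) = tpow (- p i) (pt t (pos t)) * (t `^ (- p i) * c i).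
  by rewrite pt_space mxE tpow_pt !(powR_ln _ t0) mulrA -expRD mulrC; congr (expR _ * _); ring.
have RE := rescaled_energy (t `^ lam) (t `^ p3) Ux (gdot_velocity _ _ t0)
  (ext_d_anti omega _) (fun i => elecE i Ux) (fun j k => magnE j k Ux) zE.
have sz i : t `^ p3 * (t `^ (- p i) * c i) = t `^ (p3 - p i) * c i.
  by rewrite !(powR_ln _ t0) mulrA -expRD mulrBl mulNr.
move: RE; rewrite /nu !sum3 !sz => <-; congr (_ * _).
rewrite !(powR_ln _ t0) -expRD -expRM_natl; congr expR.
case: hp => _ _ hs _; have -> : 1 - p1 = p2 + p3 by lra. ring.
Unshelve. all: by end_near. Qed.

End EnergyBlowUp.

(** * Blow-up along almost every geodesic of a given solution *)

Section AlmostEveryGeodesic.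
Variables (R : realType) (p1 p2 p3 : R).
Hypothesis hp : kasner_exponents p1 p2 p3.
Hypothesis hflat : p3 < 1.
Local Notation p := (kexp p1 p2 p3).
Local Notation lam := (1 - p1).
Local Notation g := (kasner_metric p1 p2 p3).
Local Notation U := (@spacetime R).
Local Notation pt := (@spacetime_point R).
Local Notation affine_parameter := (affine_parameter p1 p2 p3).
Local Notation mR := (measurableTypeR R).
Let i0 : 'I_3 := ord0.
Let i1 : 'I_3 := lift ord0 ord0.
Let i2 : 'I_3 := lift ord0 (lift ord0 ord0).

Variables (w : state R) (K : R) (omega : 'rV[R]_4 -> 'rV[R]_4).
Hypotheses (W : maxwell p w) (b : data_bound w 7 K) (K0 : 0 <= K).
Hypothesis elecE : forall x i, U x ->
  elec w i x = tpow (- p i) x * ext_d omega x ord0 (lift ord0 i).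
Hypothesis magnE : forall x j k, U x ->
  magn w j k x = tpow (- p j) x * (tpow (- p k) x * ext_d omega x (lift ord0 j) (lift ord0 k)).

Lemma cvg_t_to_0 (Phi E : R -> R) (l : R) I (gamma : R -> 'rV[R]_4) :
  Phi t @[t --> 0^'+] --> l ->
  (forall s, I s -> 0 < gamma s 0 0 /\ E s = Phi (gamma s 0 0)) ->
  E @ t_to_0 I gamma --> l.
Proof.
move=> cl H A /cl [e /= e0 eA]; exists e => //= s [Is se] /=.
have [t0 ->] := H s Is; apply: eA => //=.
by rewrite sub0r normrN gtr0_norm.
Qed.

Lemma blows_up_geodesic I gamma s0 :
  timelike_geodesic p1 p2 p3 I gamma -> I s0 ->
  momentum p1 p2 p3 gamma s0 i2 != 0 ->
  profile p1 (elec w i0) (endpoint p1 p2 p3 (momentum p1 p2 p3 gamma s0)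
    (ln (gamma s0 0 ord0)) (base_point gamma s0)) != 0 ->
  blows_up_like (2 * p2 + 4 * p3) I gamma (energy_density p1 p2 p3 omega gamma).
Proof.
set c := momentum _ _ _ _ _; set u0 := ln _; set x0 := base_point _ _ => geo I0 c2 D0.
have GE u := timelike_geodesicE geo I0 u; rewrite -/c -/u0 -/x0 in GE.
have b4 : data_bound w 4 K by move=> f cf l x x1 l4; apply: b => //; exact: leq_trans l4 _.
have [l l0 cl] := energy_blowup hp hflat W b4 K0 elecE magnE c2 D0.
split.
  apply: filter_from_proper.
    apply: filter_from_filter; first by exists 1 => /=.
    move=> d d' /= d0 d'0; exists (Num.min d d'); first by rewrite lt_min d0.
    by move=> s [Is]; rewrite lt_min => /andP[].
  (* The point with [t = d / 2] shows that the filter is proper. *)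
  move=> d /= d0; have [Is gE _] := GE (ln (d / 2)).
  exists (affine_parameter c u0 s0 (ln (d / 2))); split=> //.
  by rewrite gE pt_time lnK ?posrE ?divr_gt0 //; lra.
exists l => //; apply: (cvg_t_to_0 cl) => s Is; have [[_ _ _ H] _] := geo.1.
have [t0 _ _ _] := H s Is; split=> //.
have sE := affine_ln_t geo I0 Is; rewrite -/c -/u0 in sE.
have [_] := GE (ln (gamma s 0 ord0)); rewrite sE lnK ?posrE //.
by rewrite /energy_density; move: (gamma s 0 ord0) => t -> ->.
Qed.

Local Notation F l := (profile p1 (dxs l (elec w i0))).

Let damped_elec0 : damped p1 p2 p3 w lam (elec w i0).
Proof. by left; exists i0. Qed.

Lemma almost_every_blows_up (d tstar : R) : 0 < d -> 0 < tstar ->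
  (forall y, F [::] y = 0 -> ~ flat (fun l => F l) d y) ->
  almost_every_timelike_geodesic p1 p2 p3 tstar
    (fun I gamma => blows_up_like (2 * p2 + 4 * p3) I gamma
       (energy_density p1 p2 p3 omega gamma)).
Proof.
move=> d0 t0 nf.
pose a k := tstar `^ (2 * p k).
pose Y k (v : mR * mR * mR) : mR := drift p1 p2 p3 (vmom a v) (ln tstar) k.
have mY k : measurable_fun setT (Y k) by exact: measurable_drift.
split.
  move=> _ [I [gamma [s [geo Is gs -> _]]]]; rewrite /unit_past /=.
  by have [_ /(_ s Is) []] := geo.
pose M := decay_const R * K.
have M0 : 0 <= M by rewrite mulr_ge0 // C0_ge0.
have FL l y i s : (size l <= 3)%N ->
    `|F l (y + s *: delta_mx 0 i) - F l y| <= M * `|s|.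
  by move=> l3; apply: (profile_lipschitz hp hflat _ _ _ W b K0 _ damped_elec0);
    rewrite -(leq_add2r 4) in l3.
have FT l y i s : (size l <= 2)%N ->
    `|F l (y + s *: delta_mx 0 i) - F l y - s * F (i :: l) y| <= M * s ^+ 2.
  by move=> l3; apply: (profile_taylor hp hflat _ _ _ W b K0 _ damped_elec0);
    rewrite -(leq_add2r 5) in l3.
have N0 := null_nonflat_zeros M0 FL FT mY (ltW d0).
(* An exceptional geodesic has third velocity component 0 or ends at a zero of the profile, and such
   a zero is not flat by [nf]. *)
apply: negligibleS (lebesgue6U (null_last_zero R) N0).
move=> _ [_ [I [gamma [s [geo Is gs -> nQ]]]] <-].
have ch : shifted_base Y (unit_past_chart (gamma s, derive1 gamma s)) =
    endpoint p1 p2 p3 (momentum p1 p2 p3 gamma s) (ln (gamma s 0 ord0)) (base_point gamma s).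
  have o1 : (1 : 'I_4) = lift ord0 i0 by apply: val_inj.
  have o2 : (2 : 'I_4) = lift ord0 i1 by apply: val_inj.
  have o3 : (3 : 'I_4) = lift ord0 i2 by apply: val_inj.
  rewrite /unit_past_chart /shifted_base o3 o2 o1; apply/rowP => k.
  rewrite [LHS]mxE [RHS]mxE mxE /Y gs; congr (_ + drift _ _ _ _ _ _).
    by case: (I3P k) => ->.
  apply/funext => j; rewrite /vmom /momentum /tpow gs.
  by case: (I3P j) => ->.
apply: contrapT => H; apply: nQ; apply: (blows_up_geodesic geo Is).
  have Us : U (gamma s) by have [[[_ _ _ h] _] _] := geo; have [] := h s Is.
  apply: mulf_neq0; first exact: lt0r_neq0 (tpow_gt0 _ Us).
  apply/eqP => v0; apply: H; left; rewrite /= -[RHS]v0; congr (derive1 gamma s 0 _).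
  exact: val_inj.
rewrite -ch; apply/eqP => F0; apply: H; right; exact: (conj F0 (nf _ F0)).
Qed.

End AlmostEveryGeodesic.

(** * Initial data *)

#[local] Transparent partial.

Section Components.
Variables (R : realType) (n m : nat) (S : set 'rV[R]_n).
Hypothesis openS : open S.
Implicit Types (f : 'rV[R]_n -> 'rV[R]_m).

Lemma partials_component f alpha x (a : 'I_m) : smooth_on S f -> S x ->
  partials alpha f x 0 a = partials alpha (fun y => f y 0 a) x.
Proof.
move=> sf; elim: alpha x => //= i alpha IH x Sx.
rewrite -(partial_eq_in openS i IH Sx) /partial derive_mx ?mxE //.
by have [_] := sf alpha x Sx; exact.
Qed.

Lemma smooth_on_component f (a : 'I_m) : smooth_on S f ->
  smooth_on S (fun y => f y 0 a).
Proof.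
move=> sf alpha x Sx.
have E y : S y -> partials alpha f y 0 a = partials alpha (fun y => f y 0 a) y.
  exact: partials_component.
have [c d] := sf alpha x Sx; split.
  apply: (continuous_eq_in openS E Sx).
  exact: (continuous_comp c (@coord_continuous _ _ _ _ _ _)).
move=> i; apply: (derivable_eq_in openS E Sx).
by have /derivable_mxP := d i; exact.
Qed.

End Components.

Section AddConstant.
Variables (R : realType) (n m : nat).
Implicit Types (f : 'rV[R]_n -> 'rV[R]_m) (v : 'rV[R]_m).

Lemma partial_addc (W : normedModType R) (f : 'rV[R]_n -> W) (v : W) i :
  partial i (fun y => f y + v) = partial i f.
Proof.
apply/funext => x; rewrite /partial /derive /=.
suff -> : (fun h : R => h^-1 *: (f (h *: delta_mx 0 i + x) + v - (f x + v))) =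
    (fun h : R => h^-1 *: (f (h *: delta_mx 0 i + x) - f x)) by [].
by apply/funext => h; rewrite opprD addrACA subrr addr0.
Qed.

Lemma partials_addc f v alpha : partials alpha (fun y => f y + v) =
  if alpha is [::] then (fun y => f y + v) else partials alpha f.
Proof.
case/lastP: alpha => // alpha i; rewrite /partials !foldr_rcons partial_addc.
by case: alpha.
Qed.

Lemma smooth_addc f v : smooth_on setT f -> smooth_on setT (fun y => f y + v).
Proof.
move=> sf alpha x _; rewrite partials_addc; case: alpha => [|i alpha]; last exact: sf.
have [c d] := sf [::] x I; split; first exact: (continuousD c (@cst_continuous _ _ v x)).
by move=> i; apply: derivableD; [exact: d|exact: derivable_cst].
Qed.

End AddConstant.

#[local] Opaque partial.

Section SmoothTopology.
Variable R : realType.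
Implicit Types (u v : torus_map R) (F : set_system (torus_map R)).

Definition jet_close (e : R) u v alpha :=
  forall y, `|partials alpha u y - partials alpha v y| < e.

Lemma jet_near u alpha (e : R) : 0 < e -> \forall v \near u, jet_close e u v alpha.
Proof.
move=> e0.
have c := @initial_continuous _ _ (@jet R) u.
have c2 := @proj_continuous _ (fun _ : seq 'I_3 => {uniform 'rV[R]_3 -> 'rV[R]_8}) alpha (jet u).
have := c _ (c2 [set h | forall y, `|partials alpha u y - h y| < e] _); apply.
apply/uniform_nbhs; exists [set q : 'rV[R]_8 * 'rV[R]_8 | ball q.1 e q.2]; split; first exact: (entourage_ball _ (PosNum e0)).
move=> h /= H y; have := H y I; rewrite -ball_normE /=; exact.
Qed.

(** There are only finitely many lists of length at most [N]; the induction intersects over the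
    first letter. *)
Lemma jets_near u (N : nat) (e : R) : 0 < e ->
  \forall v \near u, forall alpha, (size alpha <= N)%N -> jet_close e u v alpha.
Proof.
move=> e0.
have H (P : seq 'I_3 -> set (torus_map R)) : (forall alpha, \forall v \near u, P alpha v) ->
    \forall v \near u, forall alpha, (size alpha <= N)%N -> P alpha v.
  elim: N P => [|N IH] P nP.
    by near=> v => -[|//] _; near: v; exact: nP.
  have nP' alpha : \forall v \near u, forall i, P (i :: alpha) v.
    exact: (@filter_forall _ _ (fun i v => P (i :: alpha) v) (nbhs u)
      (nbhs_filter u) (fun i => nP (i :: alpha))).
  near=> v => -[_|i alpha] /=; first by near: v; exact: nP.
  rewrite ltnS => aN; have : forall alpha, (size alpha <= N)%N -> forall i, P (i :: alpha) v.
    by near: v; exact: IH.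
  by apply.
exact: H _ (fun alpha => jet_near u alpha e0).
Unshelve. all: by end_near. Qed.

Lemma jet_cvg F u : Filter F -> (forall alpha (e : R), 0 < e ->
    \forall v \near F, jet_close e u v alpha) ->
  F --> u.
Proof.
move=> FF H A [_ [[B oB <-] Bu BA]].
suff c : @jet R @ F --> jet u.
  by apply: filterS BA _; apply: c; exact: open_nbhs_nbhs.
apply/cvg_sup => alpha C [_ [[D oD <-] Du DC]].
have : nbhs (partials alpha u : {uniform 'rV[R]_3 -> 'rV[R]_8}) D.
  exact: open_nbhs_nbhs.
move=> /uniform_nbhs[E [entE ED]].
have [e /= e0 eE] : exists2 e : R, 0 < e &
   [set q : 'rV[R]_8 * 'rV[R]_8 | ball q.1 e q.2] `<=` E.
  by move: entE; rewrite -entourage_ballE => -[e /= e0 eE]; exists e.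
apply: filterS (H alpha e e0) => v uv; apply: DC; apply: ED => y _; apply: eE.
by rewrite /= -ball_normE; exact: uv.
Qed.

End SmoothTopology.

(** * Superposition of solutions and the explicit solution *)

Section LinearTheory.
Variables (R : realType) (p : 'I_3 -> R).
Local Notation U := (@spacetime R).
Local Notation pt := (@spacetime_point R).
Local Notation "''d_' a f" := (@partial R 4 R a f) (at level 10, a at level 8, f at level 9).
Implicit Types (v : 'I_4 -> 'rV[R]_4 -> R) (f : 'rV[R]_4 -> R) (c : R).

Definition potential v := [/\ forall a, field (v a),
  forall x, U x -> wave_time p v x = 0 & forall i x, U x -> wave_space p v i x = 0].

Lemma maxwell_potential v : potential v -> maxwell p (state_of p v).
Proof. by case=> Fv T S; exact: maxwell_state_of. Qed.

Lemma field_lin c f g : field f -> field g -> field (fun x => f x + c * g x).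
Proof. by move=> Ff Fg; apply: fieldD => //; apply: fieldM => //; exact: field_cst. Qed.

Lemma d_lin c f g a x : field f -> field g -> U x ->
  'd_a (fun x => f x + c * g x) x = 'd_a f x + c * 'd_a g x.
Proof.
move=> Ff Fg Ux; have Fc := fieldM (field_cst c) Fg.
by rewrite (dD _ Ff Fc Ux) (dM _ (field_cst c) Fg Ux) partial_cst mulr0 addr0.
Qed.

Lemma dd_lin c f g a b x : field f -> field g -> U x ->
  'd_b ('d_a (fun x => f x + c * g x)) x = 'd_b ('d_a f) x + c * 'd_b ('d_a g) x.
Proof.
move=> Ff Fg Ux; rewrite (d_eq (g := fun x => 'd_a f x + c * 'd_a g x) _ _ Ux).
  by apply: d_lin => //; exact: field_partial.
by move=> y; exact: d_lin.
Qed.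

Lemma dxs_lin c f g l x : field f -> field g -> U x ->
  dxs l (fun x => f x + c * g x) x = dxs l f x + c * dxs l g x.
Proof.
move=> Ff Fg; elim: l x => //= i l IH x Ux.
by rewrite (d_eq _ IH Ux) d_lin //; exact: field_dxs.
Qed.

Section Combination.
Variables (v w : 'I_4 -> 'rV[R]_4 -> R) (c : R).
Hypotheses (pv : potential v) (pw : potential w).
Let vw a x := v a x + c * w a x.

Let Fv a : field (v a). Proof. by case: pv. Qed.
Let Fw a : field (w a). Proof. by case: pw. Qed.

Lemma wave_time_lin x : U x ->
  wave_time p vw x = wave_time p v x + c * wave_time p w x.
Proof.
move=> Ux; rewrite /wave_time; set S := (X in _ + X = _).
set Sv := (X in _ = _ + X + c * _); set Sw := (X in _ = _ + c * (_ + X)).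
have -> : S = Sv + c * Sw.
  rewrite mulr_sumr -big_split; apply: eq_bigr => j _ /=.
  rewrite (dd_lin c (lift ord0 j) (lift ord0 j) (Fv ord0) (Fw ord0) Ux).
  by rewrite (d_lin c (lift ord0 j) (Fv (lift ord0 j)) (Fw (lift ord0 j)) Ux); pring.
rewrite (dd_lin c ord0 ord0 (Fv ord0) (Fw ord0) Ux).
by rewrite (d_lin c ord0 (Fv ord0) (Fw ord0) Ux) /vw; pring.
Qed.

Lemma wave_space_lin i x : U x ->
  wave_space p vw i x = wave_space p v i x + c * wave_space p w i x.
Proof.
move=> Ux; rewrite /wave_space; set S := (X in _ + X - _ = _).
set Sv := (X in _ = _ + X - _ + c * _); set Sw := (X in _ = _ + c * (_ + X - _)).
have -> : S = Sv + c * Sw.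
  rewrite mulr_sumr -big_split; apply: eq_bigr => j _ /=.
  rewrite (dd_lin c (lift ord0 j) (lift ord0 j) (Fv (lift ord0 i)) (Fw (lift ord0 i)) Ux).
  by pring.
rewrite (dd_lin c ord0 ord0 (Fv (lift ord0 i)) (Fw (lift ord0 i)) Ux).
rewrite (d_lin c ord0 (Fv (lift ord0 i)) (Fw (lift ord0 i)) Ux).
by rewrite (d_lin c (lift ord0 i) (Fv ord0) (Fw ord0) Ux); pring.
Qed.

Lemma potential_lin : potential vw.
Proof.
have [_ Tv Sv] := pv; have [_ Tw Sw] := pw; split.
- by move=> a; exact: field_lin.
- by move=> x Ux; rewrite wave_time_lin // Tv // Tw // mulr0 addr0.
- by move=> i x Ux; rewrite wave_space_lin // Sv // Sw // mulr0 addr0.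
Qed.

Lemma elec_lin i x : U x -> elec (state_of p vw) i x =
  elec (state_of p v) i x + c * elec (state_of p w) i x.
Proof.
move=> Ux; rewrite /=.
rewrite (d_lin c ord0 (Fv (lift ord0 i)) (Fw (lift ord0 i)) Ux).
by rewrite (d_lin c (lift ord0 i) (Fv ord0) (Fw ord0) Ux); pring.
Qed.

End Combination.

Definition monopotential (a : 'I_4) (m : R) (b : 'I_4) (x : 'rV[R]_4) : R :=
  (b == a)%:R * tpow m x.

Lemma field_monopotential a m b : field (monopotential a m b).
Proof. by apply: fieldM; [exact: field_cst|exact: field_tpow]. Qed.

Lemma d_monopotential a m b j x : U x -> 'd_j (monopotential a m b) x =
  (j == ord0)%:R * ((b == a)%:R * (m * tpow (m - 1) x)).
Proof.
move=> Ux; rewrite (dM _ (field_cst _) (field_tpow m) Ux) partial_cst mulr0 addr0.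
case: (unliftP ord0 j) => [k ->|->]; last by rewrite partial_tpow0 // mul1r.
by rewrite partial_tpow // mulr0 mul0r.
Qed.

Lemma dd_monopotential a m b j k x : U x -> 'd_k ('d_j (monopotential a m b)) x =
  (k == ord0)%:R * ((j == ord0)%:R * ((b == a)%:R * (m * ((m - 1) * tpow (m - 1 - 1) x)))).
Proof.
move=> Ux.
rewrite (d_eq (g := fun x => (j == ord0)%:R * m * monopotential a (m - 1) b x) _ _ Ux); last first.
  by move=> y Uy; rewrite d_monopotential // /monopotential; ring.
rewrite (dM _ (field_cst _) (field_monopotential a (m - 1) b) Ux) partial_cst mulr0 addr0.
by rewrite d_monopotential //; ring.
Qed.

(** For [t^m dx^i] the wave equation reads [m * (m - 2 p_i) = 0]; the root 0 has no electric field,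
    the root [2 p_i] does. *)
Lemma potential_power i : potential (monopotential (lift ord0 i) (2 * p i)).
Proof.
split=> [a|x Ux|j x Ux]; first exact: field_monopotential.
- rewrite /wave_time dd_monopotential // d_monopotential //.
  have -> : monopotential (lift ord0 i) (2 * p i) ord0 x = 0 by rewrite /monopotential mul0r.
  rewrite big1 => [|j _]; first by rewrite /=; ring.
  by rewrite dd_monopotential // d_monopotential //=; ring.
- rewrite /wave_space dd_monopotential // !d_monopotential //.
  rewrite big1 => [|k _]; last by rewrite dd_monopotential //= !(mul0r, mulr0).
  have -> : tpow (2 * p i - 1) x = tpow (2 * p i - 1 - 1) x * tpow 1 x.
    by rewrite -tpowD //; congr (tpow _ x); ring.
  have h : tpow (-1) x * tpow 1 x = 1 by rewrite -tpowD // addNr /tpow powRr0.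
  rewrite /= (inj_eq lift_inj); case: eqVneq => [->|_]; last by rewrite !(mul0r, mulr0); ring.
  rewrite !mul1r !mul0r !mulr0 subr0 addr0.
  transitivity ((tpow (-1) x * tpow 1 x - 1) * ((2 * p i - 1) * 2 * p i * tpow (2 * p i - 1 - 1) x)).
    by ring.
  by rewrite h subrr mul0r.
Qed.

Lemma dxs_pt l f y : field f -> dxs l f (pt 1 y) = partials l (fun y => f (pt 1 y)) y.
Proof.
move=> Ff; elim: l y => //= i l IH y; rewrite -(funext IH).
have := is_derive_space y i 0 (field_dxs l Ff) ltr01.
move/(is_derive_line (fun y => dxs l f (pt 1 y))); rewrite scale0r addr0.
by case.
Qed.

Definition bounded_data N f (k : R) := field f /\
  forall l (x : 'rV[R]_4), x 0 ord0 = 1 -> (size l <= N)%N -> `|dxs l f x| <= k.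

Let U1 (x : 'rV[R]_4) : x 0 ord0 = 1 -> U x.
Proof. by rewrite /spacetime /= => ->. Qed.

Lemma bounded_dataD N f g a b : bounded_data N f a -> bounded_data N g b ->
  bounded_data N (fun x => f x + g x) (a + b).
Proof.
move=> [Ff bf] [Fg bg]; split=> [|l x x1 lN]; first exact: fieldD.
rewrite dxsD //; last exact: U1.
by apply: le_trans (ler_normD _ _) _; apply: lerD; [exact: bf|exact: bg].
Qed.

Lemma bounded_dataB N f g a b : bounded_data N f a -> bounded_data N g b ->
  bounded_data N (fun x => f x - g x) (a + b).
Proof.
move=> [Ff bf] [Fg bg]; split=> [|l x x1 lN]; first exact: fieldB.
rewrite dxsB //; last exact: U1.
by apply: le_trans (ler_normB _ _) _; apply: lerD; [exact: bf|exact: bg].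
Qed.

Lemma bounded_data_tpow N m f a : bounded_data N f a ->
  bounded_data N (fun x => tpow m x * f x) a.
Proof.
move=> [Ff bf]; split=> [|l x x1 lN]; first exact: fieldM (field_tpow m) Ff.
rewrite dxs_tpowM //; last exact: U1.
have -> : tpow m x = 1 by rewrite /tpow -[x 0 0]/(x 0 ord0) x1 powR1.
by rewrite mul1r; exact: bf.
Qed.

(** All powers of [t] are 1 at time 1. The factor 5 is the number of terms in the divergence, and
    the extra derivative is the one inside the state. *)
Lemma data_bound_state v N (K : R) : (forall a, field (v a)) -> 0 <= K ->
  (forall a l y, (size l <= N.+1)%N ->
     `|partials l (fun y => v a (pt 1 y)) y| <= K /\
     `|partials l (fun y => 'd_ord0 (v a) (pt 1 y)) y| <= K) ->
  data_bound (state_of p v) N (5 * K).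
Proof.
move=> Fv K0 vK.
have ptE (x : 'rV[R]_4) : x 0 ord0 = 1 -> x = pt 1 (\row_i x 0 (lift ord0 i)).
  by move=> x1; apply: pt_eq => // i; rewrite mxE.
have b0 a : bounded_data N (v a) K.
  split=> // l x /ptE -> lN; rewrite dxs_pt //; exact: (vK a l _ (leqW lN)).1.
have bt a : bounded_data N ('d_ord0 (v a)) K.
  split=> [|l x /ptE -> lN]; first exact: field_partial.
  by rewrite dxs_pt; [exact: (vK a l _ (leqW lN)).2|exact: field_partial].
have bx a i : bounded_data N ('d_(lift ord0 i) (v a)) K.
  split=> [|l x /ptE -> lN]; first exact: field_partial.
  have -> : dxs l ('d_(lift ord0 i) (v a)) = dxs (rcons l i) (v a).
    by rewrite /dxs foldr_rcons.
  by rewrite dxs_pt //; apply: (vK a _ _ _).1; rewrite size_rcons.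
have done f k : bounded_data N f k -> k <= 5 * K ->
    forall l (x : 'rV[R]_4), x 0 0 = 1 -> (size l <= N)%N -> `|dxs l f x| <= 5 * K.
  by move=> [_ bf] kK l x x1 lN; apply: le_trans kK; exact: bf.
move=> f [[i ->]|[j [k ->]]|->].
- apply: (@done _ (K + K)); last by lra.
  by apply: bounded_data_tpow; apply: bounded_dataB.
- apply: (@done _ (K + K)); last by lra.
  by do 2 apply: bounded_data_tpow; apply: bounded_dataB.
- have bj j : bounded_data N (fun x => tpow (- p j) x * (tpow (- p j) x
      * 'd_(lift ord0 j) (v (lift ord0 j)) x)) K by do 2 apply: bounded_data_tpow.
  have -> : dive (state_of p v) = fun x =>
     ((tpow (- p ord0) x * (tpow (- p ord0) x * 'd_(lift ord0 ord0) (v (lift ord0 ord0)) x)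
     + tpow (- p (lift ord0 ord0)) x * (tpow (- p (lift ord0 ord0)) x
         * 'd_(lift ord0 (lift ord0 ord0)) (v (lift ord0 (lift ord0 ord0))) x))
     + tpow (- p (lift ord0 (lift ord0 ord0))) x * (tpow (- p (lift ord0 (lift ord0 ord0))) x
         * 'd_(lift ord0 (lift ord0 (lift ord0 ord0))) (v (lift ord0 (lift ord0 (lift ord0 ord0)))) x))
     - ('d_ord0 (v ord0) x + tpow (-1) x * v ord0 x).
    by apply/funext => x; rewrite /= sum3.
  apply: (@done _ (K + K + K + (K + K))); last by lra.
  apply: bounded_dataB; last by apply: bounded_dataD => //; exact: bounded_data_tpow.
  by apply: bounded_dataD; first apply: bounded_dataD; exact: bj.
Qed.

End LinearTheory.

Section TorusData.
Variable R : realType.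
Local Notation e i := (delta_mx 0 i : 'rV[R]_3).
Implicit Types (u : torus_map R) (g : 'rV[R]_3 -> R) (alpha : seq 'I_3).

Definition torus_function g := smooth_on setT g /\
  forall x i, g (x + (2 * pi) *: e i) = g x.

Lemma torus_function_partial g i : torus_function g -> torus_function (partial i g).
Proof.
move=> [sg pg]; split=> [|x j]; first exact: smooth_on_partial.
pose z := (2 * pi) *: e j.
have D := smooth_on_is_derive i sg (I : setT (x + z)).
have [_] := (is_derive_shift g z x (e i) (partial i g (x + z))).2 D.
by have -> : (fun y => g (y + z)) = g by apply/funext => y; exact: pg.
Qed.

Lemma torus_jet_function alpha g : torus_function g -> torus_function (partials alpha g).
Proof. by move=> tg; elim: alpha => //= i alpha; exact: torus_function_partial. Qed.

Lemma torus_function_bounded g : torus_function g -> exists K, forall y, `|g y| <= K.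
Proof.
move=> [sg pg].
pose C := [set v : 'rV[R]_3 | forall i, `[0, 2 * pi]%classic (v ord0 i)].
have cC : compact C.
  exact: (@rV_compact R 3 (fun=> `[0, 2 * pi]%classic) (fun=> @segment_compact _ _ _)).
have cg : {within C, continuous g}.
  by apply: continuous_subspaceT => y; exact: smooth_on_continuous sg I.
have [K [_ KP]] := compact_bounded (continuous_compact cg cC).
exists (K + 1) => y; rewrite -(@F_reduce R (fun=> g) (fun _ => pg) [::] y).
apply: KP; first by rewrite ltrDl.
exists (reduce y) => // i; rewrite /= in_itv /=.
by have /andP[-> /ltW ->] := reduceP y i.
Qed.

Lemma partials_rcons alpha i g : partials (rcons alpha i) g = partials alpha (partial i g).
Proof. by rewrite /partials foldr_rcons. Qed.

Lemma torus_function_jets N g : torus_function g ->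
  exists K, forall alpha y, (size alpha <= N)%N -> `|partials alpha g y| <= K.
Proof.
elim: N g => [|N IH] g tg; have [K0 K0P] := torus_function_bounded tg.
  by exists K0 => -[|//] y _; exact: K0P.
have [K KP] := choice (fun i => IH _ (torus_function_partial i tg)).
exists (K0 + \sum_i `|K i|) => alpha y.
case/lastP: alpha => [_|alpha i]; first by rewrite (le_trans (K0P y)) // lerDl sumr_ge0.
rewrite size_rcons ltnS partials_rcons => aN; apply: le_trans (KP i alpha y aN) _.
have K00 : 0 <= K0 by apply: le_trans (K0P y).
by rewrite (bigD1 i) //= (le_trans (ler_norm _)) // addrCA lerDl addr_ge0 // sumr_ge0.
Qed.

Lemma torus_component u b : torus_function (fun y => u y 0 b).
Proof.
split=> [|x i]; first exact: (smooth_on_component openT b (torus_smooth u)).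
by rewrite torus_periodic.
Qed.

Lemma torus_partials u alpha y b :
  partials alpha (fun y => u y 0 b) y = partials alpha u y 0 b.
Proof. by rewrite -(partials_component openT _ _ (torus_smooth u)). Qed.

Lemma torus_jets_bounded N u : exists2 K, 0 <= K & forall b alpha y,
  (size alpha <= N)%N -> `|partials alpha u y 0 b| <= K.
Proof.
have [K KP] := choice (fun b => torus_function_jets N (torus_component u b)).
exists (\sum_b `|K b|) => [|b alpha y aN]; first by rewrite sumr_ge0.
rewrite -torus_partials; apply: le_trans (KP b alpha y aN) _.
by rewrite (bigD1 b) //= (le_trans (ler_norm _)) // lerDl sumr_ge0.
Qed.

Lemma row_norm_ge n (x : 'rV[R]_n) b : `|x 0 b| <= `|x|.
Proof.
by rewrite [leRHS]/Num.norm /= mx_normrE; apply/bigmax_geP; right => /=; exists (0, b).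
Qed.

Lemma jet_closeP (eps : R) u v alpha y b : jet_close eps u v alpha ->
  `|partials alpha (fun y => u y 0 b - v y 0 b) y| <= eps.
Proof.
move=> uv.
have -> : partials alpha (fun y => u y 0 b - v y 0 b) y =
    partials alpha (fun y => u y 0 b) y - partials alpha (fun y => v y 0 b) y.
  elim: alpha y {uv} => //= i alpha IH y; rewrite (funext IH).
  have sg w := (torus_jet_function alpha (torus_component w b)).1.
  exact: (partialB openT i (sg u) (sg v) I).
rewrite !torus_partials.
have -> : partials alpha u y 0 b - partials alpha v y 0 b =
  (partials alpha u y - partials alpha v y) 0 b by rewrite !mxE.
by apply: le_trans (row_norm_ge _ _) _; exact: ltW (uv y).
Qed.

Definition add_constant u (v : 'rV[R]_8) : torus_map R :=
  @TorusMap R (fun y => u y + v)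
    (fun x i => congr1 (+%R^~ v) (torus_periodic u x i))
    (smooth_addc v (torus_smooth u)).

(** Derivatives of positive order do not change at all, so only the values have to be estimated. *)
Lemma add_constant_cvg u (v : 'rV[R]_8) : add_constant u (s *: v) @[s --> (0 : R)] --> u.
Proof.
apply: jet_cvg => alpha eps eps0.
suff : \forall s \near (0 : R), jet_close eps u (add_constant u (s *: v)) alpha by [].
have v1 : 0 < `|v| + 1 by rewrite ltr_wpDl.
have small : \forall s \near (0 : R), `|s| < eps / (`|v| + 1).
  by exists (eps / (`|v| + 1)) => [|s]; rewrite /= ?divr_gt0 // sub0r normrN.
near=> s => y; rewrite [partials _ (add_constant _ _)]partials_addc; case: alpha => [|i alpha]; last by rewrite subrr normr0.
rewrite /= opprD addrA subrr sub0r normrN normrZ.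
apply: (@le_lt_trans _ _ (`|s| * (`|v| + 1))); first by rewrite ler_wpM2l // lerDl.
by rewrite -ltr_pdivlMr //; near: s.
Unshelve. all: by end_near. Qed.

End TorusData.

(** * Perturbation of the data *)

Section Solutions.
Variables (R : realType) (p1 p2 p3 : R).
Hypothesis hp : kasner_exponents p1 p2 p3.
Hypothesis hflat : p3 < 1.
Local Notation p := (kexp p1 p2 p3).
Local Notation lam := (1 - p1).
Local Notation g := (kasner_metric p1 p2 p3).
Local Notation U := (@spacetime R).
Local Notation pt := (@spacetime_point R).
Local Notation C0 := (decay_const R).
Let i0 : 'I_3 := ord0.
Let a1 : 'I_4 := lift ord0 i0.
Implicit Types (omega : 'rV[R]_4 -> 'rV[R]_4) (u : torus_map R)
  (v : 'I_4 -> 'rV[R]_4 -> R) (l : seq 'I_3) (y : 'rV[R]_3).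

Definition solution omega u := [/\ one_form omega,
  forall x, U x -> box g omega x = 0 & has_data omega u].

Local Notation components omega := (fun a x => omega x 0 a : R).
Local Notation elec_profile v l := (profile p1 (dxs l (elec (state_of p v) i0))).

Lemma field_one_form omega a : one_form omega -> field (fun x => omega x 0 a).
Proof.
move=> [so po]; split; first exact: (smooth_on_component (@open_spacetime R) a so).
by move=> x i Ux; rewrite po.
Qed.

Lemma potential_one_form omega : one_form omega ->
  (forall x, U x -> box g omega x = 0) -> potential p (components omega).
Proof.
move=> om bo; have F a := field_one_form a om; have [_ _ s1 s2] := hp.
split=> // [x Ux|i x Ux].
  by rewrite -(box_time F s1 s2 Ux) bo // mxE.
by rewrite -(box_space F s1 i Ux) bo // mxE.
Qed.

Lemma data_value omega u a : has_data omega u ->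
  (fun y => omega (pt 1 y) 0 a) = fun y => u y 0 (lshift 4 a).
Proof. by move=> hu; apply/funext => y; rewrite hu; apply/esym; exact: row_mxEl. Qed.

Lemma data_rate omega u a : one_form omega -> has_data omega u ->
  (fun y => partial ord0 (fun x => omega x 0 a) (pt 1 y)) = fun y => u y 0 (rshift 4 a).
Proof.
move=> [so _] hu; apply/funext => y; rewrite hu.
rewrite -[LHS](partials_component (@open_spacetime R) [:: ord0] a so (spacetime_pt y ltr01)).
by apply/esym; exact: row_mxEr.
Qed.

(** Order 7 allows third derivatives of the profile, each with its Lipschitz bound (3 + 4), and
    costs 8 derivatives of the data. *)
Lemma solution_bound omega u : solution omega u ->
  exists2 K, 0 <= K & data_bound (state_of p (components omega)) 7 K.
Proof.
move=> [om bo hu]; have [K K0 KP] := torus_jets_bounded 8 u.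
exists (5 * K); first by rewrite mulr_ge0.
apply: data_bound_state => // [a|a l y l8]; first exact: field_one_form.
rewrite (data_value a hu) (data_rate a om hu) !torus_partials.
by split; exact: KP.
Qed.

Let damped_elec w : damped p1 p2 p3 w lam (elec w i0).
Proof. by left; exists i0. Qed.

Lemma solution_blows_up omega u (d tstar : R) : solution omega u -> 0 < d -> 0 < tstar ->
  (forall y, elec_profile (components omega) [::] y = 0 ->
     ~ flat (fun l => elec_profile (components omega) l) d y) ->
  almost_every_timelike_geodesic p1 p2 p3 tstar
    (fun I gamma => blows_up_like (2 * p2 + 4 * p3) I gamma
       (energy_density p1 p2 p3 omega gamma)).
Proof.
move=> su; have [om bo _] := su; have [K K0 b] := solution_bound su.
apply: (almost_every_blows_up hp hflat (maxwell_potential (potential_one_form om bo)) b K0).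
- by move=> x i _; rewrite mxE.
- by move=> x j k _; rewrite mxE.
Qed.

Lemma profile_periodic f y i : field f ->
  profile p1 f (y + (2 * pi) *: delta_mx 0 i) = profile p1 f y.
Proof.
move=> [_ per].
have E t : 0 < t -> f (pt t (y + (2 * pi) *: delta_mx 0 i)) = f (pt t y).
  by move=> t0; rewrite pt_shift per //; exact: spacetime_pt.
rewrite /profile; congr (lim _); rewrite eqEsubset; split; apply: near_eq_cvg; near=> t.
all: have t0 : 0 < t by near: t; exact: nbhs_right_gt.
all: by rewrite /= E.
Unshelve. all: by end_near. Qed.

(** The data at time 1 of [t^(2 p1) dx^1]: value 1 and rate [2 p1] in one component. *)
Definition perturbation : 'rV[R]_8 :=
  row_mx (delta_mx 0 a1 : 'rV[R]_4) ((2 * p1) *: delta_mx 0 a1 : 'rV[R]_4).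

Lemma perturbation_value (a : 'I_4) : perturbation 0 (lshift 4 a) = (a == a1)%:R.
Proof. by rewrite [LHS]row_mxEl mxE eqxx. Qed.

Lemma perturbation_rate (a : 'I_4) : perturbation 0 (rshift 4 a) = 2 * p1 * (a == a1)%:R.
Proof. by rewrite [LHS]row_mxEr !mxE eqxx. Qed.

Lemma add_constantE u (s : R) (v : 'rV[R]_8) y b :
  add_constant u (s *: v) y 0 b = u y 0 b + s * v 0 b.
Proof. by rewrite !mxE. Qed.

Lemma perturbation_constraints u (s : R) : constraints u ->
  constraints (add_constant u (s *: perturbation)).
Proof.
have d0 a : data0 (add_constant u (s *: perturbation)) a =
    fun x => data0 u a x + s * (a == a1)%:R.
  by apply/funext => x; rewrite /data0 add_constantE perturbation_value.
have d1 a : data1 (add_constant u (s *: perturbation)) a =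
    fun x => data1 u a x + s * (2 * p1 * (a == a1)%:R).
  by apply/funext => x; rewrite /data1 add_constantE perturbation_rate.
move=> cu x; have [c1 c2] := cu x; split.
  rewrite d0 d1 !mulr0 !addr0 -[RHS]c1; congr (_ + _).
  by apply: eq_bigr => i _; rewrite d0 partial_addc.
rewrite -[RHS]c2; apply: eq_bigr => i _.
rewrite -[in RHS](partial_addc _ (s * (2 * p1 * (lift ord0 i == a1)%:R))).
congr (partial i _ x); apply/funext => y.
by rewrite d0 d1 partial_addc addrAC.
Qed.

Lemma dxs_cst (c : R) l : dxs l (fun=> c) = fun=> (l == [::])%:R * c.
Proof.
elim: l => [|i l IH]; first by apply/funext => x; rewrite mul1r.
by apply/funext => x; rewrite /= IH partial_cst mul0r.
Qed.

(** The electric component of [t^(2 p1) dx^1] is [2 p1 t^(-lam)]: its weighted value is constant,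
    and nonzero as [p1 < 0]. *)
Lemma cvg_monopotential l y :
  t `^ lam * dxs l (elec (state_of p (monopotential a1 (2 * p1))) i0) (pt t y)
    @[t --> 0^'+] --> (l == [::])%:R * (2 * p1).
Proof.
apply: cvg_near_cst; near=> t.
have t0 : 0 < t by near: t; exact: nbhs_right_gt.
have Ux := spacetime_pt y t0.
rewrite (@dxs_eq _ l _ (fun x => tpow (p1 - 1) x * (2 * p1))) //; last first.
  move=> x Vx; rewrite /= !d_monopotential //= mul0r subr0 !mul1r.
  have -> : tpow (p1 - 1) x = tpow (- p1) x * tpow (2 * p1 - 1) x.
    by rewrite -tpowD //; congr (tpow _ x); ring.
  by rewrite /kexp /=; ring.
rewrite (dxs_tpowM _ _ (field_cst _) Ux) dxs_cst tpow_pt mulrA.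
by rewrite -(opprB 1 p1) powR_inv // mul1r.
Unshelve. all: by end_near. Qed.

(* The difference of the two sides is the profile of a solution with small
   data, to which the decay estimate applies. *)
Lemma elec_profile_perturbed omega omega' u u' (s eps : R) l y :
  solution omega u -> solution omega' u' -> 0 <= eps ->
  (forall alpha, (size alpha <= 8)%N ->
     jet_close eps (add_constant u' (s *: perturbation)) u alpha) ->
  (size l <= 3)%N ->
  `|elec_profile (components omega') l y + s * ((l == [::])%:R * (2 * p1))
    - elec_profile (components omega) l y| <= C0 * (5 * eps).
Proof.
move=> su su' eps0 close l3.
have [om bo hu] := su; have [K K0 b] := solution_bound su.
have [om' bo' hu'] := su'; have [K' K'0 b'] := solution_bound su'.
have pv := potential_one_form om bo; have pv' := potential_one_form om' bo'.
have W := maxwell_potential pv; have W' := maxwell_potential pv'.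
pose m := monopotential a1 (2 * p1).
have pm : potential p m by exact: (@potential_power R p i0).
pose q a x := omega' x 0 a + s * m a x.
have pq : potential p q by exact: (potential_lin s pv' pm).
pose dl a x := q a x + (-1) * omega x 0 a.
have pd : potential p dl by exact: (potential_lin (-1) pq pv).
have l7 : (size l + 4 <= 7)%N by exact: (leq_add l3 (leqnn 4)).
have c := @cvg_profile_dxs _ _ _ _ hp hflat _ _ _ l y _ W b K0 l7 (damped_elec _).
have c' := @cvg_profile_dxs _ _ _ _ hp hflat _ _ _ l y _ W' b' K'0 l7 (damped_elec _).
have cm := @cvg_monopotential l y.
have bd : data_bound (state_of p dl) 7 (5 * eps).
  have [Fd _ _] := pd; apply: (data_bound_state Fd eps0) => a alpha z az.
  have E0 : (fun y => dl a (pt 1 y)) = fun y =>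
      add_constant u' (s *: perturbation) y 0 (lshift 4 a) - u y 0 (lshift 4 a).
    apply/funext => x; rewrite /dl /q /m /monopotential tpow_pt powR1 mulr1.
    have -> := congr1 (@^~ x) (data_value a hu); have -> := congr1 (@^~ x) (data_value a hu').
    by rewrite add_constantE perturbation_value mulN1r.
  have E1 : (fun y => partial ord0 (dl a) (pt 1 y)) = fun y =>
      add_constant u' (s *: perturbation) y 0 (rshift 4 a) - u y 0 (rshift 4 a).
    apply/funext => x; have U1 := spacetime_pt x ltr01.
    have [Fq _ _] := pq; have Fo := field_one_form a om; have Fo' := field_one_form a om'.
    have Fm := field_monopotential a1 (2 * p1) a.
    rewrite (d_lin (-1) ord0 (Fq a) Fo U1) (d_lin s ord0 Fo' Fm U1).
    rewrite d_monopotential // tpow_pt powR1 mulr1.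
    have -> := congr1 (@^~ x) (data_rate a om hu); have -> := congr1 (@^~ x) (data_rate a om' hu').
    by rewrite add_constantE perturbation_rate mulN1r mul1r [_ * (2 * p1)]mulrC.
  by rewrite E0 E1; split; apply: jet_closeP; exact: close.
have Wd := maxwell_potential pd.
have ce : 0 <= 5 * eps by rewrite mulr_ge0.
have := profile_le hp hflat y Wd bd ce l7 (damped_elec _).
suff -> : elec_profile dl l y = elec_profile (components omega') l y
    + s * ((l == [::])%:R * (2 * p1)) - elec_profile (components omega) l y by [].
apply: profileE.
have cc : t `^ lam * dxs l (elec (state_of p (components omega')) i0) (pt t y)
    + s * (t `^ lam * dxs l (elec (state_of p m) i0) (pt t y))
    - t `^ lam * dxs l (elec (state_of p (components omega)) i0) (pt t y) @[t --> 0^'+] -->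
    elec_profile (components omega') l y + s * ((l == [::])%:R * (2 * p1))
    - elec_profile (components omega) l y.
  by apply: cvgB c; apply: cvgD c' _; apply: cvgM cm; exact: cvg_cst.
apply: cvg_trans cc; apply: near_eq_cvg; near=> t.
have t0 : 0 < t by near: t; exact: nbhs_right_gt.
have Ux := spacetime_pt y t0.
have Fe v (pv0 : potential p v) := field_elec (maxwell_potential pv0) i0.
rewrite (dxs_eq l (fun x Vx => elec_lin (-1) pq pv i0 Vx) Ux).
rewrite (dxs_lin (-1) l (Fe _ pq) (Fe _ pv) Ux).
rewrite (dxs_eq l (fun x Vx => elec_lin s pv' pm i0 Vx) Ux).
rewrite (dxs_lin s l (Fe _ pv') (Fe _ pm) Ux).
move: (dxs l _ _) (dxs l _ _) (dxs l _ _) => A B C; ring.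
Unshelve. all: by end_near. Qed.

End Solutions.

Theorem theorem5p6 (R : realType) (p1 p2 p3 : R)
    (hp : kasner_exponents p1 p2 p3) (hflat : p3 < 1) :
  exists A : set (torus_map R),
    open_dense_in (@constraint_solutions R) A /\
    forall (omega : 'rV[R]_4 -> 'rV[R]_4) (u : torus_map R),
      one_form omega ->
      (forall x, spacetime x -> box (kasner_metric p1 p2 p3) omega x = 0) ->
      has_data omega u -> A u ->
      forall tstar : R, 0 < tstar ->
        almost_every_timelike_geodesic p1 p2 p3 tstar
          (fun I gamma => blows_up_like (2 * p2 + 4 * p3) I gamma
             (energy_density p1 p2 p3 omega gamma)).
Proof.
pose good u := forall omega, solution p1 p2 p3 omega u -> forall tstar, 0 < tstar ->
  almost_every_timelike_geodesic p1 p2 p3 tstar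
    (fun I gamma => blows_up_like (2 * p2 + 4 * p3) I gamma
       (energy_density p1 p2 p3 omega gamma)).
pose S := @constraint_solutions R.
(* The neighbourhood [B] is part of the definition, so that [V] is open by construction. *)
pose V := [set u : torus_map R | exists B : set (torus_map R),
  [/\ open B, B u & forall u', B u' -> S u' -> good u']].
have oV : open V.
  rewrite openE => u [B [oB Bu Bg]]; rewrite /interior.
  apply: filterS (open_nbhs_nbhs (conj oB Bu)) => u' Bu'.
  by exists B.
exists (V `&` S); split; last first.
  move=> omega u om bo hu [[B [_ Bu Bg]] Su] tstar t0.
  by apply: (Bg u Bu Su omega) => //; split.
split; first by exists V.
move=> u Su B; rewrite nbhsE => -[Q [oQ Qu] QB].
(* If no constrained datum in [Q] has a solution, all of them are good vacuously and [u] itself lies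
   in [V]. *)
have [[u' [Qu' Su' [omega' sol']]]|none] :=
    pselect (exists u', [/\ Q u', S u' & exists omega, solution p1 p2 p3 omega u']); last first.
  exists u; split; last exact: QB.
  split=> //; exists Q; split=> // u' Qu' Su' omega sol; exfalso; apply: none.
  by exists u'; split=> //; exists omega.
have n1 := kasner_p1_lt0 hp hflat.
have [om' bo' _] := sol'; have [K' K'0 b'] := solution_bound sol'.
have W' := maxwell_potential (potential_one_form hp om' bo').
set F := fun l => profile p1 (dxs l (elec (state_of (kexp p1 p2 p3)
  (fun a x => omega' x 0 a)) ord0)).
have df : damped p1 p2 p3 (state_of (kexp p1 p2 p3) (fun a x => omega' x 0 a)) (1 - p1)
    (elec (state_of (kexp p1 p2 p3) (fun a x => omega' x 0 a)) ord0).
  by left; exists ord0.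
pose M := decay_const R * K'.
have M0 : 0 <= M by rewrite mulr_ge0 // C0_ge0.
have FL l y i s : (size l <= 3)%N ->
    `|F l (y + s *: delta_mx 0 i) - F l y| <= M * `|s|.
  by move=> l3; exact: (profile_lipschitz hp hflat _ _ _ W' b' K'0 (leq_add l3 (leqnn 4)) df).
have FT l y i s : (size l <= 2)%N ->
    `|F l (y + s *: delta_mx 0 i) - F l y - s * F (i :: l) y| <= M * s ^+ 2.
  by move=> l2; exact: (profile_taylor hp hflat _ _ _ W' b' K'0 (leq_add l2 (leqnn 5)) df).
have FP l y i : F l (y + (2 * pi) *: delta_mx 0 i) = F l y.
  exact: profile_periodic (field_dxs l (field_elec W' ord0)).
pose pert := perturbation p1.
have [r r0 rQ] : exists2 r : R, 0 < r & forall s, `|s| < r -> Q (add_constant u' (s *: pert)).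
  have := @add_constant_cvg R u' pert Q (open_nbhs_nbhs (conj oQ Qu')).
  move=> [r /= r0 rQ]; exists r => // s sr; apply: rQ.
  by rewrite /= sub0r normrN.
have eps0 : 0 < - (2 * p1) * r by rewrite mulr_gt0 //; lra.
have [c [d [/andP[c0 cr] d0 nf]]] := exists_nonflat_shift M0 FL FT FP eps0.
(* The multiple of the explicit solution that shifts the profile by exactly [c]. *)
pose s := c / (2 * p1).
have p10 : 2 * p1 < 0 by lra.
have sc : s * (2 * p1) = c by rewrite divfK // lt_eqF.
pose u2 := add_constant u' (s *: pert).
have Qu2 : Q u2.
  apply: rQ; rewrite /s normrM normfV (gtr0_norm c0) ltr0_norm //.
  by rewrite ltr_pdivrMr ?oppr_gt0 // mulrC.
have C00 := C0_ge0 R.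
(* The factor 5 of [elec_profile_perturbed] turns this into an error of at most [d / 4]; [C0 + 1]
   keeps the denominator positive. *)
pose e := d / (20 * (decay_const R + 1)).
have C1 : 0 < decay_const R + 1 by lra.
have e0 : 0 < e by rewrite divr_gt0 // mulr_gt0.
have de : decay_const R * (5 * e) <= d / 2.
  have -> : decay_const R * (5 * e) = d * (decay_const R / (decay_const R + 1)) / 4.
    by rewrite /e; field; rewrite gt_eqF.
  have h : decay_const R / (decay_const R + 1) <= 1 by rewrite ler_pdivrMr // mul1r lerDl.
  have := ler_wpM2l (ltW d0) h; rewrite mulr1; lra.
exists u2; split; last exact: QB.
split; last exact: perturbation_constraints.
have : nbhs u2 [set w | forall alpha, (size alpha <= 8)%N -> jet_close e u2 w alpha].
  exact: jets_near.
rewrite nbhsE => -[B2 [oB2 B2u2] B2e].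
exists B2; split=> // w /B2e wclose Sw omega sol tstar t0.
(* The profile of [omega'], shifted by [c], serves as the profile belonging to the data [u2]. *)
have close l y l3 := @elec_profile_perturbed _ _ _ _ hp hflat _ _ _ _ _ _ l y sol sol' (ltW e0) wclose l3.
apply: (solution_blows_up hp hflat sol (d := d / 2)) => // [|y]; first by rewrite divr_gt0.
set G := fun l => profile p1 (dxs l (elec (state_of (kexp p1 p2 p3)
  (fun a x => omega x 0 a)) ord0)).
rewrite -/(G [::]) => G0 fl.
(* A zero of [G] is a near-zero of [F [::] + c], and flatness of [G] up to [d / 2] is flatness of
   [F] up to [d]; [nf] excludes the combination. *)
have F0 : `|F [::] y + c| <= d.
  have := close [::] y isT; rewrite -/(F [::]) -/(G [::]) G0 subr0 mul1r sc.
  by move=> h; apply: le_trans h _; lra.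
apply: (nf y F0) => l /andP[l1 l3].
have := close l y l3; rewrite -/(F l) -/(G l).
have -> : (l == [::]) = false by case: (l) l1.
rewrite mul0r mulr0 addr0 => h; have := fl l; rewrite l1 l3 => /(_ isT) gl.
have -> : F l y = (F l y - G l y) + G l y by rewrite subrK.
by apply: le_trans (ler_normD _ _) _; move: gl; rewrite -/(G l) => gl; lra.
Qed.
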